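(* There exists an algorithm for dynamic subset sum whose amortized processing time per operation is bounded by $O\!\left(1 + \mathsf{t}_{\mathsf{max}}^{5/3} \log^2 \mathsf{t}_{\mathsf{max}} \log \mathsf{oprs}/\mathsf{oprs}\right)$, where $\mathsf{oprs}$ is the number of operations. The algorithm answers each query operation correctly with probability at least $1-1/\mathsf{t}_{\mathsf{max}}^3$.
   Context: Dynamic subset sum: an integer upper bound $\mathsf{t}_{\mathsf{max}}$ is given to the algorithm in advance, and a multiset of items (with non-negative integer weights) is initially empty. Operations arrive one at a time (online) and each is either (1) an insertion operation, which adds an item of a given non-negative integer weight $w$ to the multiset (items may have equal weights), or (2) a query operation, which gives an integer $t$ with $0 \le t \le \mathsf{t}_{\mathsf{max}}$ and asks whether there is a sub-multiset of the current items whose weights sum to exactly $t$; the answer must be produced before the next operation is revealed. $\mathsf{oprs}$ denotes the total number of operations; it is not known to the algorithm in advance. The amortized processing time is the total running time over all operations divided by $\mathsf{oprs}$. *)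

(* Defs.v *)
From HB Require Import structures.
From mathcomp Require Import all_boot all_order all_algebra.
From mathcomp Require Import all_classical all_reals all_analysis.
Set Implicit Arguments.
Unset Strict Implicit.
Unset Printing Implicit Defensive.
Import Order.TTheory GRing.Theory Num.Theory.
Local Open Scope nat_scope.

(** * Dynamic subset sum *)

Inductive operation : Type :=
| Insert of nat
| Query of nat.

(* Multisets are sequences up to order; zero weights and repetitions are kept,
   and sub-multisets are exactly the subsequences up to order. *)
Definition inserted (ops : seq operation) : seq nat :=
  pmap (fun o => if o is Insert w then Some w else None) ops.

Definition subset_sum (items : seq nat) (t : nat) : Prop :=
  exists2 B : seq nat, subseq B items & sumn B = t.

(** * Randomized word RAM

    Algorithms are finite programs of a while-language over a word RAM.  The
    word size W is not a constant of the program: every computed value is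
    reduced modulo 2 ^ W, so that charging one step per operation on words is
    meaningful.  There are the finitely many variables named in the program and
    one random-access memory, indexed by words and initially zero. *)

Inductive binop : Type :=
| OpAdd | OpSub | OpMul | OpDiv | OpMod | OpLt | OpEq
| OpAnd | OpOr | OpXor | OpShl | OpShr.

Inductive expr : Type :=
| Lit of nat
| Var of nat
| Fetch of expr
| Bin of binop & expr & expr.

Inductive program : Type :=
| Skip
| Assign of nat & expr            (* variable := expression *)
| Store of expr & expr            (* memory[address] := value *)
| Rand of nat                     (* variable := uniformly random word *)
| Seq of program & program
| If of expr & program & program
| While of expr & program.

(* [drawn] counts the random words consumed so far. *)
Record state : Type := State {
  vars : nat -> nat;
  memory : nat -> nat;
  drawn : nat
}.

(* Subtraction is truncated, and a %/ 0 = 0, a %% 0 = a. *)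
Definition apply_binop (o : binop) (a b : nat) : nat :=
  match o with
  | OpAdd => a + b
  | OpSub => a - b
  | OpMul => a * b
  | OpDiv => a %/ b
  | OpMod => a %% b
  | OpLt => a < b
  | OpEq => a == b
  | OpAnd => Nat.land a b
  | OpOr => Nat.lor a b
  | OpXor => Nat.lxor a b
  | OpShl => a * 2 ^ b
  | OpShr => a %/ 2 ^ b
  end.

Fixpoint eval (W : nat) (s : state) (e : expr) : nat :=
  match e with
  | Lit n => n %% 2 ^ W
  | Var x => vars s x
  | Fetch a => memory s (eval W s a)
  | Bin o e1 e2 => apply_binop o (eval W s e1) (eval W s e2) %% 2 ^ W
  end.

Fixpoint ecost (e : expr) : nat :=
  match e with
  | Lit _ | Var _ => 1
  | Fetch a => (ecost a).+1
  | Bin _ e1 e2 => (ecost e1 + ecost e2).+1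
  end.

Definition set_var (s : state) (x v : nat) : state :=
  State [eta vars s with x |-> v] (memory s) (drawn s).

Definition set_mem (s : state) (a v : nat) : state :=
  State (vars s) [eta memory s with a |-> v] (drawn s).

Notation word W := 'I_(2 ^ W).

(* [exec tape p s n s']: with random words supplied by [tape], running p from
   s halts in s' after n elementary steps. *)
Inductive exec (W : nat) (tape : nat -> word W) :
    program -> state -> nat -> state -> Prop :=
| ExecSkip s : exec tape Skip s 1 s
| ExecAssign s x e :
    exec tape (Assign x e) s (ecost e).+1 (set_var s x (eval W s e))
| ExecStore s a e :
    exec tape (Store a e) s (ecost a + ecost e).+1
      (set_mem s (eval W s a) (eval W s e))
| ExecRand s x :
    exec tape (Rand x) s 1
      (State [eta vars s with x |-> val (tape (drawn s))] (memory s) (drawn s).+1)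
| ExecSeq p q s n s' m s'' :
    exec tape p s n s' -> exec tape q s' m s'' ->
    exec tape (Seq p q) s (n + m) s''
| ExecIfTrue e p q s n s' :
    eval W s e != 0 -> exec tape p s n s' ->
    exec tape (If e p q) s (ecost e + n).+1 s'
| ExecIfFalse e p q s n s' :
    eval W s e = 0 -> exec tape q s n s' ->
    exec tape (If e p q) s (ecost e + n).+1 s'
| ExecWhileTrue e p s n s' m s'' :
    eval W s e != 0 -> exec tape p s n s' -> exec tape (While e p) s' m s'' ->
    exec tape (While e p) s (ecost e + n + m).+1 s''
| ExecWhileFalse e p s :
    eval W s e = 0 -> exec tape (While e p) s (ecost e).+1 s.

(** * Online processing of a sequence of operations

    Initially variable 0 holds the upper bound on queries and everything else
    is 0.  The program is run once per operation, keeping its whole state in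
    between: variable 1 is set to the kind of the operation (0 for an insertion,
    1 for a query), variable 2 to its argument, and the answer (meaningful for
    queries only) is read in variable 3 when the program halts.  Hence an
    answer is produced before the next operation is seen, and the number of
    operations is never communicated. *)

Definition initial_state (tmax : nat) : state :=
  State [eta fun=> 0 with 0 |-> tmax] (fun=> 0) 0.

Definition present (o : operation) (s : state) : state :=
  match o with
  | Insert w => set_var (set_var s 1 0) 2 w
  | Query t => set_var (set_var s 1 1) 2 t
  end.

(* [serves tape p s ops n answers s']: all of ops is processed from s, in n
   steps in total, with one entry of answers per operation. *)
Inductive serves (W : nat) (tape : nat -> word W) (p : program) :
    state -> seq operation -> nat -> seq bool -> state -> Prop :=
| ServesNil s : serves tape p s [::] 0 [::] s
| ServesCons s o ops n s' m answers s'' :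
    exec tape p (present o s) n s' ->
    serves tape p s' ops m answers s'' ->
    serves tape p s (o :: ops) (n + m) ((vars s' 3 != 0) :: answers) s''.

Definition admissible (tmax W : nat) (o : operation) : bool :=
  match o with
  | Insert w => w < 2 ^ W
  | Query t => t <= tmax
  end.

(** * Probability over the random words *)

Lemma pow2_gt0 (W : nat) : 0 < 2 ^ W.
Proof. by rewrite expn_gt0. Qed.

Definition tape_of (W N : nat) (f : {ffun 'I_N -> word W}) : nat -> word W :=
  fun k => if insub k is Some i then f i else Ordinal (pow2_gt0 W).

(* Probability of E when the first N words of the tape are independent and
   uniform; only used for events that do not look at later words. *)
Definition tape_prob (R : realType) (W N : nat)
    (E : (nat -> word W) -> Prop) : R :=
  (#|[set f : {ffun 'I_N -> word W} | `[< E (tape_of f) >]]|%:R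
     / #|{ffun 'I_N -> word W}|%:R)%R.

(* With this tape, p processes all of ops1 ++ Query t :: ops2, drawing at most
   N random words, and answers the displayed query correctly. *)
Definition answers_correctly (W : nat) (p : program) (tmax : nat)
    (ops1 : seq operation) (t : nat) (ops2 : seq operation) (N : nat)
    (tape : nat -> word W) : Prop :=
  exists n answers s,
    [/\ serves tape p (initial_state tmax) (ops1 ++ Query t :: ops2)
          n answers s,
        drawn s <= N
      & nth false answers (size ops1) <-> subset_sum (inserted ops1) t].

(* Main.v *)
Require Import Defs.
From HB Require Import structures.
From mathcomp Require Import all_boot all_order all_algebra.
From mathcomp Require Import all_classical all_reals all_analysis.
From mathcomp Require Import zify ring lra.
Import Order.TTheory GRing.Theory Num.Theory.
Local Open Scope ring_scope.

(* The set of subset sums up to T = tmax only grows, so there are at most T + 1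
   insertions that yield new sums; and once inserting w yields nothing, the set is
   closed under adding w and stays so.  Hence O(T) insertions need any work.

   To find the new sums x + w quickly, a snapshot of the set is cut into about
   T^(1/3) blocks of length about T^(2/3), and for every block and every weight w
   one keeps the number of x in the block whose translate x + w is not in the
   snapshot.  Correcting this number by the sums found after the snapshot, which
   are kept in a list, tells whether the block contains an x for which x + w is
   new; only such blocks are scanned, and each scan is paid for by a new sum.  When
   the list reaches length about T^(2/3), the snapshot is renewed.  This happens at
   most about T^(1/3) times, and each time the counters are recomputed with one
   convolution of length O(T) per block.

   The convolutions are computed exactly modulo an odd Q > T + 1 by Nussbaumer's
   method, which needs no roots of unity in Z/Q: a polynomial of degree < n = m r
   modulo X^n + 1 is regarded as a polynomial of degree < m in X over the ring
   (Z/Q)[Y]/(Y^r + 1), where Y = X^m serves as a root of unity, and one recurses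
   with r about the square root of n.  Correctness is checked by evaluating at an
   element x of a commutative ring with x^n = -1.

   The algorithm is deterministic, so its answers are correct with probability 1. *)

(** * Structured programs on the word RAM *)

(** Balance of costs, with M the block length. Each of the O(T) tests compares T/M counters and
    corrects them by fewer than M recent sums, and each new sum pays for at most one scan of length
    M: O(T M + T^2/M) in all. Each of the T/M rebuilds takes T/M convolutions. Padding doubles the
    data at each of the about log log T levels of Nussbaumer's recursion, so a convolution costs O(T
    log^2 T), and all rebuilds together O(T^3/M^2 log^2 T). The terms T M and T^3/M^2 agree at M =
    T^(2/3), whence the exponent 5/3.

    The bound degenerates in two places. At oprs = 1 its logarithm vanishes, so the first operation
    must take constant time, which leaves no room even for setting up tables: an insertion is only
    recorded, and its work, including initialisation, is left to the next operation. At tmax = 1 the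
    other logarithm vanishes; there the whole work is bounded by a constant and is charged to the
    operations. Otherwise the factor log oprs enters only through ln oprs >= ln 2. *)

Section StructuredPrograms.
Local Open Scope nat_scope.

Inductive aexpr : Type :=
| Cst of nat
| Get of nat
| Elt of nat & aexpr
| Op of binop & aexpr & aexpr.

Inductive cmd : Type :=
| Nop
| Let of nat & aexpr
| Put of nat & aexpr & aexpr
| Then of cmd & cmd
| Cond of aexpr & cmd & cmd
| Loop of aexpr & cmd.

Record astate : Type := AState { va : nat -> nat; ar : nat -> nat -> nat }.

(** Variables and arrays are named by numerals and compared with [eqn], so that [/=] decides which
    one is meant; indices are symbolic and compared with [==]. *)
Definition updv (s : astate) (x v : nat) : astate :=
  AState (fun y => if eqn y x then v else va s y) (ar s).

Definition upda (s : astate) (j i v : nat) : astate :=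
  AState (va s) (fun j' => if eqn j' j
    then (fun i' => if i' == i then v else ar s j i') else ar s j').

Fixpoint aev (s : astate) (e : aexpr) : nat :=
  match e with
  | Cst n => n
  | Get x => va s x
  | Elt j e => ar s j (aev s e)
  | Op o e1 e2 => apply_binop o (aev s e1) (aev s e2)
  end.

(* The arrays are interleaved: entry i of array j sits at address 16 i + j, so
   that no layout depending on their sizes is needed. *)
Fixpoint comp_expr (e : aexpr) : expr :=
  match e with
  | Cst n => Lit n
  | Get x => Var x
  | Elt j e => Fetch (Bin OpAdd (Bin OpMul (Lit 16) (comp_expr e)) (Lit j))
  | Op o e1 e2 => Bin o (comp_expr e1) (comp_expr e2)
  end.

Fixpoint compile (c : cmd) : program :=
  match c with
  | Nop => Skip
  | Let x e => Assign x (comp_expr e)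
  | Put j i e =>
      Store (Bin OpAdd (Bin OpMul (Lit 16) (comp_expr i)) (Lit j)) (comp_expr e)
  | Then c1 c2 => Defs.Seq (compile c1) (compile c2)
  | Cond e c1 c2 => If (comp_expr e) (compile c1) (compile c2)
  | Loop e c => While (comp_expr e) (compile c)
  end.

Definition conc (s : astate) : state :=
  State (va s) (fun a => ar s (a %% 16) (a %/ 16)) 0.

(** The exponent of X in the bound on values. The two units of a fetch cover the computation of its
    address 16 i + j. *)
Fixpoint asize (e : aexpr) : nat :=
  match e with
  | Cst _ | Get _ => 1
  | Elt _ e => (asize e).+2
  | Op _ e1 e2 => asize e1 + asize e2
  end.

(* Left shifts are excluded: their results are not polynomial in the operands,
   which [aev_le] requires. *)
Definition tame (o : binop) : bool :=
  match o with
  | OpAdd | OpSub | OpMul | OpDiv | OpMod | OpLt | OpEq => true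
  | _ => false
  end.

Fixpoint tame_expr (e : aexpr) : bool :=
  match e with
  | Cst n => n <= 64
  | Get _ => true
  | Elt j e => (j < 16) && tame_expr e
  | Op o e1 e2 => [&& tame o, tame_expr e1 & tame_expr e2]
  end.

Definition small_expr (e : aexpr) : bool := tame_expr e && (asize e <= 38).

Fixpoint small_cmd (c : cmd) : bool :=
  match c with
  | Nop => true
  | Let _ e => small_expr e
  | Put j i e => [&& j < 16, small_expr i & small_expr e]
  | Then c1 c2 => small_cmd c1 && small_cmd c2
  | Cond e c1 c2 => [&& small_expr e, small_cmd c1 & small_cmd c2]
  | Loop e c => small_expr e && small_cmd c
  end.

Definition bounded (X : nat) (s : astate) : Prop :=
  (forall x, va s x <= X) /\ (forall j i, ar s j i <= X).

(* A tick is one command or loop test.  The bound X on all values written, with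
   that on the size of expressions, excludes overflow. *)
Inductive arun (X : nat) : cmd -> astate -> nat -> astate -> Prop :=
| RunNop s : arun X Nop s 1 s
| RunLet s x e : aev s e <= X -> arun X (Let x e) s 1 (updv s x (aev s e))
| RunPut s j i e : aev s e <= X ->
    arun X (Put j i e) s 1 (upda s j (aev s i) (aev s e))
| RunThen c1 c2 s n s1 m s2 :
    arun X c1 s n s1 -> arun X c2 s1 m s2 -> arun X (Then c1 c2) s (n + m) s2
| RunCondT e c1 c2 s n s1 :
    aev s e != 0 -> arun X c1 s n s1 -> arun X (Cond e c1 c2) s n.+1 s1
| RunCondF e c1 c2 s n s1 :
    aev s e = 0 -> arun X c2 s n s1 -> arun X (Cond e c1 c2) s n.+1 s1
| RunLoopT e c s n s1 m s2 :
    aev s e != 0 -> arun X c s n s1 -> arun X (Loop e c) s1 m s2 ->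
    arun X (Loop e c) s (n + m).+1 s2
| RunLoopF e c s : aev s e = 0 -> arun X (Loop e c) s 1 s.

Lemma asize_gt0 e : 0 < asize e.
Proof. by elim: e => //= *; lia. Qed.

(** Sizes add where bounds multiply; as both bounds are at least 64, their product also dominates
    sums, quotients, remainders and truth values. *)
Lemma aev_le {X s} e : 64 <= X -> bounded X s -> tame_expr e ->
  aev s e <= X ^ asize e.
Proof.
move=> X64 [bv ba]; have X1 : 1 < X by lia.
elim: e => [n|x|j e IH|o e1 IH1 e2 IH2] /=.
- by rewrite expn1 => /leq_trans; apply.
- by rewrite expn1.
- move=> _; apply: leq_trans (ba _ _) _; rewrite -{1}[X]expn1 leq_exp2l //.
move=> /and3P[to /IH1 {}IH1 /IH2 {}IH2].
have p1 : 0 < X ^ asize e1 by rewrite expn_gt0 ltnW.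
have p2 : 0 < X ^ asize e2 by rewrite expn_gt0 ltnW.
have s1 := asize_gt0 e1.
have s2 := asize_gt0 e2.
have q1 : 64 <= X ^ asize e1.
  by apply: leq_trans X64 _; rewrite -{1}[X]expn1 leq_exp2l //.
have q2 : 64 <= X ^ asize e2.
  by apply: leq_trans X64 _; rewrite -{1}[X]expn1 leq_exp2l //.
rewrite expnD; move: (X ^ asize e1) (X ^ asize e2) p1 p2 q1 q2 IH1 IH2.
move: (aev s e1) (aev s e2) => a b A B p1 p2 q1 q2 aA bB.
have AB : A <= A * B by rewrite leq_pmulr.
case: o to => //= _.
- by nia.
- by lia.
- by rewrite leq_mul.
- by apply: leq_trans AB; apply: leq_trans aA; apply: leq_div.
- by apply: leq_trans AB; apply: leq_trans aA; apply: leq_mod.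
- by case: (a < b); nia.
- by case: (a == b); nia.
Qed.

(** The exponent 40 is 38 for the largest expression plus 2 for the address 16 v + j of an index
    v. *)
Definition fits (W X : nat) : bool := X ^ 40 < 2 ^ W.

(** * Simulation by the word RAM *)

Section Simulation.
Variables (W X : nat) (tape : nat -> word W).
Hypotheses (X64 : 64 <= X) (XW : fits W X).

Let X1 : 1 < X.
Proof. by apply: leq_trans X64. Qed.

Let ltW k v : k <= 40 -> v <= X ^ k -> v < 2 ^ W.
Proof.
move=> k40 vX; apply: leq_ltn_trans XW; apply: leq_trans vX _.
by rewrite leq_exp2l.
Qed.

Let ltW_addr v j k : k <= 38 -> v <= X ^ k -> j < 16 -> 16 * v + j < 2 ^ W.
Proof.
move=> k38 vX j16; apply: (@ltW k.+2) => //.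
have : 0 < X ^ k by rewrite expn_gt0 ltnW.
rewrite !expnS; move: (X ^ k) vX => Y vY Y0.
apply: (@leq_trans (64 * (64 * Y))); first by clear -j16 vY Y0; lia.
by rewrite !leq_mul.
Qed.

Lemma eval_comp s e : bounded X s -> small_expr e ->
  Defs.eval W (conc s) (comp_expr e) = aev s e.
Proof.
move=> bs /andP[]; elim: e => [n|x|j e IH|o e1 IH1 e2 IH2] //=.
- by move=> n64 _; rewrite modn_small //; apply: (@ltW 1) => //; lia.
- case/andP=> j16 te se.
  rewrite IH // ?(leq_trans _ se) ?leqnSn //; last by lia.
  have v_le := aev_le _ X64 bs te.
  have aj : 16 * aev s e + j < 2 ^ W by apply: (@ltW_addr _ _ (asize e)) => //; rewrite -ltnS -ltnS (leq_trans se).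
  have l16 : 16 < 2 ^ W by apply: (@ltW 1) => //; lia.
  rewrite (modn_small l16) (@modn_small (16 * _)); last by lia.
  rewrite (@modn_small j); last by lia.
  rewrite (modn_small aj); congr (ar s _ _); lia.
- case/and3P=> to t1 t2 se.
  rewrite IH1 ?IH2 //; first last.
  + by rewrite (leq_trans _ se) // leq_addr.
  + by rewrite (leq_trans _ se) // leq_addl.
  rewrite modn_small //; apply: (@ltW (asize (Op o e1 e2))) => /=; first by lia.
  have := @aev_le X s (Op o e1 e2) X64 bs; rewrite /= to t1 t2; exact.
Qed.

Lemma ecost_comp e : ecost (comp_expr e) < 6 * asize e.
Proof. by elim: e => [n|x|j e IH|o e1 IH1 e2 IH2] //=; lia. Qed.

Lemma arun_bounded {c s n s'} : arun X c s n s' -> bounded X s -> bounded X s'.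
Proof.
elim=> {c s n s'} //=; try by auto.
- move=> s x e le [bv ba]; split=> //= y; by case: eqn.
- move=> s j i e le [bv ba]; split=> //= j' i'.
  by case: eqn => //; case: eqP.
Qed.

Lemma eval_addr s j i : bounded X s -> j < 16 -> small_expr i ->
  Defs.eval W (conc s) (Bin OpAdd (Bin OpMul (Lit 16) (comp_expr i)) (Lit j))
    = 16 * aev s i + j.
Proof.
move=> bs j16 si; rewrite /= (eval_comp _ _ bs si).
case/andP: si => ti i38.
have aj : 16 * aev s i + j < 2 ^ W.
  by apply: (@ltW_addr _ _ (asize i)) => //; apply: aev_le.
have l16 : 16 < 2 ^ W by apply: (@ltW 1) => //; lia.
rewrite (modn_small l16) (@modn_small (16 * _)); last by lia.
by rewrite (@modn_small j) ?(modn_small aj) //; lia.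
Qed.

(** The dearest tick is a [Put]: two expressions of cost below 6 * 38 = 228 each and the address
    arithmetic stay below 500. *)
Lemma arun_exec {c s n s'} : arun X c s n s' -> small_cmd c -> bounded X s ->
  exists2 t, exec tape (compile c) (conc s) t (conc s') & t <= 500 * n.
Proof.
elim=> {c s n s'} /=.
- by move=> s _ _; exists 1 => //; exact: ExecSkip.
- move=> s x e le se bs; exists (ecost (comp_expr e)).+1.
    suff -> : conc (updv s x (aev s e)) =
      set_var (conc s) x (Defs.eval W (conc s) (comp_expr e)) by exact: ExecAssign.
    rewrite (eval_comp _ _ bs se); congr State; apply/funext => y /=.
  have := ecost_comp e; case/andP: se; lia.
- move=> s j i e le /and3P[j16 si se] bs.
  exists (ecost (Bin OpAdd (Bin OpMul (Lit 16) (comp_expr i)) (Lit j))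
          + ecost (comp_expr e)).+1.
    set a := Bin OpAdd _ _.
    suff -> : conc (upda s j (aev s i) (aev s e)) =
      Defs.set_mem (conc s) (Defs.eval W (conc s) a) (Defs.eval W (conc s) (comp_expr e))
      by exact: ExecStore.
    rewrite (eval_comp _ _ bs se) eval_addr //; congr State; apply/funext => y /=.
    case: eqnP => [ej|ne]; last first.
      by case: eqP => // ey; case: ne; lia.
    case: eqP => [ei|nei]; first by case: eqP => // ny; case: ny; lia.
    by rewrite ej; case: eqP => // ey; case: nei; lia.
  rewrite /=; have := ecost_comp e; have := ecost_comp i; case/andP: se; case/andP: si; lia.
- move=> c1 c2 s n s1 m s2 r1 IH1 r2 IH2 /andP[g1 g2] bs.
  have [t1 x1 l1] := IH1 g1 bs.
  have [t2 x2 l2] := IH2 g2 (arun_bounded r1 bs).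
  by exists (t1 + t2); [exact: ExecSeq x1 x2 | lia].
- move=> e c1 c2 s n s1 ne r IH /and3P[se g1 _] bs.
  have [t x l] := IH g1 bs; exists (ecost (comp_expr e) + t).+1.
    by apply: ExecIfTrue x; rewrite (eval_comp _ _ bs se).
  have := ecost_comp e; case/andP: se; lia.
- move=> e c1 c2 s n s1 ne r IH /and3P[se _ g2] bs.
  have [t x l] := IH g2 bs; exists (ecost (comp_expr e) + t).+1.
    by apply: ExecIfFalse x; rewrite (eval_comp _ _ bs se).
  have := ecost_comp e; case/andP: se; lia.
- move=> e c s n s1 m s2 ne r1 IH1 r2 IH2 g bs; case/andP: (g) => se gc.
  have [t1 x1 l1] := IH1 gc bs.
  have [t2 x2 l2] := IH2 g (arun_bounded r1 bs).
  exists (ecost (comp_expr e) + t1 + t2).+1.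
    by apply: ExecWhileTrue x1 x2; rewrite (eval_comp _ _ bs se).
  have := ecost_comp e; case/andP: se; lia.
- move=> e c s e0 /andP[se _] bs; exists (ecost (comp_expr e)).+1.
    by apply: ExecWhileFalse; rewrite (eval_comp _ _ bs se).
  have := ecost_comp e; case/andP: se; lia.
Qed.

End Simulation.


(** * Weakest preconditions for total correctness, with tick counts *)

Definition wp (X : nat) (c : cmd) (s : astate) (Q : nat -> astate -> Prop) :=
  exists n s', arun X c s n s' /\ Q n s'.

Lemma wp_nop X s Q : Q 1 s -> wp X Nop s Q.
Proof. by move=> q; exists 1, s; split=> //; exact: RunNop. Qed.

Lemma wp_let X x e s (Q : nat -> astate -> Prop) :
  aev s e <= X -> Q 1 (updv s x (aev s e)) -> wp X (Let x e) s Q.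
Proof. by move=> le q; exists 1, (updv s x (aev s e)); split=> //; exact: RunLet. Qed.

Lemma wp_put X j i e s (Q : nat -> astate -> Prop) :
  aev s e <= X -> Q 1 (upda s j (aev s i) (aev s e)) -> wp X (Put j i e) s Q.
Proof. by move=> le q; eexists _, _; split; [exact: RunPut|]. Qed.

Lemma wp_then X c1 c2 s Q :
  wp X c1 s (fun n s1 => wp X c2 s1 (fun m s2 => Q (n + m) s2)) ->
  wp X (Then c1 c2) s Q.
Proof.
move=> [n [s1 [r1 [m [s2 [r2 q]]]]]]; exists (n + m), s2; split=> //.
exact: RunThen r1 r2.
Qed.

Lemma wp_cond X e c1 c2 s (Q : nat -> astate -> Prop) :
  (aev s e != 0 -> wp X c1 s (fun n => Q n.+1)) ->
  (aev s e = 0 -> wp X c2 s (fun n => Q n.+1)) -> wp X (Cond e c1 c2) s Q.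
Proof.
move=> h1 h2; have [e0|ne] := eqVneq (aev s e) 0.
  by have [n [s1 [r q]]] := h2 e0; exists n.+1, s1; split=> //; exact: RunCondF.
by have [n [s1 [r q]]] := h1 ne; exists n.+1, s1; split=> //; exact: RunCondT.
Qed.

Lemma wp_mono X c s (Q Q' : nat -> astate -> Prop) :
  wp X c s Q -> (forall n s', Q n s' -> Q' n s') -> wp X c s Q'.
Proof. by move=> [n [s' [r q]]] h; exists n, s'; split=> //; exact: h. Qed.

Definition For (x : nat) (e : aexpr) (c : cmd) : cmd :=
  Then (Let x (Cst 0)) (Loop (Op OpLt (Get x) e)
    (Then c (Let x (Op OpAdd (Get x) (Cst 1))))).

(** [J i n] records the ticks n spent on the first i rounds, two per round being the test and the
    increment; the 2 added for [Q] are the initial assignment and the failing test. *)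
Lemma wp_for (N : nat) (J : nat -> nat -> astate -> Prop) X x e c s
    (Q : nat -> astate -> Prop) :
  N <= X ->
  J 0 0 (updv s x 0) ->
  (forall i n s', i <= N -> J i n s' -> va s' x = i /\ aev s' e = N) ->
  (forall i n s', i < N -> J i n s' ->
     wp X c s' (fun m s'' =>
       va s'' x = i /\ J i.+1 (n + m + 2) (updv s'' x i.+1))) ->
  (forall n s', J N n s' -> Q (n + 2) s') ->
  wp X (For x e c) s Q.
Proof.
move=> NX J0 Jx Jb JN.
suff run i n s' : i <= N -> J i n s' ->
    exists m s'', arun X (Loop (Op OpLt (Get x) e)
      (Then c (Let x (Op OpAdd (Get x) (Cst 1))))) s' m s''
      /\ exists2 k, k + 1 = n + m & J N k s''.
  have [m [s'' [r [k ek jk]]]] := run 0 0 _ (leq0n _) J0.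
  exists (1 + m), s''; split; first by apply: RunThen r; exact: RunLet.
  by have -> : 1 + m = k + 2; [lia | exact: JN].
move=> iN; move: {2}(N - i) (leqnn (N - i)) => d; elim: d i n s' iN => [|d IH] i n s' iN di J1.
  have ei : i = N by lia.
  have [vx ve] := Jx _ _ _ iN J1; exists 1, s'; split.
    by apply: RunLoopF => /=; rewrite vx ve ei ltnn.
  by exists n; rewrite // -ei.
have [vx ve] := Jx _ _ _ iN J1.
have [eN|neN] := eqVneq i N.
  exists 1, s'; split; last by exists n; rewrite // -eN.
  by apply: RunLoopF => /=; rewrite vx ve eN ltnn.
have ltN : i < N by lia.
have [m [s1 [r [vx1 J2]]]] := Jb _ _ _ ltN J1.
have [|m' [s2 [r' [k ek jk]]]] := IH _ _ _ ltN _ J2; first by lia.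
exists (m + 1 + m').+1, s2; split; last by exists k => //; lia.
apply: RunLoopT r'; first by rewrite /= vx ve ltN.
apply: RunThen r _.
have -> : i.+1 = aev s1 (Op OpAdd (Get x) (Cst 1)) by rewrite /= vx1 addn1.
by apply: RunLet; rewrite /= vx1; lia.
Qed.

End StructuredPrograms.

(** * Fast negacyclic convolution *)

Section Radix2.
Variables (E : comNzRingType) (hf : E).
Hypothesis hf2 : hf *+ 2 = 1.

(** A Gentleman-Sande butterfly of stride H on an unbounded sequence: the bit of g at H tells the
    half of its block of length 2 H, and all blocks are transformed at once. *)
Definition fwdE (H : nat) (z : E) (f : nat -> E) (g : nat) : E :=
  if ((g %/ H) %% 2 == 0)%N then f g + f (g + H)%N
  else (f (g - H)%N - f g) * z ^+ (g %% H).

Definition bwdE (H : nat) (z : E) (f : nat -> E) (g : nat) : E :=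
  hf * (if ((g %/ H) %% 2 == 0)%N then f g + f (g + H)%N * z ^+ (g %% H)
        else f (g - H)%N - f g * z ^+ (g %% H)).

Lemma bit_add (H g : nat) : (0 < H)%N -> ((g %/ H) %% 2 = 0)%N ->
  [/\ ((g + H) %/ H) %% 2 = 1, (g + H) %% H = g %% H & g + H - H = g]%N.
Proof. by move=> H0 e; rewrite divnDr // divnn H0 modnDr addnK; split=> //; lia. Qed.

Lemma bit_sub (H g : nat) : (0 < H)%N -> ((g %/ H) %% 2 != 0)%N ->
  [/\ ((g - H) %/ H) %% 2 = 0, (g - H) %% H = g %% H & g - H + H = g]%N.
Proof.
move=> H0 e; have Hg : (H <= g)%N.
  by rewrite leqNgt; apply/negP => /divn_small e0; rewrite e0 in e.
have eg : (g - H + H = g)%N by rewrite subnK.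
have := modnDr (g - H) H; have := divnDr (g - H) (dvdnn H).
by rewrite eg divnn H0 => e1 e2; split=> //; lia.
Qed.

Lemma fwdEK H z zi f g : (0 < H)%N -> z * zi = 1 ->
  bwdE H zi (fwdE H z f) g = f g.
Proof.
move=> H0 zzi; have zk k : z ^+ k * zi ^+ k = 1 by rewrite -exprMn zzi expr1n.
rewrite /bwdE /fwdE; case: eqP => [e|/eqP ne].
  have [e1 e2 e3] := bit_add _ _ H0 e.
  rewrite e1 e2 e3 /= -mulrA zk mulr1 -[RHS]mul1r -hf2; ring.
have [e1 e2 e3] := bit_sub _ _ H0 ne.
rewrite e1 e2 e3 /= -mulrA zk mulr1 -[RHS]mul1r -hf2; ring.
Qed.

Variables (h : nat) (z zi : nat -> E).
Hypothesis zzi : forall s, (s <= h)%N -> z s * zi s = 1.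
Hypothesis zN1 : forall s, (s <= h)%N -> z s ^+ (2 ^ s) = -1.

Fixpoint DFT (i : nat) (f : nat -> E) : nat -> E :=
  if i is i'.+1 then fwdE (2 ^ (h - i')) (z (h - i')) (DFT i' f) else f.

Fixpoint IDFT (i : nat) (f : nat -> E) : nat -> E :=
  if i is i'.+1 then bwdE (2 ^ i') (zi i') (IDFT i' f) else f.

(** The inverse stages take the strides in the opposite order, so each cancels the last forward
    stage still in force. Only 1/2 and inverses of the twiddles are needed. *)
Lemma DFTK i f : (i <= h.+1)%N -> IDFT i (DFT h.+1 f) =1 DFT (h.+1 - i) f.
Proof.
elim: i => [|i IH] ih g; first by rewrite subn0.
rewrite /= -/(DFT h.+1 f).
have -> : (h.+1 - i.+1 = h - i)%N by lia.
have e : (h.+1 - i = (h - i).+1)%N by lia.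
have ei : (h - (h - i) = i)%N by lia.
rewrite -(@fwdEK (2 ^ i) (z i) (zi i) (DFT (h - i) f) g) ?expn_gt0 ?zzi //.
have IH' := IH (ltnW ih); rewrite e /= ei in IH'.
by rewrite /bwdE !IH'.
Qed.

(* The point at which output g evaluates its block, in bit-reversed order. *)
Fixpoint rho (s g : nat) : E :=
  if s is s'.+1 then
    if ((g %/ 2 ^ s') %% 2 == 0)%N then rho s' g else z s' * rho s' g
  else 1.

Lemma rho_unity s g : (s <= h.+1)%N -> rho s g ^+ (2 ^ s) = 1.
Proof.
elim: s => [|s IH] sh //=.
have {}IH := IH (ltnW sh); rewrite expnS mulnC exprM.
case: eqP => _; first by rewrite IH expr1n.
by rewrite exprMn IH zN1 // mulr1 sqrrN expr1n.
Qed.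

(** A stage of stride H = 2^s reduces a block of length 2 H modulo X^H - 1 in its lower half and
    modulo X^H + 1 in its upper half, where X is also scaled by z. Since [rho] has H-th power 1 and
    z has H-th power -1, evaluation does not see the reduction. *)
Lemma DFT_partial s f g : (s <= h.+1)%N ->
  DFT h.+1 f g = \sum_(j < 2 ^ s)
    DFT (h.+1 - s) f (g %/ 2 ^ s * 2 ^ s + j)%N * rho s g ^+ j.
Proof.
elim: s g => [|s IH] g sh.
  by rewrite big_ord1 expr0 mulr1 subn0 addn0 -[(2 ^ 0)%N]/1%N divn1 muln1.
rewrite IH 1?ltnW //; set H := (2 ^ s)%N; have H0 : (0 < H)%N by rewrite expn_gt0.
have -> : (h.+1 - s = (h.+1 - s.+1).+1)%N by lia.
set F := DFT (h.+1 - s.+1) f; rewrite /= -/F.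
have -> : (h - (h.+1 - s.+1) = s)%N by lia.
rewrite -/H expnS mul2n -addnn big_split_ord /= -/H.
have rH : rho s g ^+ H = 1 by apply: rho_unity; rewrite ltnW.
have gH : (g %/ (H + H) = (g %/ H) %/ 2)%N by rewrite addnn -mul2n mulnC divnMA.
have blk (j : 'I_H) : ((g %/ H * H + j) %/ H = g %/ H)%N /\
    ((g %/ H * H + j) %% H = j)%N.
  by rewrite divnMDl // (divn_small (ltn_ord j)) addn0 modnMDl modn_small.
rewrite -big_split /=; case: eqP => e.
  have b : (g %/ (H + H) * (H + H) = g %/ H * H)%N by rewrite gH; lia.
  apply: eq_bigr => j _; have [b1 b2] := blk j.
  rewrite /fwdE b1 e eqxx b exprD rH mul1r -mulrDl.
  by congr ((_ + F _) * _); lia.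
have b : (g %/ (H + H) * (H + H) + H = g %/ H * H)%N.
  rewrite gH {2}(divn_eq (g %/ H) 2) (_ : (g %/ H) %% 2 = 1)%N; last by lia.
  by rewrite mulnDl mul1n -mulnA mul2n addnn.
apply: eq_bigr => j _; have [b1 b2] := blk j.
rewrite /fwdE b1 b2; case: eqP => // _.
rewrite exprMn exprD exprMn zN1 // rH mulr1 mulN1r exprMn -b.
have -> : (g %/ (H + H) * (H + H) + H + j - H = g %/ (H + H) * (H + H) + j)%N by rewrite addnAC addnK.
have -> : (g %/ (H + H) * (H + H) + (H + j) = g %/ (H + H) * (H + H) + H + j)%N by rewrite addnA.
by rewrite mulrN mulrBl mulrBl -!mulrA.
Qed.

Lemma DFT_eval f g : DFT h.+1 f g =
  (\poly_(j < 2 ^ h.+1) f (g %/ 2 ^ h.+1 * 2 ^ h.+1 + j)%N).[rho h.+1 g].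
Proof. by rewrite (DFT_partial h.+1) // subnn horner_poly. Qed.

(* Evaluating at the roots of unity, multiplying pointwise and interpolating
   multiplies polynomials, as long as the degrees leave room. *)
Lemma IDFT_mul (m : nat) (fa fb : nat -> E) p (x : E) :
  (2 * m = 2 ^ h.+1)%N ->
  (forall g, (m <= g %% (2 * m))%N -> fa g = 0) ->
  (forall g, (m <= g %% (2 * m))%N -> fb g = 0) ->
  \sum_(l < 2 * m) IDFT h.+1 (fun g => DFT h.+1 fa g * DFT h.+1 fb g)
      (p * (2 * m) + l)%N * x ^+ l =
  (\sum_(l < m) fa (p * (2 * m) + l)%N * x ^+ l) *
  (\sum_(l < m) fb (p * (2 * m) + l)%N * x ^+ l).
Proof.
move=> e2m a0 b0.
have m0 : (0 < m)%N by case: (m) e2m => // e; have := expn_gt0 2 h.+1; rewrite -e.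
pose pol (f : nat -> E) q := \poly_(j < m) f (q * (2 * m) + j)%N.
have pol_wide (f : nat -> E) q : (forall g, (m <= g %% (2 * m))%N -> f g = 0) ->
    \poly_(j < 2 * m) f (q * (2 * m) + j)%N = pol f q.
  move=> f0; apply/polyP => i; rewrite !coef_poly.
  case: (ltnP i m) => im; first by rewrite (leq_trans im) // leq_pmull.
  by case: ifP => // i2; rewrite f0 // modnMDl modn_small.
pose fh g := (pol fa (g %/ (2 * m))%N * pol fb (g %/ (2 * m))%N)`_(g %% (2 * m)).
have szh q : (size (pol fa q * pol fb q)%R <= 2 * m)%N.
  apply: leq_trans (size_polyMleq _ _) _.
  have := size_poly m (fun j => fa (q * (2 * m) + j)%N).
  have := size_poly m (fun j => fb (q * (2 * m) + j)%N).
  rewrite -/(pol fa q) -/(pol fb q); lia.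
have polh q : \poly_(j < 2 * m) fh (q * (2 * m) + j)%N = pol fa q * pol fb q.
  apply/polyP => i; rewrite coef_poly; case: ltnP => i2m.
    by rewrite /fh divnMDl ?muln_gt0 // (divn_small i2m) addn0 modnMDl modn_small.
  by rewrite nth_default // (leq_trans (szh q)).
(* Evaluation is multiplicative, so the pointwise product is the transform of the coefficients [fh]
   of the product. Undoing the stages recovers them without appeal to uniqueness of interpolation,
   which may fail over a ring. *)
have DFTh g : DFT h.+1 fa g * DFT h.+1 fb g = DFT h.+1 fh g.
  by rewrite !DFT_eval -e2m polh !pol_wide // hornerM.
have inv g : IDFT h.+1 (fun g => DFT h.+1 fa g * DFT h.+1 fb g) g = fh g.
  have -> : (fun g => DFT h.+1 fa g * DFT h.+1 fb g) = DFT h.+1 fh by apply/funext.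
  by rewrite (DFTK h.+1) // subnn.
under eq_bigr do rewrite inv.
rewrite -[LHS](horner_poly (2 * m) (fun l => fh (p * (2 * m) + l)%N)) polh hornerM.
by rewrite !horner_poly.
Qed.

(** Blocks of length 2 H do not straddle a multiple of 2 H, so entries from G on, which are garbage
    in the arrays, do not interfere. *)
Lemma fwdE_agree H (u : E) f f' G : (0 < H)%N -> (2 * H %| G)%N ->
  (forall g, (g < G)%N -> f g = f' g) ->
  forall g, (g < G)%N -> fwdE H u f g = fwdE H u f' g.
Proof.
move=> H0 /dvdnP[d ->] ag g gG; rewrite /fwdE ag //; case: eqP => [e|_]; last by rewrite ag //; lia.
rewrite ag // mulnA; rewrite mulnA in gG; move: gG; rewrite -!ltn_divLR // divnDr // divnn H0; lia.
Qed.

Lemma bwdE_agree H (u : E) f f' G : (0 < H)%N -> (2 * H %| G)%N ->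
  (forall g, (g < G)%N -> f g = f' g) ->
  forall g, (g < G)%N -> bwdE H u f g = bwdE H u f' g.
Proof.
move=> H0 /dvdnP[d ->] ag g gG; rewrite /bwdE ag //; case: eqP => [e|_]; last by rewrite ag //; lia.
rewrite ag // mulnA; rewrite mulnA in gG; move: gG; rewrite -!ltn_divLR // divnDr // divnn H0; lia.
Qed.

End Radix2.

(** * Nussbaumer's steps as maps on arrays *)

Section ArrayMaps.
Local Open Scope nat_scope.
Implicit Types (Q H m r i : nat) (V U : nat -> nat).

(** Entry i is the coefficient of Y^t in the g-th element of (Z/Q)[Y]/(Y^r + 1), with g = i / r and
    t = i mod r. A polynomial of length m r becomes m coefficients of powers of X, followed by m
    zeros that keep the product in X from wrapping around. *)
Definition expandA m r V i :=
  ((i %/ r) %% (2 * m) < m) *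
  V (i %/ (2 * m * r) * (m * r) + (i %/ r) %% (2 * m) + m * (i %% r)).

(** The twiddle is Y^e, so multiplying by it rotates the chunk by e places, with a change of sign at
    the wrap. Negatives are formed as Q - v, for which entries need only be at most Q. *)
Definition fwdA Q H r V i :=
  let g := i %/ r in let t := i %% r in
  if (g %/ H) %% 2 == 0 then (V i + V (i + H * r)) %% Q
  else let e := g %% H * (r %/ H) in let t2 := (t + r - e) %% r in
       let v := (V ((g - H) * r + t2) + (Q - V (g * r + t2))) %% Q in
       if t < e then (Q - v) %% Q else v.

Definition bwdA Q hf H r V i :=
  let g := i %/ r in let t := i %% r in
  let e := g %% H * (r %/ H) in let t2 := (t + e) %% r in
  if (g %/ H) %% 2 == 0 then
    let v := V ((g + H) * r + t2) in
    hf * (V i + (if t + e < r then v else Q - v)) %% Q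
  else let v := V (g * r + t2) in
    hf * (V ((g - H) * r + t) + (if t + e < r then Q - v else v)) %% Q.

(** Puts Y = X^m back: coefficient l + m contributes X^l Y, a rotation by one place whose wrapped
    entry changes sign. *)
Definition compressA Q m r V i :=
  let g := i %/ (m * r) * (2 * m) + i %% m in let t := (i %% (m * r)) %/ m in
  (V (g * r + t) + (if t == 0 then Q - V ((g + m) * r + r.-1)
                    else V ((g + m) * r + t.-1))) %% Q.

(** The recursion ends at length 2, where elements of (Z/Q)[Y]/(Y^2 + 1) are multiplied like complex
    numbers. *)
Definition pairmulA Q V U i :=
  if i %% 2 == 0 then (V i * U i + (Q - (V i.+1 * U i.+1) %% Q)) %% Q
  else (V i.-1 * U i + V i * U i.-1) %% Q.

End ArrayMaps.

(** * Values of the array maps in a ring *)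

Section Evaluation.
Variable E : comNzRingType.

(* The g-th chunk of length r, read as a polynomial in y. *)
Definition ev (r : nat) (y : E) (V : nat -> nat) (g : nat) : E :=
  \sum_(t < r) (V (g * r + t)%N)%:R * y ^+ t.

(** Multiplying by y^e moves the last e coefficients to degrees from r on, whence y^r = -1 brings
    them back to the front with a minus sign. *)
Lemma shift_sum (r e : nat) (y : E) (w : nat -> E) : (e < r)%N -> y ^+ r = -1 ->
  \sum_(t < r) (if (t < e)%N then - w ((t + r - e) %% r)%N
                else w ((t + r - e) %% r)%N) * y ^+ t =
  (\sum_(t < r) w t * y ^+ t) * y ^+ e.
Proof.
move=> er yr; have re : (r - e <= r)%N by rewrite leq_subr.
rewrite -(big_mkord xpredT (fun t => (if (t < e)%N then - w ((t + r - e) %% r)%N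
   else w ((t + r - e) %% r)%N) * y ^+ t)).
rewrite -(big_mkord xpredT (fun t => w t * y ^+ t)).
rewrite (big_cat_nat _ (ltnW er)) //= [in RHS](big_cat_nat _ re) //=.
rewrite addrC mulrDl; congr (_ + _).
  rewrite -{1}[e]add0n big_addn mulr_suml; apply: eq_big_nat => t /andP[_ tr].
  rewrite ifN; last by rewrite -leqNgt leq_addl.
  rewrite (_ : (t + e + r - e = t + r)%N); last by lia.
  by rewrite modnDr modn_small ?exprD ?mulrA //; lia.
rewrite -{1}[(r - e)%N]add0n big_addn mulr_suml subKn ?(ltnW er) //.
apply: eq_big_nat => t /andP[_ te]; rewrite te modn_small; last by lia.
rewrite -mulrA -exprD (_ : (t + (r - e) + e = t + r)%N); last by lia.
rewrite exprD yr mulrN1 mulrN mulNr (_ : (t + r - e = t + (r - e))%N) //; lia.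
Qed.

Lemma unshift_sum (r e : nat) (y : E) (w : nat -> E) : (e < r)%N -> y ^+ r = -1 ->
  (\sum_(t < r) (if (t + e < r)%N then w ((t + e) %% r)%N
                else - w ((t + e) %% r)%N) * y ^+ t) * y ^+ e =
  \sum_(t < r) w t * y ^+ t.
Proof.
move=> er yr.
rewrite -(shift_sum _ _ _ (fun t => if (t + e < r)%N then w ((t + e) %% r)%N
  else - w ((t + e) %% r)%N) er yr); apply: eq_bigr => t _; congr (_ * _).
have tr := ltn_ord t; case: ltnP => te.
  rewrite (@modn_small (t + r - e)); last by lia.
  by rewrite ifN ?opprK; [congr w; rewrite (_ : (t + r - e + e = t + r)%N) ?modnDr ?modn_small //; lia | lia].
rewrite (_ : (t + r - e = t - e + r)%N) ?modnDr ?(@modn_small (t - e)); try by lia.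
by rewrite subnK // tr modn_small.
Qed.

Lemma ev_agree r y (V V' : nat -> nat) G g : (g < G)%N ->
  (forall i, (i < G * r)%N -> V i = V' i) -> ev r y V g = ev r y V' g.
Proof.
move=> gG ag; apply: eq_bigr => t _; rewrite ag //.
by have := ltn_ord t; nia.
Qed.

Lemma divn_chunk (r g t : nat) : (t < r)%N ->
  ((g * r + t) %/ r = g)%N /\ ((g * r + t) %% r = t)%N.
Proof.
move=> tr; rewrite divnMDl ?modnMDl ?(leq_ltn_trans _ tr) //.
by rewrite (divn_small tr) addn0 modn_small.
Qed.

Lemma twiddle_lt (r H g : nat) : (0 < r)%N -> (H %| r)%N -> (0 < H)%N ->
  (g %% H * (r %/ H) < r)%N.
Proof.
move=> r0 Hr H0; rewrite -{2}(divnK Hr) mulnC ltn_pmul2l ?ltn_mod //.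
by rewrite divn_gt0 // dvdn_leq.
Qed.

Definition chunkE (m r : nat) (y : E) (V : nat -> nat) (g : nat) : E :=
  if (g %% (2 * m) < m)%N then
    \sum_(t < r) (V (g %/ (2 * m) * (m * r) + g %% (2 * m) + m * t)%N)%:R * y ^+ t
  else 0.

Lemma ev_expand m r y V g : (0 < r)%N -> (0 < m)%N ->
  ev r y (expandA m r V) g = chunkE m r y V g.
Proof.
move=> r0 m0; rewrite /ev /chunkE; case: ifP => gm; last first.
  rewrite big1 // => t _; have [t1 t2] := divn_chunk r g t (ltn_ord t).
  by rewrite /expandA t1 gm mul0n mul0r.
apply: eq_bigr => t _; have [t1 t2] := divn_chunk r g t (ltn_ord t).
by rewrite /expandA t1 t2 gm mul1n [(2 * m * r)%N]mulnC divnMA t1.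
Qed.

Lemma sum_chunks (m r : nat) (F : nat -> E) :
  \sum_(i < m * r) F i = \sum_(t < r) \sum_(l < m) F (l + m * t)%N.
Proof.
elim: r => [|r IH]; first by rewrite muln0 !big_ord0.
rewrite big_ord_recr -IH /= -!(big_mkord xpredT) mulnS addnC.
rewrite (big_cat_nat _ (leq_addr m (m * r))) //=; congr (_ + _).
rewrite -{1}[(m * r)%N]add0n big_addn addKn.
by rewrite -(big_mkord xpredT (fun l => F (l + m * r)%N)).
Qed.

Lemma ev_chunks m r (x : E) V p : (0 < r)%N -> (0 < m)%N ->
  ev (m * r) x V p = \sum_(l < m) chunkE m r (x ^+ m) V (p * (2 * m) + l)%N * x ^+ l.
Proof.
move=> r0 m0; rewrite /ev (sum_chunks m r (fun i => (V (p * (m * r) + i)%N)%:R * x ^+ i)).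
rewrite exchange_big; apply: eq_bigr => l _ /=; have lm := ltn_ord l.
have [l1 l2] : ((p * (2 * m) + l) %/ (2 * m) = p)%N /\ ((p * (2 * m) + l) %% (2 * m) = l)%N.
  by apply: divn_chunk; lia.
rewrite /chunkE l1 l2 lm mulr_suml; apply: eq_bigr => t _.
by rewrite exprD exprM [x ^+ l * _]mulrC mulrA addnA.
Qed.

Definition twid (y : E) (r s : nat) : E := y ^+ (r %/ 2 ^ s).
(** From y^r = -1 follows y^(2 r) = 1, so this is the inverse of [twid], written with a natural
    exponent. *)
Definition itwid (y : E) (r s : nat) : E := y ^+ (2 * r - r %/ 2 ^ s).

Lemma twid_itwid y r s : y ^+ r = -1 -> twid y r s * itwid y r s = 1.
Proof.
move=> yr; rewrite -exprD subnKC; last by have := leq_div r (2 ^ s); lia.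
by rewrite mulnC exprM yr sqrrN expr1n.
Qed.

Lemma twid_N1 y r s : y ^+ r = -1 -> (2 ^ s %| r)%N -> twid y r s ^+ (2 ^ s) = -1.
Proof. by move=> yr sr; rewrite -exprM divnK. Qed.

Lemma IDFT_agree h (zi : nat -> E) (hh : E) f f' G i : (i <= h.+1)%N ->
  (2 ^ h.+1 %| G)%N -> (forall g, (g < G)%N -> f g = f' g) ->
  forall g, (g < G)%N -> IDFT E hh zi i f g = IDFT E hh zi i f' g.
Proof.
move=> ih hG ff'; elim: i ih => //= i IH ih.
apply: bwdE_agree; rewrite ?expn_gt0 //; last by apply: IH; exact: ltnW.
by rewrite -expnS (dvdn_trans _ hG) // dvdn_exp2l.
Qed.

(** Arrays are related through the values of their chunks, so that representatives modulo Q do not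
    matter. *)
Definition level_rel (h r : nat) (y : E) (G : nat) (V V' : nat -> nat) :=
  forall g, (g < G)%N ->
    ev r y V' g = DFT E h (twid y r) h.+1 (chunkE (2 ^ h) r y V) g.

Section Modulus.
Variables (Q hf : nat).
Hypothesis Qgt0 : (0 < Q)%N.
Hypothesis Q0 : Q%:R = 0 :> E.
Hypothesis hfE : (hf%:R : E) *+ 2 = 1.

Lemma natr_modQ n : (n %% Q)%:R = n%:R :> E.
Proof. by rewrite {2}(divn_eq n Q) natrD natrM Q0 mulr0 add0r. Qed.

Lemma natr_subQ n : (n <= Q)%N -> (Q - n)%:R = - n%:R :> E.
Proof. by move=> nQ; rewrite natrB // Q0 add0r. Qed.

Lemma ev_fwd (r H : nat) (y : E) V g : (0 < r)%N -> (H %| r)%N -> (0 < H)%N ->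
  y ^+ r = -1 -> (forall i, V i <= Q)%N ->
  ev r y (fwdA Q H r V) g = fwdE E H (y ^+ (r %/ H)) (ev r y V) g.
Proof.
move=> r0 Hr H0 yr VQ; rewrite /fwdE /ev.
have eH : (g %% H * (r %/ H) < r)%N by apply: twiddle_lt.
case: eqP => [e|/eqP ne].
  rewrite -big_split /=; apply: eq_bigr => t _.
  have [t1 t2] := divn_chunk r g t (ltn_ord t).
  rewrite /fwdA t1 e /= natr_modQ natrD mulrDl; congr (_ + (V _)%:R * _).
  by rewrite mulnDl addnAC.
rewrite -exprM [(r %/ H * _)%N]mulnC -sumrB.
under [in RHS]eq_bigr do rewrite -mulrBl.
rewrite -(shift_sum _ _ _ (fun t => (V ((g - H) * r + t)%N)%:R - (V (g * r + t)%N)%:R) eH yr).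
apply: eq_bigr => t _; have [t1 t2] := divn_chunk r g t (ltn_ord t).
rewrite /fwdA t1 t2 (negbTE ne); case: ifP => te; congr (_ * _).
  rewrite natr_modQ natr_subQ; last by rewrite ltnW // ltn_mod.
  by rewrite natr_modQ natrD natr_subQ.
by rewrite natr_modQ natrD natr_subQ.
Qed.

Lemma ev_bwd (r H : nat) (y zi : E) V g : (0 < r)%N -> (H %| r)%N -> (0 < H)%N ->
  y ^+ r = -1 -> y ^+ (r %/ H) * zi = 1 -> (forall i, V i <= Q)%N ->
  ev r y (bwdA Q hf H r V) g = bwdE E hf%:R H zi (ev r y V) g.
Proof.
move=> r0 Hr H0 yr yzi VQ.
have eH : (g %% H * (r %/ H) < r)%N by apply: twiddle_lt.
have un (w : nat -> E) : (\sum_(t < r) w t * y ^+ t) * zi ^+ (g %% H) =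
    \sum_(t < r) (if (t + g %% H * (r %/ H) < r)%N
      then w ((t + g %% H * (r %/ H)) %% r)%N
      else - w ((t + g %% H * (r %/ H)) %% r)%N) * y ^+ t.
  rewrite -(unshift_sum _ _ _ w eH yr) -mulrA [(g %% H * _)%N]mulnC exprM.
  by rewrite -exprMn yzi expr1n mulr1.
rewrite /bwdE /ev; case: eqP => [e|/eqP ne].
  rewrite (un (fun t => (V ((g + H) * r + t)%N)%:R)) -big_split mulr_sumr /=; apply: eq_bigr => t _.
  have [t1 t2] := divn_chunk r g t (ltn_ord t).
  rewrite /bwdA t1 t2 e /= natr_modQ natrM natrD -mulrDl -mulrA; congr (_ * ((_ + _) * _)).
  by case: ifP => // _; rewrite natr_subQ.
rewrite (un (fun t => (V (g * r + t)%N)%:R)) -sumrB mulr_sumr; apply: eq_bigr => t _.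
have [t1 t2] := divn_chunk r g t (ltn_ord t).
rewrite /bwdA t1 t2 (negbTE ne) /= natr_modQ natrM natrD -mulrBl -mulrA; congr (_ * ((_ + _) * _)).
by case: ifP => // _; rewrite ?natr_subQ ?opprK.
Qed.

Lemma ev_compress m r (x : E) V p : (0 < r)%N -> (0 < m)%N ->
  x ^+ (m * r) = -1 -> (forall i, V i <= Q)%N ->
  ev (m * r) x (compressA Q m r V) p =
  \sum_(l < 2 * m) ev r (x ^+ m) V (p * (2 * m) + l)%N * x ^+ l.
Proof.
move=> r0 m0 xN VQ; pose y := x ^+ m; have yr : y ^+ r = -1 by rewrite -exprM.
rewrite mul2n -addnn big_split_ord /= -big_split /= addnn -mul2n.
rewrite /ev (sum_chunks m r (fun i => (compressA Q m r V (p * (m * r) + i)%N)%:R * x ^+ i)).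
rewrite exchange_big; apply: eq_bigr => l _ /=; have lm := ltn_ord l.
have idx (t : nat) : (t < r)%N -> [/\ (p * (m * r) + (l + m * t)) %/ (m * r) = p,
    (p * (m * r) + (l + m * t)) %% m = l &
    ((p * (m * r) + (l + m * t)) %% (m * r)) %/ m = t]%N.
  move=> tr; have lt : (l + m * t < m * r)%N by nia.
  have [i1 i2] := divn_chunk _ p _ lt; rewrite i1 i2; split=> //.
    by rewrite (_ : (p * (m * r) + (l + m * t) = (p * r + t) * m + l)%N) ?modnMDl ?modn_small //; ring.
  by rewrite addnC mulnC divnMDl // divn_small ?addn0.
rewrite exprD mulrA -mulrDl -/y.
transitivity ((\sum_(t < r) (compressA Q m r V (p * (m * r) + (l + m * t))%N)%:R * y ^+ t) * x ^+ l).
  rewrite mulr_suml; apply: eq_bigr => t _.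
  by rewrite exprD exprM [x ^+ l * _]mulrC mulrA.
congr (_ * _).
have -> : (\sum_(t < r) (V ((p * (2 * m) + (m + l)) * r + t)%N)%:R * y ^+ t) * y =
  \sum_(t < r) (if t == 0 :> nat then - (V ((p * (2 * m) + (m + l)) * r + r.-1)%N)%:R
     else (V ((p * (2 * m) + (m + l)) * r + t.-1)%N)%:R) * y ^+ t.
  case: (r) r0 yr => // r' _ yr'; rewrite big_ord_recr big_ord_recl /= mulr1 mulrDl.
  rewrite -mulrA -exprSr yr' mulrN1 addrC; congr (_ + _).
  by rewrite mulr_suml; apply: eq_bigr => t _; rewrite -mulrA -exprSr.
rewrite -big_split /=; apply: eq_bigr => t _.
have [i1 i2 i3] := idx t (ltn_ord t).
rewrite /compressA i1 i2 i3 natr_modQ natrD -mulrDl; congr ((_ + _) * _).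
have -> : (p * (2 * m) + l + m = p * (2 * m) + (m + l))%N by lia.
by case: eqP => _ //; rewrite natr_subQ.
Qed.

Lemma ev_mul (y : E) V U g : y ^+ 2 = -1 ->
  ev 2 y (pairmulA Q V U) g = ev 2 y V g * ev 2 y U g.
Proof.
move=> y2; rewrite /ev !big_ord_recl !big_ord0 /=.
rewrite /bump /= !addn0 !addr0 !mulr1 !expr1 !(addn1, addnS, addn0).
rewrite /pairmulA modnMl (_ : ((g * 2).+1 %% 2 == 0)%N = false); last by lia.
rewrite /= !natr_modQ !natrD natr_subQ; last by rewrite ltnW // ltn_mod.
rewrite natr_modQ !natrM.
have -> : - ((V (g * 2).+1)%:R * (U (g * 2).+1)%:R) =
   (V (g * 2).+1)%:R * (U (g * 2).+1)%:R * y ^+ 2 by rewrite y2 mulrN1.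
ring.
Qed.

(** One level of the recursion: splitting and recombining agree at Y = x^m, the transform turns
    products of polynomials in X into pointwise products, and the next level supplies these as the
    hypothesis on [VC]. *)
Lemma level_mul (h r P : nat) (x : E) (VA VB VA' VB' VC VD : nat -> nat) :
  (2 ^ h %| r)%N -> (0 < r)%N -> x ^+ (2 ^ h * r) = -1 ->
  let y := x ^+ (2 ^ h) in let G := (P * (2 * 2 ^ h))%N in
  level_rel h r y G VA VA' -> level_rel h r y G VB VB' ->
  (forall g, (g < G)%N -> ev r y VC g = ev r y VA' g * ev r y VB' g) ->
  (forall g, (g < G)%N ->
     ev r y VD g = IDFT E hf%:R (itwid y r) h.+1 (ev r y VC) g) ->
  (forall i, VD i <= Q)%N ->
  forall p, (p < P)%N ->
    ev (2 ^ h * r) x (compressA Q (2 ^ h) r VD) p =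
    ev (2 ^ h * r) x VA p * ev (2 ^ h * r) x VB p.
Proof.
move=> hr r0 xN y G relA relB mulC invD VDQ p pP.
have yr : y ^+ r = -1 by rewrite -exprM.
have m0 : (0 < 2 ^ h)%N by rewrite expn_gt0.
have zz s : (s <= h)%N -> twid y r s * itwid y r s = 1 by move=> _; exact: twid_itwid.
have zN s : (s <= h)%N -> twid y r s ^+ (2 ^ s) = -1.
  by move=> sh; apply: twid_N1 => //; rewrite (dvdn_trans _ hr) // dvdn_exp2l.
rewrite ev_compress // !ev_chunks // -/y.
have e2m : (2 * 2 ^ h = 2 ^ h.+1)%N by rewrite expnS.
have c0 V g : (2 ^ h <= g %% (2 * 2 ^ h))%N -> chunkE (2 ^ h) r y V g = 0.
  by move=> gm; rewrite /chunkE ltnNge gm.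
rewrite -(IDFT_mul E hf%:R hfE h (twid y r) (itwid y r) zz zN _ _ _ p x e2m (c0 VA) (c0 VB)).
apply: eq_bigr => l _.
have lG : (p * (2 * 2 ^ h) + l < G)%N.
  by apply: (@leq_trans (p.+1 * (2 * 2 ^ h))); [by rewrite (mulSnr p) ltn_add2l | rewrite leq_mul2r pP orbT].
rewrite invD //; congr (_ * _); apply: (@IDFT_agree h _ _ _ _ G) => //.
  by rewrite -e2m dvdn_mull.
by move=> g gG; rewrite mulC // relA // relB.
Qed.

End Modulus.
End Evaluation.

(* The universal such ring, (Z/Q)[X]/(X^n + 1): identities of values at x are
   identities of coefficients. *)
Lemma negacyclic_ring (Q n : nat) : (1 < Q)%N -> (0 < n)%N ->
  exists (E : comNzRingType) (x : E), [/\ Q%:R = 0 :> E, x ^+ n = -1 &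
    forall (T : nat) (V a b : nat -> nat), (2 * T < n)%N ->
      (forall i, (T < i < n)%N -> a i = 0%N) ->
      (forall i, (T < i < n)%N -> b i = 0%N) ->
      ev E n x V 0 = ev E n x a 0 * ev E n x b 0 ->
      forall i, (i < n)%N -> (V i = \sum_(j < i.+1) a j * b (i - j) %[mod Q])%N].
Proof.
move=> Q1 n0; pose R : comNzRingType := 'Z_Q.
pose h : {poly R} := 'X^n + 1%:P.
have szh : size h = n.+1 by rewrite size_XnaddC.
have hm : h \is monic by rewrite monicXnaddC.
have mkh : mk_monic h = h by rewrite /mk_monic szh hm ltnS n0.
have QR : Q%:R = 0 :> R by exact: pchar_Zp.
pose E : comNzRingType := {poly %/ h}; pose x : E := in_qpoly h 'X.
have evE V : ev E n x V 0 = in_qpoly h (\poly_(t < n) (V t)%:R).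
  rewrite poly_def rmorph_sum; apply: eq_bigr => t _.
  by rewrite -mul_polyC rmorphM /= rmorphXn polyC_natr rmorph_nat mul0n add0n.
exists E, x; split.
- by rewrite -(rmorph_nat (in_qpoly h)) -polyC_natr QR rmorph0.
- apply/eqP; rewrite -addr_eq0 -(rmorphXn (in_qpoly h)) -(rmorph1 (in_qpoly h)) -rmorphD.
  by apply/eqP/val_inj; rewrite /= mkh -[1]/(1%:P) -/h Pdiv.RingMonic.rmodpp.
move=> T V a b Tn a0 b0; rewrite !evE -rmorphM /= => /(congr1 (@polyn _ _)).
have cut (c : nat -> nat) : (forall i, (T < i < n)%N -> c i = 0%N) ->
    \poly_(t < n) (c t)%:R = \poly_(t < T.+1) (c t)%:R :> {poly R}.
  move=> c0; apply/polyP => i; rewrite !coef_poly ltnS.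
  have [iT|Ti] := leqP i T; first by rewrite (leq_ltn_trans iT) // (leq_ltn_trans _ Tn) // leq_pmull.
  by case: ifP => // it; rewrite c0 // Ti.
(* As 2 T < n, the product of the two truncated polynomials has degree below n and is its own
   residue. *)
rewrite !in_qpoly_small ?mkh ?szh ?ltnS ?size_poly ?(cut a) ?(cut b) //; last first.
  apply: leq_trans (size_polyMleq _ _) _.
  have := leq_add (size_poly T.+1 (fun t => (a t)%:R : R)) (size_poly T.+1 (fun t => (b t)%:R : R)).
  by move=> /(leq_sub2r 1); rewrite !subn1 => /leq_trans-> //; rewrite addSn addnS /= addnn -mul2n.
move=> /polyP eqV i ilt; have := eqV i; rewrite coef_poly ilt coefM.
have cz (c : nat -> nat) j : (j < n)%N -> (forall i, (T < i < n)%N -> c i = 0%N) ->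
    (\poly_(t < T.+1) (c t)%:R)`_j = (c j)%:R :> R.
  by move=> jn c0; rewrite coef_poly ltnS; case: leqP => // Tj; rewrite c0 // Tj.
rewrite (eq_bigr (fun j : 'I_i.+1 => (a j * b (i - j)%N)%:R : R)); last first.
  move=> j _; rewrite natrM; congr (_ * _); apply: cz => //.
    by apply: leq_trans ilt; exact: ltn_ord.
  by apply: leq_ltn_trans ilt; exact: leq_subr.
by rewrite -natr_sum => /(congr1 val); rewrite /= !val_Zp_nat.
Qed.

Declare Scope aexpr_scope.
Delimit Scope aexpr_scope with ax.
Arguments Op o (e1 e2)%_ax.
Local Notation "x + y" := (Op OpAdd x y) : aexpr_scope.
Local Notation "x - y" := (Op OpSub x y) : aexpr_scope.
Local Notation "x * y" := (Op OpMul x y) : aexpr_scope.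
Local Notation "x %/ y" := (Op OpDiv x y) : aexpr_scope.
Local Notation "x %% y" := (Op OpMod x y) : aexpr_scope.
Local Notation "x < y" := (Op OpLt x y) : aexpr_scope.
Local Notation "x == y" := (Op OpEq x y) : aexpr_scope.
Local Notation "# n" := (Cst n) (at level 1, n at level 0) : aexpr_scope.
Local Notation "$ n" := (Get n) (at level 1, n at level 0) : aexpr_scope.
Arguments Elt j%_nat_scope e%_ax.
Arguments Let x%_nat_scope e%_ax.
Arguments Put j%_nat_scope i%_ax e%_ax.
Arguments Cond e%_ax c1 c2.
Arguments For x%_nat_scope e%_ax c.

(** * Programs for the array maps *)

Section ConvolutionProgram.
Local Open Scope nat_scope.

(** Nested routines use ever higher variables (30s for rebuilding, 40s for levels, 50s for entries),
    so a threshold suffices to say what they preserve. *)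
Definition frame (lo : nat) (s s' : astate) := forall y, y < lo -> va s' y = va s y.

Lemma frame_trans {lo s1 s2 s3} : frame lo s1 s2 -> frame lo s2 s3 -> frame lo s1 s3.
Proof. by move=> f1 f2 y ylo; rewrite f2 ?f1. Qed.

Lemma frame_le {lo lo' s1 s2} : lo <= lo' -> frame lo' s1 s2 -> frame lo s1 s2.
Proof. by move=> le f y ylo; rewrite f // (leq_trans ylo). Qed.

Lemma frame_updv {lo s s' x v} : lo <= x -> frame lo s s' -> frame lo s (updv s' x v).
Proof.
move=> lx f y ylo /=; case: eqnP => [e|_]; last exact: f.
by rewrite e ltnNge lx in ylo.
Qed.

Lemma frame_upda {lo s s' j i v} : frame lo s s' -> frame lo s (upda s' j i v).
Proof. by []. Qed.

(** A new entry may depend on several old ones, so results are gathered in array 6 and copied once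
    all are known. *)
Definition tab (j : nat) (body : cmd) : cmd :=
  Then (For 50 ($45) body) (For 50 ($45) (Put j ($50) (Elt 6 ($50)))).

Lemma wp_tab X j N K (f : nat -> nat) body s (Q : nat -> astate -> Prop) :
  N <= X -> va s 45 = N -> j != 6 -> (forall i, i < N -> f i <= X) ->
  (forall i s', i < N -> va s' 50 = i -> frame 50 s s' ->
    (forall j', j' != 6 -> ar s' j' = ar s j') ->
    wp X body s' (fun n s'' => [/\ n <= K, frame 51 s' s'',
      (forall j', j' != 6 -> ar s'' j' = ar s' j'),
      ar s'' 6 i = f i & forall k, k != i -> ar s'' 6 k = ar s' 6 k])) ->
  (forall n s', n <= N * (K + 5) + 4 -> frame 50 s s' ->
    (forall j', j' != 6 -> j' != j -> ar s' j' = ar s j') ->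
    (forall k, ar s' j k = if k < N then f k else ar s j k) -> Q n s') ->
  wp X (tab j body) s Q.
Proof.
move=> NX sN j6 fX Hb HQ; apply: wp_then.
apply: (wp_for N (fun i n s' => [/\ va s' 50 = i, frame 50 s s',
   (forall j', j' != 6 -> ar s' j' = ar s j'),
   (forall k, k < i -> ar s' 6 k = f k) & n <= i * (K + 2)])) => //.
- by split=> //; exact: frame_updv.
- by move=> i n s' iN [vi fr _ _ _] /=; split=> //; rewrite fr.
- move=> i n s' iN [vi fr fa f6 nl].
  apply: wp_mono (Hb i s' iN vi fr fa) _ => m s'' [mK fr2 fa2 f6i f6k] /=.
  split; first by rewrite fr2.
  split=> //=.
  + by apply: frame_updv => //; apply: frame_trans fr (frame_le (leqnSn 50) fr2).
  + by move=> j' nj; rewrite fa2 ?fa.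
  + move=> k ki; have [->//|nk] := eqVneq k i.
    by rewrite f6k // f6 //; lia.
  + rewrite mulSn; lia.
move=> n1 s1 [v1 fr1 fa1 f61 n1l].
apply: (wp_for N (fun i n s' => [/\ va s' 50 = i, frame 50 s s',
   (forall j', j' != 6 -> j' != j -> ar s' j' = ar s j'),
   (forall k, ar s' j k = if k < i then f k else ar s j k) /\ ar s' 6 = ar s1 6
   & n <= i * 3])) => //=.
- split=> //=.
  + exact: frame_updv.
  + by move=> j' n6 _; rewrite fa1.
  + by rewrite fa1.
- by move=> i n s' iN [vi fr _ _ _]; split=> //; rewrite fr.
- move=> i n s' iN [vi fr fa [fj f6] nl].
  apply: wp_put; rewrite /= vi f6 f61 ?fX //; split=> //; split=> //=.
  + by apply: frame_updv => //; exact: frame_upda.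
  + by move=> j' n6 nj; case: eqnP => [e|_]; [rewrite e eqxx in nj | rewrite fa].
  + split; last by case: eqnP => [e|//]; rewrite -e in j6.
    move=> k; rewrite eqnE eqxx; rewrite ltnS leq_eqVlt.
    by case: eqP => [->//|_] /=; rewrite fj.
  + lia.
move=> n2 s2 [v2 fr2 fa2 [fj2 _] n2l]; apply: HQ => //.
rewrite !mulnDr; lia.
Qed.


Definition stored (K : nat) (f : nat -> nat) (i : nat) (s : astate)
    (n : nat) (s' : astate) : Prop :=
  [/\ n <= K, frame 51 s s', (forall j', j' != 6 -> ar s' j' = ar s j'),
    ar s' 6 i = f i & forall k, k != i -> ar s' 6 k = ar s 6 k].

Lemma stored_put K (f : nat -> nat) i v s s1 n : n <= K -> frame 51 s s1 ->
  ar s1 = ar s -> v = f i -> stored K f i s n (upda s1 6 i v).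
Proof.
move=> nK fr a1 ->; split=> //=; rewrite ?eqxx //.
- by move=> j' nj; case: eqnP nj => [->|_ _] //; rewrite a1.
- by move=> k nk; rewrite (negbTE nk) a1.
Qed.

Definition expand_body (j : nat) : cmd :=
  Put 6 ($50) ((($50 %/ $44) %% (#2 * $43) < $43) *
    Elt j ($50 %/ (#2 * $43 * $44) * ($43 * $44) + ($50 %/ $44) %% (#2 * $43)
           + $43 * ($50 %% $44)))%ax.

Definition fwd_body (j : nat) : cmd :=
  Then (Let 51 ($50 %/ $44)) (Then (Let 52 ($50 %% $44))
  (Cond (($51 %/ $47) %% #2 == #0)
    (Put 6 ($50) ((Elt j ($50) + Elt j ($50 + $47 * $44)) %% $7))
    (Then (Let 53 ($51 %% $47 * ($44 %/ $47)))
    (Then (Let 54 (($52 + $44 - $53) %% $44))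
    (Then (Let 55 ((Elt j (($51 - $47) * $44 + $54)
                    + ($7 - Elt j ($51 * $44 + $54))) %% $7))
    (Cond ($52 < $53) (Put 6 ($50) (($7 - $55) %% $7)) (Put 6 ($50) ($55)))))))).

Definition bwd_body (j : nat) : cmd :=
  Then (Let 51 ($50 %/ $44)) (Then (Let 52 ($50 %% $44))
  (Then (Let 53 ($51 %% $47 * ($44 %/ $47)))
  (Then (Let 54 (($52 + $53) %% $44))
  (Cond (($51 %/ $47) %% #2 == #0)
    (Then (Let 55 (Elt j (($51 + $47) * $44 + $54)))
    (Then (Cond ($52 + $53 < $44) Nop (Let 55 ($7 - $55)))
    (Put 6 ($50) ($8 * (Elt j ($50) + $55) %% $7))))
    (Then (Let 55 (Elt j ($51 * $44 + $54)))
    (Then (Cond ($52 + $53 < $44) (Let 55 ($7 - $55)) Nop)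
    (Put 6 ($50) ($8 * (Elt j (($51 - $47) * $44 + $52) + $55) %% $7)))))))).

Definition compress_body (j : nat) : cmd :=
  Then (Let 51 ($50 %/ ($43 * $44) * (#2 * $43) + $50 %% $43))
  (Then (Let 52 ($50 %% ($43 * $44) %/ $43))
  (Cond ($52 == #0)
    (Put 6 ($50) ((Elt j ($51 * $44 + $52)
      + ($7 - Elt j (($51 + $43) * $44 + ($44 - #1)))) %% $7))
    (Put 6 ($50) ((Elt j ($51 * $44 + $52)
      + Elt j (($51 + $43) * $44 + ($52 - #1))) %% $7)))).

Definition mul_body (j j' : nat) : cmd :=
  Cond ($50 %% #2 == #0)
    (Put 6 ($50) ((Elt j ($50) * Elt j' ($50)
      + ($7 - Elt j ($50 + #1) * Elt j' ($50 + #1) %% $7)) %% $7))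
    (Put 6 ($50) ((Elt j ($50 - #1) * Elt j' ($50)
      + Elt j ($50) * Elt j' ($50 - #1)) %% $7)).

Lemma nat_of_bool0 (b : bool) : (b : nat) = 0 -> b = false.
Proof. by case: b. Qed.
Lemma nat_of_bool1 (b : bool) : (b : nat) != 0 -> b = true.
Proof. by case: b. Qed.

Section Bodies.
Variables (X j : nat) (s : astate) (i : nat).
Hypotheses (vi : va s 50 = i) (iX : i <= X) (rX : va s 44 <= X).

Lemma wp_expand m r : va s 43 = m -> va s 44 = r -> (forall k, ar s j k <= X) ->
  wp X (expand_body j) s (stored 1 (expandA m r (ar s j)) i s).
Proof.
move=> vm vr aX; apply: wp_put; rewrite /= vi vm vr.
  by case: (_ < m); rewrite ?mul0n // mul1n.
exact: stored_put.
Qed.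

Lemma wp_fwd Q H r : va s 7 = Q -> va s 47 = H -> va s 44 = r ->
  0 < r -> 0 < H -> H %| r -> 0 < Q -> Q <= X ->
  wp X (fwd_body j) s (stored 10 (fwdA Q H r (ar s j)) i s).
Proof.
move=> vQ vH vr r0 H0 Hr Q0 QX; have r_le := rX; rewrite vr in r_le.
have mQ k : k %% Q <= X by apply: leq_trans QX; rewrite ltnW // ltn_mod.
have mr k : k %% r <= X by apply: leq_trans r_le; rewrite ltnW // ltn_mod.
apply: wp_then; apply: wp_let; rewrite /= ?vi ?vr.
  exact: leq_trans (leq_div _ _) iX.
apply: wp_then; apply: wp_let; rewrite /= ?vi ?vr //.
apply: wp_cond => /=; rewrite ?vi ?vr ?vH ?vQ.
  move=> /nat_of_bool1 c; apply: wp_put; rewrite /= ?vi ?vr ?vH ?vQ //.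
  by apply: stored_put => //; [do ?[apply: frame_updv => //] | rewrite /fwdA /= c].
move=> /nat_of_bool0 c.
apply: wp_then; apply: wp_let; rewrite /= ?vi ?vr ?vH ?vQ.
  exact: leq_trans (ltnW (twiddle_lt _ _ _ r0 Hr H0)) r_le.
do 2! (apply: wp_then; apply: wp_let; rewrite /= ?vi ?vr ?vH ?vQ //).
apply: wp_cond => /=.
  move=> /nat_of_bool1 lt; apply: wp_put; rewrite /= ?vi ?vQ //.
  by apply: stored_put => //; [do ?[apply: frame_updv => //] | rewrite /fwdA /= c lt].
move=> /nat_of_bool0 lt; apply: wp_put; rewrite /= ?vi //.
by apply: stored_put => //; [do ?[apply: frame_updv => //] | rewrite /fwdA /= c lt].
Qed.

Lemma wp_bwd Q hf H r : va s 7 = Q -> va s 8 = hf -> va s 47 = H -> va s 44 = r ->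
  0 < r -> 0 < H -> H %| r -> 0 < Q -> Q <= X -> (forall k, ar s j k <= X) ->
  wp X (bwd_body j) s (stored 12 (bwdA Q hf H r (ar s j)) i s).
Proof.
move=> vQ vf vH vr r0 H0 Hr Q0 QX aX; have r_le := rX; rewrite vr in r_le.
have mQ k : k %% Q <= X by apply: leq_trans QX; rewrite ltnW // ltn_mod.
have mr k : k %% r <= X by apply: leq_trans r_le; rewrite ltnW // ltn_mod.
have sX k : Q - k <= X by apply: leq_trans QX; exact: leq_subr.
apply: wp_then; apply: wp_let; rewrite /= ?vi ?vr.
  exact: leq_trans (leq_div _ _) iX.
apply: wp_then; apply: wp_let; rewrite /= ?vi ?vr //.
apply: wp_then; apply: wp_let; rewrite /= ?vi ?vr ?vH ?vQ.
  exact: leq_trans (ltnW (twiddle_lt _ _ _ r0 Hr H0)) r_le.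
apply: wp_then; apply: wp_let; rewrite /= ?vi ?vr ?vH ?vQ //.
apply: wp_cond => /=; rewrite ?vi ?vr ?vH ?vQ.
  move=> /nat_of_bool1 c.
  apply: wp_then; apply: wp_let; rewrite /= ?vi ?vr ?vH ?vQ ?vf //.
  apply: wp_then; apply: wp_cond => /=; rewrite ?vi ?vr ?vH ?vQ ?vf.
    move=> /nat_of_bool1 lt; apply: wp_nop.
    apply: wp_put; rewrite /= ?vi ?vr ?vH ?vQ ?vf //.
    by apply: stored_put => //; [do ?[apply: frame_updv => //] | rewrite /bwdA /= c lt].
  move=> /nat_of_bool0 lt; apply: wp_let; rewrite /= ?vi ?vr ?vH ?vQ ?vf //.
  apply: wp_put; rewrite /= ?vi ?vr ?vH ?vQ ?vf //.
  by apply: stored_put => //; [do ?[apply: frame_updv => //] | rewrite /bwdA /= c lt].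
move=> /nat_of_bool0 c.
apply: wp_then; apply: wp_let; rewrite /= ?vi ?vr ?vH ?vQ ?vf //.
apply: wp_then; apply: wp_cond => /=; rewrite ?vi ?vr ?vH ?vQ ?vf.
  move=> /nat_of_bool1 lt; apply: wp_let; rewrite /= ?vi ?vr ?vH ?vQ ?vf //.
  apply: wp_put; rewrite /= ?vi ?vr ?vH ?vQ ?vf //.
  by apply: stored_put => //; [do ?[apply: frame_updv => //] | rewrite /bwdA /= c lt].
move=> /nat_of_bool0 lt; apply: wp_nop.
apply: wp_put; rewrite /= ?vi ?vr ?vH ?vQ ?vf //.
by apply: stored_put => //; [do ?[apply: frame_updv => //] | rewrite /bwdA /= c lt].
Qed.

Lemma wp_compress Q m r : va s 7 = Q -> va s 43 = m -> va s 44 = r ->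
  0 < m -> 0 < r -> 0 < Q -> Q <= X -> 2 * i + m <= X ->
  wp X (compress_body j) s (stored 8 (compressA Q m r (ar s j)) i s).
Proof.
move=> vQ vm vr m0 r0 Q0 QX i2X.
have mQ k : k %% Q <= X by apply: leq_trans QX; rewrite ltnW // ltn_mod.
apply: wp_then; apply: wp_let; rewrite /= ?vi ?vr ?vm ?vQ.
  apply: leq_trans i2X; apply: leq_add; last by rewrite ltnW // ltn_mod.
  rewrite mulnCA leq_mul2l /=; apply: leq_trans (leq_trunc_div i (m * r)).
  by rewrite leq_mul2l leq_pmulr ?orbT.
apply: wp_then; apply: wp_let; rewrite /= ?vi ?vr ?vm ?vQ.
  by apply: leq_trans iX; apply: leq_trans (leq_div _ _) (leq_mod _ _).
apply: wp_cond => /=; rewrite ?vi ?vr ?vm ?vQ.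
  move=> /nat_of_bool1 c; apply: wp_put; rewrite /= ?vi ?vr ?vm ?vQ //.
  by apply: stored_put => //; [do ?[apply: frame_updv => //] | rewrite /compressA /= c subn1].
move=> /nat_of_bool0 c; apply: wp_put; rewrite /= ?vi ?vr ?vm ?vQ //.
by apply: stored_put => //; [do ?[apply: frame_updv => //] | rewrite /compressA /= c subn1].
Qed.

Lemma wp_mul j' Q : va s 7 = Q -> 0 < Q -> Q <= X ->
  wp X (mul_body j j') s (stored 2 (pairmulA Q (ar s j) (ar s j')) i s).
Proof.
move=> vQ Q0 QX.
have mQ k : k %% Q <= X by apply: leq_trans QX; rewrite ltnW // ltn_mod.
apply: wp_cond => /=; rewrite ?vi ?vQ.
  move=> /nat_of_bool1 c; apply: wp_put; rewrite /= ?vi ?vQ //.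
  by apply: stored_put => //; rewrite /pairmulA c !addn1.
move=> /nat_of_bool0 c; apply: wp_put; rewrite /= ?vi ?vQ //.
by apply: stored_put => //; rewrite /pairmulA c !subn1.
Qed.

End Bodies.

End ConvolutionProgram.

(** * Convolution with the recursion unrolled *)

Section Convolution.
Local Open Scope nat_scope.

Definition level_setup : cmd :=
  Then (Let 41 (Elt 8 ($46))) (Then (Let 42 ($41 %/ #2))
  (Then (Let 43 (Elt 9 ($42))) (Then (Let 44 (Elt 9 ($41 - $42)))
  (Let 45 ($9 * Elt 9 ($46 + #1)))))).

(** All polynomials of one depth have the same length and lie side by side, so the recursion becomes
    a loop over levels, without a stack. *)
Definition fwd_level (j : nat) : cmd :=
  Then (Let 46 ($40)) (Then level_setup (Then (tab j (expand_body j))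
  (For 48 ($42 + #1) (Then (Let 47 (Elt 9 ($42 - $48))) (tab j (fwd_body j)))))).

Definition bwd_level (j : nat) : cmd :=
  Then (Let 46 ($11 - $40 - #1)) (Then level_setup (Then
  (For 48 ($42 + #1) (Then (Let 47 (Elt 9 ($48))) (tab j (bwd_body j))))
  (Then (Let 45 ($9 * Elt 9 ($46))) (tab j (compress_body j))))).

Definition convolve : cmd :=
  Then (For 40 ($11) (fwd_level 5)) (Then (For 40 ($11) (fwd_level 7))
  (Then (Let 45 ($9 * Elt 9 ($11))) (Then (tab 5 (mul_body 5 7))
  (For 40 ($11) (bwd_level 5))))).

(* [kap k i] is the base-2 logarithm of the length of the polynomials after i
   levels. *)
Definition kap (k i : nat) : nat := iter i (fun c => c - c %/ 2) k.

Definition tables (Q hf k lev : nat) (s : astate) : Prop :=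
  [/\ va s 7 = Q, va s 8 = hf, va s 9 = 2 ^ k & va s 11 = lev] /\
  (forall i, i <= lev -> ar s 8 i = kap k i) /\
  (forall i, i <= k -> ar s 9 i = 2 ^ i).

Lemma tables_frame {Q hf k lev s s'} : tables Q hf k lev s ->
  frame 12 s s' -> ar s' 8 = ar s 8 -> ar s' 9 = ar s 9 -> tables Q hf k lev s'.
Proof.
move=> [[v7 v8 v9 v11] [t8 t9]] fr a8 a9.
by split; [rewrite !fr | rewrite a8 a9].
Qed.

Lemma kapS k i : kap k i.+1 = kap k i - kap k i %/ 2.
Proof. by []. Qed.

Lemma kap_le k i : kap k i <= k.
Proof. by elim: i => //= i IH; apply: leq_trans (leq_subr _ _) IH. Qed.

Section Runs.
Variables (E : comNzRingType) (Q hf k lev X : nat) (x : E).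
Hypotheses (Qgt0 : 0 < Q) (Q0 : (Q%:R = 0 :> E)%R)
  (hfE : ((hf%:R : E) *+ 2 = 1)%R) (xN : (x ^+ (2 ^ k) = -1)%R).
Hypotheses (levk : lev <= k) (QX : Q <= X) (NX : 4 * 2 ^ (k + lev) <= X).

(** Level i consists of [cnt i] polynomials of length 2^(kap k i) whose variable takes the value
    [yv i]. Together they have 2^(k + i) entries, since padding doubles the data at each level. *)
Definition yv (i : nat) : E := (x ^+ (2 ^ (k - kap k i)))%R.
Definition cnt (i : nat) : nat := 2 ^ (k + i - kap k i).

Lemma yvN i : (yv i ^+ (2 ^ kap k i) = -1)%R.
Proof. by rewrite /yv -exprM -expnD subnK ?kap_le. Qed.

Lemma yvS i : yv i.+1 = (yv i ^+ (2 ^ (kap k i %/ 2)))%R.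
Proof.
rewrite /yv -exprM -expnD; congr (_ ^+ (2 ^ _))%R.
have := kap_le k i; rewrite kapS; lia.
Qed.

Lemma cntS i : cnt i.+1 = cnt i * (2 * 2 ^ (kap k i %/ 2)).
Proof.
rewrite /cnt -expnS -expnD; congr (2 ^ _).
have := kap_le k i; rewrite kapS; lia.
Qed.

Lemma cnt_len i : cnt i * 2 ^ kap k i = 2 ^ (k + i).
Proof. by rewrite /cnt -expnD subnK // (leq_trans (kap_le k i)) ?leq_addr. Qed.

Lemma half_kap i : kap k i = kap k i %/ 2 + kap k i.+1.
Proof. by rewrite kapS; lia. Qed.

(** The exponent of m is rounded down, so m divides r; hence Y^(r / H) makes sense for every stride
    H <= m, and the 2 m evaluation points are powers of Y. *)
Lemma half_dvd i s : s <= kap k i %/ 2 -> 2 ^ s %| 2 ^ kap k i.+1.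
Proof. by move=> sh; apply: dvdn_exp2l; rewrite kapS; lia. Qed.

Let NN := 2 ^ (k + lev).
Let NN0 : 0 < NN. Proof. by rewrite expn_gt0. Qed.
Let pX e : e <= k + lev -> 2 ^ e <= X.
Proof. by move=> le; apply: leq_trans NX; apply: leq_trans (leq_pmull _ _) => //; rewrite leq_exp2l. Qed.
Let idX e : e <= k + lev -> e <= X.
Proof. by move=> le; apply: leq_trans (pX _ le); rewrite ltnW // ltn_expl. Qed.

Definition ready (i : nat) (s : astate) : Prop :=
  [/\ va s 42 = kap k i %/ 2, va s 43 = 2 ^ (kap k i %/ 2),
      va s 44 = 2 ^ kap k i.+1 & va s 45 = 2 ^ (k + i.+1)].

Lemma wp_setup i s (P : nat -> astate -> Prop) : tables Q hf k lev s -> i < lev ->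
  va s 46 = i ->
  (forall s', ready i s' -> frame 41 s s' -> va s' 46 = i -> ar s' = ar s -> P 5 s') ->
  wp X level_setup s P.
Proof.
move=> [[v7 v8 v9 v11] [t8 t9]] il v46 HP.
have kk := kap_le k i; have kS := half_kap i.
have le i' : i' <= k -> 2 ^ i' <= X by move=> h; apply: pX; lia.
apply: wp_then; apply: wp_let; rewrite /= ?v46 t8 1?ltnW //; first by apply: idX; lia.
apply: wp_then; apply: wp_let; rewrite /= ?v46; first by apply: idX; lia.
apply: wp_then; apply: wp_let; rewrite /= ?v46 t9 //; try (apply: le; lia); try lia.
apply: wp_then; apply: wp_let; rewrite /= ?v46 t9 //; try (apply: le; lia); try lia.
apply: wp_let; rewrite /= ?v9 v46 t9 ?addn1; try lia.
  by rewrite -expnD; apply: pX; lia.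
apply: HP => //; last by do 5! apply: frame_updv => //.
split=> //=; by rewrite expnD.
Qed.

Lemma wp_fwd_stage i j (s : astate) (P : nat -> astate -> Prop) :
  tables Q hf k lev s -> ready i s -> i < lev -> j != 6 ->
  forall t, t <= kap k i %/ 2 -> va s 47 = 2 ^ t -> (forall q, ar s j q <= Q) ->
  (forall n s', n <= 19 * NN -> frame 50 s s' ->
     (forall j', j' != 6 -> j' != j -> ar s' j' = ar s j') ->
     (forall q, ar s' j q <= Q) ->
     (forall g, g < cnt i.+1 -> ev E (2 ^ kap k i.+1) (yv i.+1) (ar s' j) g =
        fwdE E (2 ^ t) (twid E (yv i.+1) (2 ^ kap k i.+1) t)
          (ev E (2 ^ kap k i.+1) (yv i.+1) (ar s j)) g) -> P n s') ->
  wp X (tab j (fwd_body j)) s P.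
Proof.
move=> tb [v42 v43 v44 v45] il j6 t th v47 aQ HP.
have r0 : 0 < 2 ^ kap k i.+1 by rewrite expn_gt0.
have H0 : 0 < 2 ^ t by rewrite expn_gt0.
have Hr := half_dvd i t th.
have [[v7 v8 v9 v11] _] := tb.
have fQ q : fwdA Q (2 ^ t) (2 ^ kap k i.+1) (ar s j) q <= Q.
  by rewrite /fwdA; case: ifP => _; [|case: ifP => _]; rewrite ltnW // ltn_mod.
have NNi : 2 ^ (k + i.+1) <= NN by rewrite leq_exp2l //; lia.
apply: (wp_tab X j (2 ^ (k + i.+1)) 10 (fwdA Q (2 ^ t) (2 ^ kap k i.+1) (ar s j))) => //.
- by apply: pX; lia.
- by move=> q _; exact: leq_trans (fQ q) QX.
- move=> q s' qN vq fr fa.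
  apply: wp_mono (wp_fwd X j s' q vq _ _ Q (2 ^ t) (2 ^ kap k i.+1) _ _ _ r0 H0 Hr Qgt0 QX) _.
  + by apply: leq_trans (pX (k + i.+1) _); [exact: ltnW | lia].
  + by rewrite fr // v44; apply: pX; have := kap_le k i.+1; lia.
  + by rewrite fr.
  + by rewrite fr.
  + by rewrite fr.
  + by move=> n s''; rewrite /stored fa.
move=> n s' nl fr fa fj; apply: HP => //.
- by apply: leq_trans nl _; move: NNi NN0; lia.
- by move=> q; rewrite fj; case: ifP.
- move=> g gG; rewrite -(ev_fwd E Q Qgt0 Q0) ?yvN //.
  apply: (ev_agree E _ _ _ _ (cnt i.+1)) => // q qG.
  by rewrite fj -cnt_len qG.
Qed.

Lemma wp_fwd_level i j (s : astate) (P : nat -> astate -> Prop) :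
  tables Q hf k lev s -> va s 40 = i -> i < lev -> 12 <= X ->
  j \notin [:: 6; 8; 9] -> (forall q, ar s j q <= Q) ->
  (forall n s', n + 2 <= 24 * NN * (kap k i %/ 2 + 2) -> frame 41 s s' ->
     (forall j', j' != 6 -> j' != j -> ar s' j' = ar s j') ->
     (forall q, ar s' j q <= Q) ->
     level_rel E (kap k i %/ 2) (2 ^ kap k i.+1) (yv i.+1) (cnt i.+1)
       (ar s j) (ar s' j) -> P n s') ->
  wp X (fwd_level j) s P.
Proof.
move=> tb v40 il X12 jn aQ HP.
have [j6 [j8 j9]] : j != 6 /\ j != 8 /\ j != 9 by move: jn; rewrite !inE; lia.
have kk := kap_le k i; have kS := half_kap i.
have r0 : 0 < 2 ^ kap k i.+1 by rewrite expn_gt0.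
have m0 : 0 < 2 ^ (kap k i %/ 2) by rewrite expn_gt0.
have NNi : 2 ^ (k + i.+1) <= NN by rewrite leq_exp2l //; lia.
apply: wp_then; apply: wp_let; rewrite /= v40; first by apply: idX; lia.
apply: wp_then; apply: (wp_setup i) => //.
move=> s1 rd fr1' v46 a1 /=.
have fr1 : frame 41 s s1.
  by apply: frame_trans fr1'; exact: frame_updv.
have [v42 v43 v44 v45] := rd.
have tb1 : tables Q hf k lev s1.
  by apply: (tables_frame tb); rewrite ?a1 //; exact: frame_le fr1.
apply: wp_then.
have eX V q : (forall q, V q <= Q) -> expandA (2 ^ (kap k i %/ 2)) (2 ^ kap k i.+1) V q <= Q.
  by move=> VQ; rewrite /expandA; case: (_ < _); rewrite ?mul1n ?mul0n.
apply: (wp_tab X j (2 ^ (k + i.+1)) 1 (expandA (2 ^ (kap k i %/ 2)) (2 ^ kap k i.+1) (ar s1 j))) => //.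
- by apply: pX; lia.
- by move=> q _; apply: leq_trans QX; apply: eX; rewrite a1.
- move=> q s' qN vq fr fa.
  apply: wp_mono (wp_expand X j s' q vq (2 ^ (kap k i %/ 2)) (2 ^ kap k i.+1) _ _ _) _.
  + by rewrite fr.
  + by rewrite fr.
  + by move=> t; rewrite fa // a1; exact: leq_trans (aQ _) QX.
  + by move=> n s''; rewrite /stored fa.
move=> n2 s2 nl2 fr2 fa2 fj2 /=.
pose F := chunkE E (2 ^ (kap k i %/ 2)) (2 ^ kap k i.+1) (yv i.+1) (ar s j).
pose evj s' := ev E (2 ^ kap k i.+1) (yv i.+1) (ar s' j).
apply: (wp_for (kap k i %/ 2 + 1) (fun t n s' => [/\ va s' 48 = t, frame 47 s2 s',
  (forall j', j' != 6 -> j' != j -> ar s' j' = ar s2 j'), (forall q, ar s' j q <= Q)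
  & n <= t * (22 * NN) /\ (forall g, g < cnt i.+1 ->
     evj s' g = DFT E (kap k i %/ 2) (twid E (yv i.+1) (2 ^ kap k i.+1)) t F g)])) => //=.
- by apply: idX; lia.
- split=> //=; first exact: frame_updv.
    move=> q; rewrite fj2 a1; case: ifP => _; last exact: aQ.
    by apply: eX; exact: aQ.
  split=> // g gG; rewrite /F -(ev_expand E _ _ _ _ g r0 m0).
  apply: (ev_agree E _ _ _ _ (cnt i.+1)) => // q qG /=.
  by rewrite fj2 -cnt_len qG a1.
- by move=> t n s' tN [v48 fr _ _ _]; split=> //; rewrite fr // fr2 // v42.
- move=> t n s' tN [v48 fr fa aQ' [nl evt]].
  have tb' : tables Q hf k lev s'.
    apply: (tables_frame tb1); rewrite ?fa ?fa2 // 1?eq_sym //.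
    by apply: (frame_trans (frame_le _ fr2)) => //; exact: frame_le fr.
  apply: wp_then; apply: wp_let; rewrite /= v48 (fr 42) // (fr2 42) // v42.
    case: tb' => _ [_ ->]; last by lia.
    by apply: pX; lia.
  have -> : ar s' 9 (kap k i %/ 2 - t) = 2 ^ (kap k i %/ 2 - t).
    by case: tb' => _ [_ ->] //; lia.
  apply: (wp_fwd_stage i j _ _ _ _ il j6 (kap k i %/ 2 - t)) => //.
  + by split; rewrite /= ?fr // ?fr2.
  + by lia.
  move=> n' s'' nl' fr' fa' aQ'' ev' /=; split; first by rewrite fr' //= v48.
  split=> //=.
  + apply: frame_updv => //; apply: frame_trans fr _.
    by apply: frame_trans (frame_le _ fr'); [exact: frame_updv | ].
  + by move=> j' n6 nj; rewrite fa' //= fa.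
  split; first by rewrite mulSn; move: nl nl' NN0; lia.
  move=> g gG; rewrite /evj ev' //.
  apply: (fwdE_agree _ _ _ _ _ (cnt i.+1)) => //; first by rewrite expn_gt0.
  by rewrite cntS dvdn_mull // -!expnS dvdn_exp2l //; lia.
move=> n3 s3 [v48 fr3 fa3 aQ3 [nl3 ev3]]; apply: HP => //.
- move: nl3 nl2 NNi NN0; rewrite !mulnDl !mulnDr; lia.
- apply: (frame_trans fr1).
  by apply: (frame_trans (frame_le _ fr2)) => //; exact: frame_le fr3.
- by move=> j' n6 nj; rewrite fa3 ?fa2 ?a1.
- by move=> g gG; have := ev3 _ gG; rewrite addn1.
Qed.


(** The machine overwrites the contents of the array at each level; they are kept here as ghost data
    because the ascent is specified by them. *)
Definition descent (As : nat -> nat -> nat) (m : nat) : Prop :=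
  forall i, i < m -> level_rel E (kap k i %/ 2) (2 ^ kap k i.+1) (yv i.+1) (cnt i.+1)
    (As i) (As i.+1).

(** The numbers of stages telescope, as kap k i %/ 2 = kap k i - kap k i.+1: at most k over all
    levels, plus an overhead of two per level with lev <= k, whence 3 k. *)
Lemma wp_forward j (s : astate) (P : nat -> astate -> Prop) :
  tables Q hf k lev s -> 12 <= X -> j \notin [:: 6; 8; 9] ->
  (forall q, ar s j q <= Q) ->
  (forall n s' As, n <= 24 * NN * (3 * k) + 2 -> frame 40 s s' ->
     (forall j', j' != 6 -> j' != j -> ar s' j' = ar s j') ->
     (forall q, ar s' j q <= Q) -> As 0 = ar s j -> As lev = ar s' j ->
     descent As lev -> P n s') ->
  wp X (For 40 ($11) (fwd_level j)) s P.
Proof.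
move=> tb X12 jn aQ HP.
have [j6 [j8 j9]] : j != 6 /\ j != 8 /\ j != 9 by move: jn; rewrite !inE; lia.
apply: (wp_for lev (fun i n s' => [/\ va s' 40 = i, frame 40 s s',
  (forall j', j' != 6 -> j' != j -> ar s' j' = ar s j'), (forall q, ar s' j q <= Q)
  & n <= 24 * NN * (k - kap k i + 2 * i) /\
    exists As : nat -> nat -> nat, [/\ As 0 = ar s j, As i = ar s' j & descent As i]])).
- by apply: idX; lia.
- split=> //=; first exact: frame_updv.
  by split=> //; exists (fun=> ar s j); split.
- move=> i n s' il [v40 fr _ _ _]; split=> //=; rewrite fr //.
  by case: tb => [[]].
- move=> i n s' il [v40 fr fa aQ' [nl [As [As0 Asi dsc]]]].
  have tb' : tables Q hf k lev s'.
    apply: (tables_frame tb); rewrite ?fa // 1?eq_sym //; exact: frame_le fr.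
  apply: (wp_fwd_level i j _ _ tb' v40 il X12 jn aQ') => n' s'' nl' fr' fa' aQ'' rel.
  split; first by rewrite fr'.
  split=> //=.
  + apply: frame_updv => //; apply: frame_trans fr _; exact: frame_le fr'.
  + by move=> j' n6 nj; rewrite fa' ?fa.
  split.
    have ki := kap_le k i; have ks := half_kap i.
    apply: (@leq_trans (24 * NN * (k - kap k i + 2 * i) + 24 * NN * (kap k i %/ 2 + 2))); first by lia.
    rewrite -mulnDr leq_mul2l; apply/orP; right; lia.
  exists (fun i' => if i' <= i then As i' else ar s'' j); rewrite leq0n ltnn; split=> //.
  move=> i'; rewrite ltnS => le; have [->|ne] := eqVneq i' i; first by rewrite leqnn ltnn Asi.
  by have lt : i' < i; [rewrite ltn_neqAle ne | rewrite le lt; exact: dsc].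
move=> n s' [_ fr fa aQ' [nl [As [As0 Asl dsc]]]]; apply: (HP _ _ As) => //.
rewrite leq_add2r; apply: leq_trans nl _; rewrite leq_mul2l; apply/orP; right; lia.
Qed.

Lemma wp_bwd_stage i (s : astate) (P : nat -> astate -> Prop) :
  tables Q hf k lev s -> ready i s -> i < lev ->
  forall t, t <= kap k i %/ 2 -> va s 47 = 2 ^ t -> (forall q, ar s 5 q <= Q) ->
  (forall n s', n <= 21 * NN -> frame 50 s s' ->
     (forall j', j' != 6 -> j' != 5 -> ar s' j' = ar s j') ->
     (forall q, ar s' 5 q <= Q) ->
     (forall g, g < cnt i.+1 -> ev E (2 ^ kap k i.+1) (yv i.+1) (ar s' 5) g =
        bwdE E (hf%:R)%R (2 ^ t) (itwid E (yv i.+1) (2 ^ kap k i.+1) t)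
          (ev E (2 ^ kap k i.+1) (yv i.+1) (ar s 5)) g) -> P n s') ->
  wp X (tab 5 (bwd_body 5)) s P.
Proof.
move=> tb [v42 v43 v44 v45] il t th v47 aQ HP.
have r0 : 0 < 2 ^ kap k i.+1 by rewrite expn_gt0.
have H0 : 0 < 2 ^ t by rewrite expn_gt0.
have Hr := half_dvd i t th.
have [[v7 v8 v9 v11] _] := tb.
have fQ q : bwdA Q hf (2 ^ t) (2 ^ kap k i.+1) (ar s 5) q <= Q.
  by rewrite /bwdA; case: ifP => _; rewrite ltnW // ltn_mod.
have NNi : 2 ^ (k + i.+1) <= NN by rewrite leq_exp2l //; lia.
apply: (wp_tab X 5 (2 ^ (k + i.+1)) 12 (bwdA Q hf (2 ^ t) (2 ^ kap k i.+1) (ar s 5))) => //.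
- by apply: pX; lia.
- by move=> q _; exact: leq_trans (fQ q) QX.
- move=> q s' qN vq fr fa.
  apply: wp_mono (wp_bwd X 5 s' q vq _ _ Q hf (2 ^ t) (2 ^ kap k i.+1) _ _ _ _ r0 H0 Hr Qgt0 QX _) _.
  + by apply: leq_trans (pX (k + i.+1) _); [exact: ltnW | lia].
  + by rewrite fr // v44; apply: pX; have := kap_le k i.+1; lia.
  + by rewrite fr.
  + by rewrite fr.
  + by rewrite fr.
  + by rewrite fr.
  + by move=> q'; rewrite fa //; exact: leq_trans (aQ _) QX.
  + by move=> n s''; rewrite /stored fa.
move=> n s' nl fr fa fj; apply: HP => //.
- by apply: leq_trans nl _; move: NNi NN0; lia.
- by move=> q; rewrite fj; case: ifP.
- move=> g gG; rewrite -(ev_bwd E Q hf Q0 (2 ^ kap k i.+1) (2 ^ t) (yv i.+1)) ?yvN //.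
    apply: (ev_agree E _ _ _ _ (cnt i.+1)) => // q qG.
    by rewrite fj -cnt_len qG.
  by apply: (twid_itwid E); exact: yvN.
Qed.

Lemma wp_bwd_level i (s : astate) (VA VB VA' VB' : nat -> nat)
    (P : nat -> astate -> Prop) :
  tables Q hf k lev s -> va s 40 + i + 1 = lev -> 12 <= X ->
  (forall q, ar s 5 q <= Q) ->
  let lr := level_rel E (kap k i %/ 2) (2 ^ kap k i.+1) (yv i.+1) (cnt i.+1) in
  lr VA VA' -> lr VB VB' ->
  (forall g, g < cnt i.+1 -> ev E (2 ^ kap k i.+1) (yv i.+1) (ar s 5) g =
     (ev E (2 ^ kap k i.+1) (yv i.+1) VA' g * ev E (2 ^ kap k i.+1) (yv i.+1) VB' g)%R) ->
  (forall n s', n + 2 <= 30 * NN * (kap k i %/ 2 + 2) -> frame 41 s s' ->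
     (forall j', j' != 6 -> j' != 5 -> ar s' j' = ar s j') ->
     (forall q, ar s' 5 q <= Q) ->
     (forall p, p < cnt i -> ev E (2 ^ kap k i) (yv i) (ar s' 5) p =
       (ev E (2 ^ kap k i) (yv i) VA p * ev E (2 ^ kap k i) (yv i) VB p)%R) -> P n s') ->
  wp X (bwd_level 5) s P.
Proof.
move=> tb v40 X12 aQ lr relA relB mulC HP.
have il : i < lev by lia.
have kk := kap_le k i; have kS := half_kap i.
have r0 : 0 < 2 ^ kap k i.+1 by rewrite expn_gt0.
have m0 : 0 < 2 ^ (kap k i %/ 2) by rewrite expn_gt0.
have NNi : 2 ^ (k + i.+1) <= NN by rewrite leq_exp2l //; lia.
have v11 : va s 11 = lev by case: tb => [[]].
have iE : lev - va s 40 - 1 = i by lia.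
apply: wp_then; apply: wp_let; rewrite /= v11 iE; first by apply: idX; lia.
apply: wp_then; apply: (wp_setup i) => //.
move=> s1 rd fr1' v46 a1 /=.
have fr1 : frame 41 s s1.
  by apply: frame_trans fr1'; exact: frame_updv.
have [v42 v43 v44 v45] := rd.
have tb1 : tables Q hf k lev s1.
  by apply: (tables_frame tb); rewrite ?a1 //; exact: frame_le fr1.
apply: wp_then.
pose evj s' := ev E (2 ^ kap k i.+1) (yv i.+1) (ar s' 5).
apply: (wp_for (kap k i %/ 2 + 1) (fun t n s' => [/\ va s' 48 = t, frame 47 s1 s',
  (forall j', j' != 6 -> j' != 5 -> ar s' j' = ar s1 j'), (forall q, ar s' 5 q <= Q)
  & n <= t * (24 * NN) /\ (forall g, g < cnt i.+1 ->
     evj s' g = IDFT E (hf%:R)%R (itwid E (yv i.+1) (2 ^ kap k i.+1)) t (evj s) g)])) => //=.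
- by apply: idX; lia.
- split=> //=; first exact: frame_updv.
    by move=> q; rewrite a1; exact: aQ.
  by split=> // g gG; rewrite /evj /= a1.
- by move=> t n s' tN [v48 fr _ _ _]; split=> //; rewrite fr // v42.
- move=> t n s' tN [v48 fr fa aQ' [nl evt]].
  have tb' : tables Q hf k lev s'.
    apply: (tables_frame tb1); rewrite ?fa //; exact: frame_le fr.
  have e9 : ar s' 9 t = 2 ^ t by case: tb' => _ [_ ->] //; lia.
  apply: wp_then; apply: wp_let; rewrite /= v48 e9; first by apply: pX; lia.
  apply: (wp_bwd_stage i _ _ _ _ il t) => //.
  + by split; rewrite /= ?fr.
  + by lia.
  move=> n' s'' nl' fr' fa' aQ'' ev' /=; split; first by rewrite fr' //= v48.
  split=> //=.
  + apply: frame_updv => //; apply: frame_trans fr _.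
    by apply: frame_trans (frame_le _ fr'); [exact: frame_updv | ].
  + by move=> j' n6 nj; rewrite fa' //= fa.
  split; first by rewrite mulSn; move: nl nl' NN0; lia.
  move=> g gG; rewrite /evj ev' //.
  apply: (bwdE_agree _ _ _ _ _ _ (cnt i.+1)) => //; first by rewrite expn_gt0.
  by rewrite cntS dvdn_mull // -!expnS dvdn_exp2l //; lia.
move=> n3 s3 [v48 fr3 fa3 aQ3 [nl3 ev3]].
have tb3 : tables Q hf k lev s3.
  by apply: (tables_frame tb1); rewrite ?fa3 //; exact: frame_le fr3.
have [[v7 v8 v9 _] [t8 t9]] := tb3.
have v46' : va s3 46 = i by rewrite fr3.
apply: wp_then; apply: wp_let; rewrite /= v9 v46' t9; try lia.
  by rewrite -expnD; apply: pX; lia.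
rewrite -expnD.
have cQ q : compressA Q (2 ^ (kap k i %/ 2)) (2 ^ kap k i.+1) (ar s3 5) q <= Q.
  by rewrite ltnW // ltn_mod.
have NNi' : 2 ^ (k + i) <= NN by rewrite leq_exp2l //; lia.
apply: (wp_tab X 5 (2 ^ (k + i)) 8 (compressA Q (2 ^ (kap k i %/ 2)) (2 ^ kap k i.+1) (ar s3 5))) => //.
- by apply: pX; lia.
- by move=> q _; exact: leq_trans (cQ q) QX.
- move=> q s' qN vq fr fa.
  apply: wp_mono (wp_compress X 5 s' q vq _ Q (2 ^ (kap k i %/ 2)) (2 ^ kap k i.+1) _ _ _ m0 r0 Qgt0 QX _) _.
  + by apply: leq_trans (pX (k + i) _); [exact: ltnW | lia].
  + by rewrite fr //=.
  + by rewrite fr //= fr3.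
  + by rewrite fr //= fr3.
  + apply: leq_trans NX.
    have : 2 ^ (kap k i %/ 2) <= NN by rewrite leq_exp2l //; lia.
    by move: qN NNi' ; rewrite -/NN; lia.
  + by move=> n s''; rewrite /stored fa.
move=> n4 s4 nl4 fr4 fa4 fj4; apply: HP => //.
- move: nl3 nl4 NNi' NN0; rewrite !mulnDl !mulnDr; lia.
- apply: (frame_trans fr1); apply: frame_trans (frame_le _ fr3) _ => //.
  by apply: frame_trans (frame_le _ fr4); [exact: frame_updv |].
- by move=> j' n6 nj; rewrite fa4 //= fa3 ?a1.
- by move=> q; rewrite fj4; case: ifP => _; [exact: cQ | exact: aQ3].
move=> p pc.
transitivity (ev E (2 ^ kap k i) (yv i)
    (compressA Q (2 ^ (kap k i %/ 2)) (2 ^ kap k i.+1) (ar s3 5)) p).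
  apply: (ev_agree E _ _ _ _ (cnt i)) => // q; rewrite cnt_len => qG.
  by rewrite fj4 qG.
have e2 : 2 ^ kap k i = 2 ^ (kap k i %/ 2) * 2 ^ kap k i.+1 by rewrite -expnD -half_kap.
rewrite e2; apply: (level_mul E Q hf Qgt0 Q0 hfE _ _ (cnt i) _ VA VB VA' VB' (ar s 5)) => //.
- by apply: half_dvd.
- by rewrite -e2 yvN.
- by rewrite -yvS -cntS.
- by rewrite -yvS -cntS.
- by rewrite -yvS -cntS.
- by rewrite -yvS -cntS => g gG; have := ev3 _ gG; rewrite addn1.
Qed.


(** On the way up, the array at level lev - t holds the products of the corresponding polynomials of
    [As] and [Bs]; at level 0 these are the two inputs. *)
Lemma wp_conv_eval (s : astate) (P : nat -> astate -> Prop) :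
  tables Q hf k lev s -> 12 <= X -> kap k lev = 1 -> 0 < k ->
  (forall q, ar s 5 q <= Q) -> (forall q, ar s 7 q <= Q) ->
  (forall n s', n <= 280 * NN * k -> frame 40 s s' ->
     (forall j', j' \notin [:: 5; 6; 7] -> ar s' j' = ar s j') ->
     (forall q, ar s' 5 q <= Q) -> (forall q, ar s' 7 q <= Q) ->
     ev E (2 ^ k) x (ar s' 5) 0 = (ev E (2 ^ k) x (ar s 5) 0 * ev E (2 ^ k) x (ar s 7) 0)%R ->
     P n s') ->
  wp X convolve s P.
Proof.
move=> tb X12 kl k0 a5 a7 HP.
apply: wp_then; apply: wp_forward => // n1 s1 As nl1 fr1 fa1 a5' As0 Asl dA.
have tb1 : tables Q hf k lev s1.
  by apply: (tables_frame tb); rewrite ?fa1 //; exact: frame_le fr1.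
apply: wp_then; apply: wp_forward => //; first by rewrite fa1.
move=> n2 s2 Bs nl2 fr2 fa2 a7' Bs0 Bsl dB.
have tb2 : tables Q hf k lev s2.
  by apply: (tables_frame tb1); rewrite ?fa2 //; exact: frame_le fr2.
have [[v7 v8 v9 v11] [t8 t9]] := tb2.
apply: wp_then; apply: wp_let; rewrite /= v9 v11 t9 -?expnD //; first exact: pX.
apply: wp_then.
have mQ q : pairmulA Q (ar s2 5) (ar s2 7) q <= Q.
  by rewrite /pairmulA; case: ifP => _; rewrite ltnW // ltn_mod Qgt0.
apply: (wp_tab X 5 NN 2 (pairmulA Q (ar s2 5) (ar s2 7))) => //.
- exact: pX.
- by move=> q _; exact: leq_trans (mQ q) QX.
- move=> q s' qN vq fr fa.
  apply: wp_mono (wp_mul X 5 s' q vq 7 Q _ Qgt0 QX) _; first by rewrite fr.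
  by move=> n s''; rewrite /stored (fa 5) // (fa 7).
move=> n3 s3 nl3 fr3' fa3 fj3 /=.
have fr3 : frame 40 s2 s3.
  by apply: frame_trans (frame_le _ fr3'); [exact: frame_updv |].
have tb3 : tables Q hf k lev s3.
  by apply: (tables_frame tb2); rewrite ?fa3 //; exact: frame_le fr3.
have a5'' q : ar s3 5 q <= Q.
  by rewrite fj3; case: ifP => _; [exact: mQ | rewrite /= fa2].
have base p : p < cnt lev -> ev E (2 ^ kap k lev) (yv lev) (ar s3 5) p =
    (ev E (2 ^ kap k lev) (yv lev) (As lev) p * ev E (2 ^ kap k lev) (yv lev) (Bs lev) p)%R.
  move=> pc; rewrite kl expn1 Asl Bsl -(ev_mul E Q Qgt0 Q0); last first.
    by have := yvN lev; rewrite kl expn1.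
  apply: (ev_agree E _ _ _ _ (cnt lev)) => // q.
  have -> : cnt lev * 2 = NN by rewrite /NN -(cnt_len lev) kl expn1.
  by move=> qN; rewrite fj3 qN (fa2 5).
apply: (wp_for lev (fun t n s' => [/\ va s' 40 = t, frame 40 s3 s',
  (forall j', j' != 6 -> j' != 5 -> ar s' j' = ar s3 j'), (forall q, ar s' 5 q <= Q)
  & n <= 30 * NN * (kap k (lev - t) - kap k lev + 2 * t) /\
    (forall p, p < cnt (lev - t) ->
      ev E (2 ^ kap k (lev - t)) (yv (lev - t)) (ar s' 5) p =
      (ev E (2 ^ kap k (lev - t)) (yv (lev - t)) (As (lev - t)%N) p *
       ev E (2 ^ kap k (lev - t)) (yv (lev - t)) (Bs (lev - t)%N) p)%R)])).
- by apply: idX; lia.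
- by split=> //=; rewrite ?subn0 //; exact: frame_updv.
- move=> t n s' tl [v40 fr _ _ _]; split=> //=; rewrite fr //.
  by case: tb3 => [[]].
- move=> t n s' tl [v40 fr fa aQ' [nl evt]].
  have tb' : tables Q hf k lev s'.
    apply: (tables_frame tb3); rewrite ?fa //; exact: frame_le fr.
  have e1 : lev - t = (lev - t.+1).+1 by lia.
  set i := lev - t.+1 in e1 *; rewrite e1 in evt nl.
  apply: (wp_bwd_level i _ (As i) (Bs i) (As i.+1) (Bs i.+1)) => //.
  + by rewrite v40 /i; lia.
  + by apply: dA; rewrite /i; lia.
  + by apply: dB; rewrite /i; lia.
  move=> n' s'' nl' fr' fa' aQ'' ev'.
  split; first by rewrite fr'.
  split=> //=.
  + apply: frame_updv => //; apply: frame_trans fr _; exact: frame_le fr'.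
  + by move=> j' n6 nj; rewrite fa' ?fa.
  split=> //.
  have ks := half_kap i.
  have kl1 : kap k lev <= kap k i.+1.
    rewrite (_ : lev = t + i.+1); last by rewrite /i; lia.
    rewrite /kap iterD -/(kap k i.+1); elim: (t) => //= t' IH.
    by apply: leq_trans (leq_subr _ _) IH.
  apply: (@leq_trans (30 * NN * (kap k i.+1 - kap k lev + 2 * t) + 30 * NN * (kap k i %/ 2 + 2))); first by lia.
  rewrite -mulnDr leq_mul2l; apply/orP; right; lia.
move=> n4 s4 [v4 fr4 fa4 aQ4 []]; rewrite subnn => nl4 ev4; apply: HP.
- have b4 : n4 <= 30 * NN * (3 * k).
    apply: leq_trans nl4 _; rewrite leq_mul2l; apply/orP; right.
    by rewrite /kap /=; lia.
  have kN : NN <= NN * k by rewrite leq_pmulr.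
  have reorder a b : a * NN * (b * k) = a * b * (NN * k) by ring.
  move: nl1 nl2 nl3 b4 kN NN0; rewrite !reorder -[280 * NN * k]mulnA.
  by move: (NN * k) => M; clear; lia.
- by apply: frame_trans fr1 (frame_trans fr2 (frame_trans fr3 fr4)).
- move=> j'; rewrite !inE !negb_or => /and3P[n5 n6 n7].
  by rewrite fa4 // fa3 //= fa2 // fa1.
- exact: aQ4.
- by move=> q; rewrite fa4 // fa3 //= a7'.
have := ev4 0; rewrite /yv /cnt /kap /= subnn expr1 addn0 subnn => -> //.
by rewrite As0 Bs0 fa1.
Qed.

End Runs.

Lemma wp_conv (Q hf k lev X T : nat) (s : astate) (P : nat -> astate -> Prop) :
  1 < Q -> hf * 2 = Q.+1 -> lev <= k -> Q <= X -> 4 * 2 ^ (k + lev) <= X ->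
  tables Q hf k lev s -> 12 <= X -> kap k lev = 1 -> 0 < k -> 2 * T < 2 ^ k ->
  (forall q, ar s 5 q <= Q) -> (forall q, ar s 7 q <= Q) ->
  (forall q, T < q < 2 ^ k -> ar s 5 q = 0) ->
  (forall q, T < q < 2 ^ k -> ar s 7 q = 0) ->
  (forall n s', n <= 280 * 2 ^ (k + lev) * k -> frame 40 s s' ->
     (forall j', j' \notin [:: 5; 6; 7] -> ar s' j' = ar s j') ->
     (forall q, ar s' 5 q <= Q) -> (forall q, ar s' 7 q <= Q) ->
     (forall i, i < 2 ^ k ->
       ar s' 5 i %% Q = (\sum_(j < i.+1) ar s 5 j * ar s 7 (i - j)) %% Q) ->
     P n s') ->
  wp X convolve s P.
Proof.
move=> Q1 hfE levk QX NX tb X12 kl k0 Tk a5 a7 z5 z7 HP.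
have n0 : 0 < 2 ^ k by rewrite expn_gt0.
have [E [x [QE xN mulE]]] := negacyclic_ring Q (2 ^ k) Q1 n0.
(* Since 2 hf = Q + 1 and Q vanishes in E, [hf] is 1/2; this is why Q is odd. *)
have hE : ((hf%:R : E) *+ 2 = 1)%R by rewrite -mulrnA hfE -addn1 natrD QE add0r.
apply: (wp_conv_eval E Q hf k lev X x) => //; first exact: ltnW.
move=> m s' ml fr fa a5' a7' evs; apply: HP => // i ik.
exact: (mulE T _ _ _ Tk z5 z7 evs).
Qed.

End Convolution.

(** * The dynamic algorithm *)

Section Initialisation.
Local Open Scope nat_scope.

(* Variables: 5 is q, 6 is q^2, 7 is the modulus Q of the convolutions, 8 is 1/2
   modulo Q, 9 is 2^k, 10 is k, 11 is lev, 12 is the number of sums found since the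
   last rebuild, 13 is T + 1, and 4 is the weight whose insertion is pending, 0 if
   there is none.
   Arrays: 0 is the status of the sums, 1 lists those found since the last
   rebuild, 2 marks the weights that cannot yield new sums any more, 3 and 4 hold
   [certs] and [stale], 5, 6 and 7 are buffers, 8 is [kap k] and 9 holds powers
   of two. *)
Definition init : cmd :=
  Then (Let 13 ($0 + #1)) (Then (Let 7 ($0 + $0 + #3)) (Then (Let 8 ($0 + #2))
  (Then (Let 5 (#1))
  (Then (For 20 ($0) (Cond ($5 * $5 * $5 < $13) (Let 5 ($5 + #1)) Nop))
  (Then (Let 6 ($5 * $5))
  (Then (Let 9 (#1)) (Then (Let 10 (#0)) (Then (Put 9 (#0) (#1))
  (Then (For 20 ($13) (Cond ($9 < $0 + $0 + #1)
     (Then (Let 9 ($9 * #2)) (Then (Let 10 ($10 + #1)) (Put 9 ($10) ($9)))) Nop))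
  (Then (Let 11 (#0)) (Then (Let 21 ($10)) (Then (Put 8 (#0) ($10))
  (Then (For 20 ($10) (Cond (#1 < $21)
     (Then (Let 21 ($21 - $21 %/ #2)) (Then (Let 11 ($11 + #1)) (Put 8 ($11) ($21)))) Nop))
  (Then (Put 0 (#0) (#2)) (Then (Put 1 (#0) (#0)) (Let 12 (#1))))))))))))))))).

Definition Xof (T : nat) := 64 * T.+1 ^ 3.

(* q^2 is both the length of a block and the number of new sums that triggers a
   rebuild; 2^k is the length of the convolutions and lev their recursion depth. *)
Definition sized (T q k lev : nat) : Prop :=
  [/\ q.-1 ^ 3 <= T < q ^ 3, 2 * T < 2 ^ k <= 4 * T, lev <= k,
      kap k lev = 1 & 2 ^ lev <= 2 * k].

Definition params (T q k lev : nat) (s : astate) : Prop :=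
  [/\ va s 0 = T, va s 5 = q, va s 6 = q * q & va s 13 = T.+1] /\
  tables (2 * T + 3) (T + 2) k lev s.

(** Halving c with rounding up at least halves c - 1. So the recursion stops within k levels, and
    its last proper step gives 2^lev <= 2 k, which limits the growth by padding to a factor O(log
    T). *)
Lemma kap_halving k i : 0 < k -> (kap k i - 1) * 2 ^ i <= k - 1.
Proof.
move=> k0; elim: i => [|i IH]; first by rewrite muln1.
apply: leq_trans IH; rewrite kapS expnS mulnA leq_mul2r; apply/orP; right; lia.
Qed.

Lemma kap_gt0 k i : 0 < k -> 0 < kap k i.
Proof. by move=> k0; elim: i => // i; rewrite kapS; lia. Qed.

Definition fixes (l : seq nat) (s s' : astate) := forall x, x \in l -> va s' x = va s x.

Lemma fixes_updv l s s' x v : x \notin l -> fixes l s s' -> fixes l s (updv s' x v).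
Proof.
move=> xl fx y yl /=; case: eqnP => [e|_]; last exact: fx.
by rewrite -e yl in xl.
Qed.

Lemma upda_other {s i v j j'} : j' != j -> ar (upda s j i v) j' = ar s j'.
Proof. by move=> /=; case: eqnP => // ->; rewrite eqxx. Qed.

Lemma upda_same s j i v k : ar (upda s j i v) j k = if k == i then v else ar s j k.
Proof. by rewrite /= eqnE eqxx. Qed.

Lemma wp_init T (s : astate) (P : nat -> astate -> Prop) :
  0 < T -> va s 0 = T ->
  (forall n s' q k lev, n <= 40 * T.+1 -> params T q k lev s' -> sized T q k lev ->
     va s' 12 = 1 -> (forall x, x \in [:: 1; 2; 3; 4] -> va s' x = va s x) ->
     (forall j, j \notin [:: 0; 1; 8; 9] -> ar s' j = ar s j) ->
     (forall i, ar s' 0 i = if i == 0 then 2 else ar s 0 i) ->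
     (forall i, ar s' 1 i = if i == 0 then 0 else ar s 1 i) -> P n s') ->
  wp (Xof T) init s P.
Proof.
move=> T0 vT HP; set X := Xof T.
have XT : 64 * T.+1 <= X.
  by rewrite /X /Xof leq_mul2l -{1}[T.+1]expn1 leq_exp2l.
do 3! (apply: wp_then; apply: wp_let; rewrite /= ?vT; first by lia).
do 1! (apply: wp_then; apply: wp_let; rewrite /= ?vT; first by lia).
apply: wp_then.
set s1 := updv _ 5 1.
have s1E : va s1 0 = T /\ va s1 13 = T.+1 by rewrite /= vT addn1.
(* The last disjunct says that every round so far has incremented; after T rounds it would give q =
   T + 1, whose cube exceeds T. The other two searches end by the same argument. *)
apply: (wp_for T (fun i n s' => [/\ va s' 20 = i, fixes [:: 0; 1; 2; 3; 4; 7; 8; 13] s1 s',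
   ar s' = ar s, 0 < va s' 5 <= i.+1 /\ (va s' 5).-1 ^ 3 <= T & n <= i * 4 /\
   (T < va s' 5 ^ 3 \/ va s' 5 = i.+1)])).
- by lia.
- by split=> //; [exact: fixes_updv | split=> //; right].
- by move=> i n s' _ [v20 fx _ _ _]; split=> //=; rewrite fx // vT.
- move=> i n s' iT [v20 fx as' [v5 c5] [nl or5]].
  have cube v : v * v * v = v ^ 3 by rewrite !expnS expn0 muln1 mulnA.
  apply: wp_cond => /=; rewrite (fx 13) // s1E.2 cube.
    move=> /nat_of_bool1; rewrite ltnS => le3.
    apply: wp_let; rewrite /= ?addn1; first by lia.
    split=> //; split=> //=; first by do 2! apply: fixes_updv => //.
      by split=> //; lia.
    by split; [lia | right; case: or5; [rewrite ltnNge le3 | move=> ->]].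
  move=> /nat_of_bool0 /negbT; rewrite ltnS -ltnNge => gt3; apply: wp_nop.
  split=> //; split=> //=; first exact: fixes_updv.
    by split=> //; lia.
  by split; [lia | left].
move=> n1 s2 [_ fx2 as2 [v5 c5] [nl1 or5]] /=.
set q := va s2 5 in v5 c5 or5 *.
have q3 : T < q ^ 3.
  case: or5 => // qT; rewrite qT !expnS expn0 muln1; nia.
have qT : q <= T.+1 by lia.
apply: wp_then; apply: wp_let; rewrite /= -/q.
  have : q.-1 * q.-1 * q.-1 <= T by rewrite -mulnA; move: c5; rewrite !expnS expn0 muln1.
  by nia.
apply: wp_then; apply: wp_let; rewrite /=; first by lia.
apply: wp_then; apply: wp_let; rewrite /=; first by lia.
apply: wp_then; apply: wp_put; rewrite /=; first by lia.
apply: wp_then.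
set s3 := upda _ 9 0 1.
have s3E : va s3 0 = T /\ va s3 13 = T.+1 by rewrite /= !fx2 // s1E.1 s1E.2.
apply: (wp_for T.+1 (fun i n s' => [/\ va s' 20 = i,
   fixes [:: 0; 1; 2; 3; 4; 5; 6; 7; 8; 13] s3 s',
   (forall j, j != 9 -> ar s' j = ar s j),
   [/\ va s' 10 <= i, va s' 9 = 2 ^ va s' 10, va s' 9 <= 4 * T &
     forall i, i <= va s' 10 -> ar s' 9 i = 2 ^ i] & n <= i * 6 /\
   (2 * T < va s' 9 \/ va s' 10 = i)])).
- by lia.
- split=> //; first exact: fixes_updv.
    by move=> j j9; rewrite -as2; exact: upda_other.
  by split=> //; [change (1 <= 4 * T); lia | case].
  by split=> //; right.
- by move=> i n s' _ [v20 fx _ _ _]; split=> //=; rewrite fx // s3E.2.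
- move=> i n s' iT [v20 fx fa [v10 v9 v9T t9] [nl or9]].
  apply: wp_cond => /=; rewrite (fx 0) // s3E.1.
    move=> /nat_of_bool1 lt9.
    apply: wp_then; apply: wp_let; rewrite /=; first by lia.
    apply: wp_then; apply: wp_let; rewrite /=; first by lia.
    apply: wp_put; rewrite /=; first by lia.
    split=> //; split=> //; first by do 3! apply: fixes_updv => //.
    - by move=> j j9; rewrite -fa //; exact: upda_other.
    - split=> /=; [lia | by rewrite v9 addn1 expnSr | lia |].
      move=> i' i'le; case: eqP => [->|ne]; first by rewrite v9 addn1 expnSr.
      by apply: t9; lia.
    by split=> /=; [lia | case: or9; lia].
  move=> /nat_of_bool0 ge9; apply: wp_nop.
  split=> //; split=> //=; first exact: fixes_updv.
    by split=> //; lia.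
  by split; [lia | left; lia].
move=> n2 s4 [_ fx4 fa4 [v10 v9 v9T t9] [nl2 or9]] /=.
set k := va s4 10 in v10 v9 or9 t9 *.
have k2T : 2 * T < 2 ^ k.
  rewrite -v9; case: or9 => // kT; rewrite v9 kT expnS ltn_pmul2l //.
  exact: ltn_expl.
have k0 : 0 < k by case: (k) k2T => //; rewrite expn0; lia.
apply: wp_then; apply: wp_let; rewrite /=; first by lia.
apply: wp_then; apply: wp_let; rewrite /= -/k; first by lia.
apply: wp_then; apply: wp_put; rewrite /= -/k; first by lia.
apply: wp_then.
set s5 := upda _ 8 0 k.
apply: (wp_for k (fun i n s' => [/\ va s' 20 = i,
   fixes [:: 0; 1; 2; 3; 4; 5; 6; 7; 8; 9; 10; 13] s5 s',
   (forall j, j != 8 -> ar s' j = ar s5 j),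
   [/\ va s' 11 <= i, va s' 21 = kap k (va s' 11),
     0 < va s' 11 -> 2 ^ va s' 11 <= 2 * k &
     forall i, i <= va s' 11 -> ar s' 8 i = kap k i] & n <= i * 6 /\
   (va s' 21 = 1 \/ va s' 11 = i)])).
- by lia.
- split=> //; first exact: fixes_updv.
  by split=> //; case=> // _; rewrite upda_same.
  by split=> //; right.
- by move=> i n s' _ [v20 fx _ _ _]; split=> //=; rewrite fx.
- move=> i n s' ik [v20 fx fa [v11 v21 p11 t8] [nl or8]].
  have kl := kap_le k (va s' 11); have kg := kap_gt0 k (va s' 11) k0.
  apply: wp_cond => /=; rewrite v21.
    move=> /nat_of_bool1 lt1.
    apply: wp_then; apply: wp_let; rewrite /= ?v21; first by lia.
    apply: wp_then; apply: wp_let; rewrite /=; first by lia.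
    apply: wp_put; rewrite /=; first by lia.
    split=> //; split=> //; first by do 3! apply: fixes_updv => //.
    - by move=> j j8; transitivity (ar s' j); [exact: upda_other | exact: fa].
    - split=> /=; rewrite ?addn1; [lia | by rewrite kapS | move=> _ |].
        have := kap_halving k (va s' 11) k0; rewrite expnS leq_mul2l /=.
        by move: (2 ^ va s' 11) => z; nia.
      move=> i' i'le; case: eqP => [->|ne]; first by rewrite kapS.
      by apply: t8; lia.
    by split=> /=; [lia | right; case: or8; lia].
  move=> /nat_of_bool0 ge1; apply: wp_nop.
  split=> //; split=> //=; first exact: fixes_updv.
    by split=> //; lia.
  by split; [lia | left; lia].
move=> n3 s6 [_ fx6 fa6 [v11 v21 p11 t8] [nl3 or8]] /=.
set lev := va s6 11 in v11 v21 p11 t8 or8 *.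
have kapl : kap k lev = 1.
  case: or8 => [<-//|lk]; have := kap_halving k lev k0.
  have := kap_gt0 k lev k0; have := ltn_expl lev (isT : 1 < 2); rewrite lk.
  by move: (2 ^ k) (kap k k) => a b; nia.
have lev2 : 2 ^ lev <= 2 * k.
  by case: (posnP lev) => [->|/p11//]; rewrite expn0; lia.
apply: wp_then; apply: wp_put; rewrite /=; first by lia.
apply: wp_then; apply: wp_put; rewrite /=; first by lia.
apply: wp_let; rewrite /=; first by lia.
have vE x : x \in [:: 0; 1; 2; 3; 4; 7; 8; 13] -> va s6 x = va s1 x.
  by rewrite !inE => /or4P[|||/or4P[|||/orP[]]] /eqP->; rewrite fx6 // /s5 /= fx4 // /s3 /= fx2.
have aE j : j \notin [:: 8; 9] -> ar s6 j = ar s j.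
  rewrite !inE negb_or => /andP[j8 j9]; rewrite fa6 // -fa4 //; exact: upda_other.
apply: (HP _ _ q k lev).
- by move: nl1 nl2 nl3 v10; clear; lia.
- split; first split; rewrite /=.
  + by rewrite vE // s1E.1.
  + by rewrite fx6 // /s5 /= fx4.
  + by rewrite fx6 // /s5 /= fx4.
  + by rewrite vE // s1E.2.
  split; first split; rewrite /=.
  + by rewrite vE // /s1 /=; lia.
  + by rewrite vE // /s1 /=.
  + by rewrite fx6 // -v9.
  + by [].
  by split=> i il; [rewrite -t8 | rewrite -t9 //= fa6].
- split=> //; first by rewrite c5.
  by rewrite k2T -v9.
- by [].
- by move=> x; rewrite !inE => /or4P[] /eqP->; rewrite /= vE.
- move=> j; rewrite !inE !negb_or => /and4P[j0 j1 j8 j9].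
  transitivity (ar s6 j); last by rewrite aE // !inE negb_or j8.
  by transitivity (ar (upda s6 0 0 2) j); exact: upda_other.
- by move=> i /=; rewrite aE.
- by move=> i /=; rewrite aE.
Qed.

End Initialisation.

(** * Renewing the snapshot *)

Section Rebuild.
Local Open Scope nat_scope.

(** Counting the x with x + w outside the snapshot is a correlation; storing the block reversed, at
    T - x, makes the count coefficient T + w of a product. *)
Definition fill_body : cmd :=
  Then (Put 5 ($31) (($31 < $13) *
     ((Elt 0 ($0 - $31) == #1) * (($0 - $31) %/ $6 == $30))))
  (Put 7 ($31) (($31 < $13) * (#1 - (Elt 0 ($31) == #1)))).

Definition rebuild : cmd :=
  Then (For 30 ($12) (Put 0 (Elt 1 ($30)) (#1))) (Then (Let 12 (#0))
  (For 30 ($5) (Then (For 31 ($9) fill_body) (Then convolve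
    (For 31 ($13) (Put 3 ($30 * $13 + $31) (Elt 5 ($0 + $31) %% $7))))))).

(* S z is 0 if z is not a sum, 1 if it is one in the snapshot taken by the last
   rebuild, and 2 if it was found later.  The x counted certify that inserting w
   adds a sum x + w to the snapshot. *)
Definition certs (T m : nat) (S : nat -> nat) (b w : nat) : nat :=
  count (fun x => [&& S x == 1, x %/ m == b, x + w <= T & S (x + w) != 1]) (iota 0 T.+1).

(** The first factor kills all j > T, and on the remaining range j = T - x runs through all x. *)
Lemma certs_conv T m S b w : w <= T ->
  \sum_(j < (T + w).+1)
     ((j < T.+1) * ((S (T - j) == 1) * ((T - j) %/ m == b))) *
     ((T + w - j < T.+1) * (1 - (S (T + w - j) == 1))) = certs T m S b w.
Proof.
move=> wT; pose F j := ((j < T.+1) * ((S (T - j) == 1) * ((T - j) %/ m == b))) *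
     ((T + w - j < T.+1) * (1 - (S (T + w - j) == 1))).
rewrite -(big_mkord xpredT F) (@big_cat_nat _ _ _ T.+1) //=; last by lia.
rewrite [X in _ + X]big1_seq ?addn0; last first.
  by move=> j; rewrite mem_index_iota /F => /andP[_ /andP[Tj _]]; rewrite ltnNge Tj.
rewrite big_mkord (reindex_inj rev_ord_inj) /certs -[iota 0 T.+1]/(index_iota 0 T.+1).
rewrite -sum1_count [in RHS]big_mkcond [in RHS]big_mkord; apply: eq_bigr => x _.
have xT : x <= T by have := ltn_ord x.
rewrite /F /= subSS subKn // (_ : T + w - (T - x) = x + w); last by lia.
rewrite (_ : T - x < T.+1); last by lia.
by rewrite ltnS mul1n; case: (S x == 1); case: (x %/ m == b); case: (S (x + w) == 1); case: (x + w <= T).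
Qed.

Lemma sized_k T q k lev : 0 < T -> sized T q k lev -> k <= T.+1.
Proof.
move=> T0 [_ /andP[_ k4] _ _ _]; rewrite leqNgt; apply/negP => Tk.
have : 2 ^ T.+2 <= 4 * T by apply: leq_trans k4; rewrite leq_exp2l.
by rewrite !expnS mulnA leq_mul2l /= leqNgt ltn_expl.
Qed.

Lemma sized_X T q k lev : 0 < T -> sized T q k lev ->
  [/\ 4 * 2 ^ (k + lev) <= Xof T, 64 * T.+1 <= Xof T & q <= T.+1].
Proof.
move=> T0 sz; have kT := sized_k _ _ _ _ T0 sz.
case: sz => /andP[q3 _] /andP[_ k4] _ _ l2.
have e3 : Xof T = 64 * (T.+1 * (T.+1 * T.+1)) by rewrite /Xof !expnS expn0 muln1.
split; rewrite ?e3 ?expnD.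
- apply: (@leq_trans (4 * (4 * T * (2 * k)))); first by rewrite leq_mul2l leq_mul.
  have : 4 * T * (2 * k) <= 4 * T.+1 * (2 * T.+1) by rewrite !leq_mul.
  by nia.
- by nia.
case: q q3 => // q; rewrite /= !expnS expn0 muln1 ltnS; nia.
Qed.

Lemma params_frame {T q k lev s s'} : params T q k lev s ->
  fixes [:: 0; 5; 6; 7; 8; 9; 11; 13] s s' -> ar s' 8 = ar s 8 -> ar s' 9 = ar s 9 ->
  params T q k lev s'.
Proof.
move=> [[v0 v5 v6 v13] [[v7 v8 v9 v11] [t8 t9]]] fx a8 a9.
by split; [rewrite !fx | split; [rewrite !fx | rewrite a8 a9]].
Qed.

Lemma frame_fixes lo l s s' : all (fun x => x < lo) l -> frame lo s s' -> fixes l s s'.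
Proof. by move=> /allP h fr x xl; apply: fr; exact: h. Qed.

Lemma wp_rebuild T q k lev (s : astate) (P : nat -> astate -> Prop) :
  0 < T -> sized T q k lev -> params T q k lev s ->
  let L := mkseq (ar s 1) (va s 12) in
  va s 12 <= T.+1 -> (forall z, (z \in L) = (ar s 0 z == 2)) ->
  (forall i, ar s 5 i <= 2 * T + 3) -> (forall i, ar s 7 i <= 2 * T + 3) ->
  (forall n s', n <= 400 * 2 ^ (k + lev) * k * q -> params T q k lev s' ->
     fixes [:: 0; 1; 2; 3; 4] s s' -> va s' 12 = 0 ->
     (forall j, j \in [:: 1; 2; 4] -> ar s' j = ar s j) ->
     (forall z, ar s' 0 z = if ar s 0 z == 2 then 1 else ar s 0 z) ->
     (forall i, ar s' 5 i <= 2 * T + 3) -> (forall i, ar s' 7 i <= 2 * T + 3) ->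
     (forall b w, b < q -> w <= T ->
        ar s' 3 (b * T.+1 + w) = certs T (q * q) (ar s' 0) b w) -> P n s') ->
  wp (Xof T) rebuild s P.
Proof.
move=> T0 sz pr L cT LS a5 a7 HP.
have [XN XT qT] := sized_X _ _ _ _ T0 sz.
have kT := sized_k _ _ _ _ T0 sz.
have [q3 /andP[Tk k4] levk kl l2] := sz.
have k2X : 4 * 2 ^ k <= Xof T by apply: leq_trans XN; rewrite leq_mul2l leq_exp2l // leq_addr.
have [[v0 v5 v6 v13] [[v7 v8 v9 v11] _]] := pr.
apply: wp_then.
apply: (wp_for (va s 12) (fun i n s' => [/\ va s' 30 = i, frame 30 s s',
  (forall j, j != 0 -> ar s' j = ar s j),
  (forall z, ar s' 0 z = if z \in take i L then 1 else ar s 0 z) & n <= i * 3])).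
- by lia.
- by split=> //; [exact: frame_updv | rewrite take0].
- by move=> i n s' _ [v30 fr _ _ _]; split=> //=; rewrite fr.
- move=> i n s' ic [v30 fr fa f0 nl].
  apply: wp_put; first by rewrite /=; lia.
  split=> //; split=> //; [exact: frame_updv | | | by lia].
    by move=> j j0; rewrite -fa //; exact: upda_other.
  move=> z; rewrite [LHS]upda_same /= v30 fa // f0.
  rewrite (take_nth 0) ?size_mkseq // mem_rcons inE nth_mkseq //.
  by case: (z == _).
move=> n1 s1 [_ fr1 fa1 f01 nl1] /=.
have f0 z : ar s1 0 z = if ar s 0 z == 2 then 1 else ar s 0 z.
  by rewrite f01 -LS take_oversize // size_mkseq.
apply: wp_then; apply: wp_let; rewrite /=; first by lia.
set s2 := updv s1 12 0.
have pr2 : params T q k lev s2.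
  apply: (params_frame pr); rewrite /= ?fa1 //.
  by apply: fixes_updv => //; apply: frame_fixes fr1.
have v2 x : x \in [:: 0; 5; 6; 13; 7; 9] -> va s2 x = va s x.
  by rewrite !inE => /or4P[|||/or3P[]] /eqP->; rewrite /= fr1.
pose NN := 2 ^ (k + lev).
have NN0 : 0 < NN by rewrite expn_gt0.
have kN : 2 ^ k <= NN by rewrite leq_exp2l // leq_addr.
have k0 : 0 < k by have := kap_le k lev; rewrite kl.
apply: (wp_for q (fun b n s' => [/\ va s' 30 = b, frame 30 s2 s',
  (forall j, j \in [:: 0; 1; 2; 4; 8; 9] -> ar s' j = ar s2 j),
  (forall i, ar s' 5 i <= 2 * T + 3) /\ (forall i, ar s' 7 i <= 2 * T + 3) &
  n <= b * (320 * (NN * k)) /\ (forall b' w, b' < b -> w <= T ->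
        ar s' 3 (b' * T.+1 + w) = certs T (q * q) (ar s2 0) b' w)])).
- by lia.
- split=> //; first exact: frame_updv.
  by split=> i /=; rewrite fa1.
- by move=> b n s' bq [v30 fr _ _ _]; split=> //=; rewrite fr // v2.
- move=> b n s' bq [v30 fr fa [b5 b7] [nl ct]].
  have prs : params T q k lev s'.
    by apply: (params_frame pr2); rewrite ?fa //; apply: frame_fixes fr.
  have [[v0' v5' v6' v13'] [[v7' v8' v9' v11'] tab']] := prs.
  pose a j := (j < T.+1) * ((ar s2 0 (T - j) == 1) * ((T - j) %/ (q * q) == b)).
  pose u i := (i < T.+1) * (1 - (ar s2 0 i == 1)).
  have a1 j : a j <= 1 by rewrite /a; case: (_ < _); do 2 case: (_ == _).
  have u1 j : u j <= 1 by rewrite /u; case: (_ < _); case: (_ == _).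
  apply: wp_then.
  apply: (wp_for (2 ^ k) (fun i n s'' => [/\ va s'' 31 = i, frame 31 s' s'',
    (forall j, j \notin [:: 5; 7] -> ar s'' j = ar s' j),
    (forall t, ar s'' 5 t = if t < i then a t else ar s' 5 t) /\
    (forall t, ar s'' 7 t = if t < i then u t else ar s' 7 t) & n <= i * 4])).
  + by lia.
  + by split=> //; exact: frame_updv.
  + by move=> i m s'' _ [v31 fr' _ _ _]; split=> //=; rewrite fr'.
  + move=> i m s'' ik [v31 fr' fa' [f5 f7] ml].
    apply: wp_then; apply: wp_put; rewrite /= v31 !fr' // v13' v0' v6' v30 fa' // (fa 0) //.
      by apply: leq_trans (a1 i) _; lia.
    apply: wp_put; rewrite /= v31 !fr' // v13' fa' // (fa 0) //.
      by apply: leq_trans (u1 i) _; lia.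
    split=> //; split=> //; [exact: frame_updv | | | by lia].
      move=> j; rewrite !inE negb_or => /andP[j5 j7].
      transitivity (ar s'' j); last by rewrite fa' // !inE negb_or j5.
      by rewrite /= !eqnE (negbTE j5) (negbTE j7).
    split=> t /=; rewrite [t < i.+1]ltnS [t <= i]leq_eqVlt; case: eqP => [->//|_] /=; [exact: f5 | exact: f7].
  move=> m1 s3 [v31 fr3 fa3 [f5 f7] ml1] /=.
  have pr3 : params T q k lev s3.
    by apply: (params_frame prs); rewrite ?fa3 //; apply: frame_fixes fr3.
  have [[v03 v53 v63 v133] tb3] := pr3.
  have [[v73 v83 v93 v113] _] := tb3.
  have leQ (c : nat -> nat) (old : nat -> nat) : (forall t, c t <= 1) ->
      (forall t, old t <= 2 * T + 3) -> forall t, (if t < 2 ^ k then c t else old t) <= 2 * T + 3.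
    by move=> c1 o t; case: ifP => _ //; apply: leq_trans (c1 t) _; lia.
  apply: wp_then; apply: (wp_conv (2 * T + 3) (T + 2) k lev (Xof T) T) => //; try lia.
  + by move=> t; rewrite f5; exact: leQ.
  + by move=> t; rewrite f7; exact: leQ.
  + by move=> t /andP[Tt tk]; rewrite f5 tk /a ltnNge Tt.
  + by move=> t /andP[Tt tk]; rewrite f7 tk /u ltnNge Tt.
  move=> m2 s4 ml2 fr4 fa4 c5 c7 res.
  have pr4 : params T q k lev s4.
    by apply: (params_frame pr3); rewrite ?fa4 //; apply: frame_fixes fr4.
  have [[v04 v54 v64 v134] [[v74 v84 v94 v114] _]] := pr4.
  have v304 : va s4 30 = b by rewrite fr4 // fr3.
  have resE w : w <= T -> ar s4 5 (T + w) %% (2 * T + 3) = certs T (q * q) (ar s2 0) b w.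
    move=> wT; rewrite res; last by lia.
    rewrite -(certs_conv T (q * q) (ar s2 0) b w wT).
    have e : \sum_(j < (T + w).+1) ar s3 5 j * ar s3 7 (T + w - j) =
             \sum_(j < (T + w).+1) a j * u (T + w - j).
      apply: eq_bigr => j _; have := ltn_ord j => jT.
      by rewrite f5 f7 !ifT //; lia.
    (* The count is at most T + 1 < Q, so its residue modulo Q determines it. *)
    rewrite e; apply: modn_small; rewrite /a /u certs_conv //.
    apply: (@leq_ltn_trans T.+1); last by lia.
    by rewrite /certs; apply: leq_trans (count_size _ _) _; rewrite size_iota.
  apply: (wp_for T.+1 (fun i n s'' => [/\ va s'' 31 = i, frame 31 s4 s'',
    (forall j, j != 3 -> ar s'' j = ar s4 j),
    (forall t, t < b * T.+1 -> ar s'' 3 t = ar s4 3 t) /\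
    (forall w, w < i -> ar s'' 3 (b * T.+1 + w) = certs T (q * q) (ar s2 0) b w) &
    n <= i * 3])).
  + by lia.
  + by split=> //; exact: frame_updv.
  + by move=> i m s'' _ [v31' fr' _ _ _]; split=> //=; rewrite fr'.
  + move=> i m s'' iT [v31' fr' fa' [flo fhi] ml].
    apply: wp_put; rewrite /= v31' !fr' // v04 v74 fa' // resE //.
      rewrite /certs; apply: leq_trans (count_size _ _) _; rewrite size_iota; lia.
    rewrite v304 v134; split=> //; split=> //; [exact: frame_updv | | | by lia].
      by move=> j j3; rewrite -fa' //; exact: upda_other.
    split=> [t tl | w] /=; first by rewrite ltn_eqF ?flo //; lia.
    rewrite ltnS leq_eqVlt eqn_add2l; case: eqP => [->//|_] /=; exact: fhi.
  move=> m3 s5 [v31' fr5 fa5 [flo fhi] ml3] /=.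
  have fr30 : frame 30 s2 s5.
    apply: (frame_trans fr); apply: (frame_trans (frame_le _ fr3)) => //.
    by apply: (frame_trans (frame_le _ fr4)) => //; exact: frame_le fr5.
  split; first by rewrite fr5.
  split=> //; first exact: frame_updv.
  + move=> j; rewrite !inE => /or4P[|||/or3P[]] /eqP->; by rewrite /= fa5 // fa4 // fa3 // fa.
  + by split=> i /=; rewrite fa5.
  split.
    have kM : NN <= NN * k by rewrite leq_pmulr.
    have TN : T.+1 <= NN by lia.
    move: ml2; rewrite -/NN -mulnA mulSn.
    move: nl ml1 ml3 kM TN kN NN0; move: (NN * k) => M; clear; lia.
  move=> b' w b'b wT; have [->|ne] := eqVneq b' b; first by rewrite /= fhi.
  have lt : b' < b by lia.
  rewrite /= flo; last by nia.
  by rewrite fa4 // fa3 // ct.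
move=> n6 s6 [_ fr6 fa6 [b5 b7] [nl6 ct]]; apply: HP => //.
- have : va s 12 * 3 <= 6 * NN by move: kN; clear -cT Tk T0; lia.
  have q0 : 0 < q by case: (q) q3 => //; rewrite expn0 muln0 ltn0 andbF.
  have : NN <= NN * k * q by rewrite -mulnA leq_pmulr // muln_gt0 k0.
  have : q * (320 * (NN * k)) = 320 * (NN * k * q) by ring.
  move: nl6 nl1; rewrite -/NN -!(mulnA 400); move: NN0.
  move: (NN * k * q) (q * (320 * (NN * k))) => M1 M2; clear; lia.
- by apply: (params_frame pr2); rewrite ?fa6 //; apply: frame_fixes fr6.
- move=> x; rewrite !inE => /or4P[|||/orP[]] /eqP->; by rewrite fr6 // /s2 /= fr1.
- by rewrite fr6.
- by move=> j; rewrite !inE => /or3P[] /eqP->; rewrite fa6 // /s2 /= fa1.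
- by move=> z; rewrite fa6 // -f0.
- by move=> b w bq wT; rewrite ct // fa6.
Qed.

End Rebuild.

(** * Finding the new sums *)

Section Insertion.
Local Open Scope nat_scope.

Definition count_stale : cmd :=
  Then (For 20 ($5) (Put 4 ($20) (#0)))
  (For 20 ($12) (Then (Let 21 (Elt 1 ($20)))
    (Cond ($21 < $4) Nop (Then (Let 21 ($21 - $4))
      (Cond (Elt 0 ($21) == #1)
        (Then (Let 21 ($21 %/ $6)) (Put 4 ($21) (Elt 4 ($21) + #1))) Nop))))).

Definition scan_blocks : cmd :=
  For 20 ($5) (Cond (Elt 3 ($20 * $13 + $4) == Elt 4 ($20)) Nop
    (For 23 ($6) (Then (Let 24 ($20 * $6 + $23))
      (Cond ($24 + $4 < $13) (Cond (Elt 0 ($24) == #1) (Cond (Elt 0 ($24 + $4) == #0)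
        (Then (Put 1 ($22) ($24 + $4)) (Let 22 ($22 + #1))) Nop) Nop) Nop)))).

Definition scan_recent : cmd :=
  For 20 ($12) (Then (Let 24 (Elt 1 ($20) + $4))
    (Cond ($24 < $13) (Cond (Elt 0 ($24) == #0)
      (Then (Put 1 ($22) ($24)) (Let 22 ($22 + #1))) Nop) Nop)).

(** The scans only list the new sums, and their status is set afterwards: otherwise w could be added
    again to a sum that already uses it. *)
Definition insert : cmd :=
  Cond (Elt 2 ($4)) Nop
  (Then count_stale (Then (Let 22 ($12)) (Then scan_blocks (Then scan_recent
  (Then (Cond ($22 == $12) (Put 2 ($4) (#1)) Nop)
  (Then (For 20 ($22) (Put 0 (Elt 1 ($20)) (#2)))
  (Then (Let 12 ($22)) (Cond ($12 < $6) Nop rebuild)))))))).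

(* The certificates that refer to sums L found after the snapshot. *)
Definition stale (m : nat) (S : nat -> nat) (b w : nat) (L : seq nat) : nat :=
  count (fun z => [&& w <= z, S (z - w) == 1 & (z - w) %/ m == b]) L.

Definition fresh (T : nat) (S : nat -> nat) (w x : nat) : bool :=
  (x + w <= T) && (S (x + w) == 0).

(** A target x + w outside the snapshot has status 2 or 0. Those of status 2 correspond to the z = x
    + w in L and are counted by [stale]; what remains are the x that give new sums. *)
Lemma certs_split T m S b w L : w <= T -> (forall z, S z <= 2) -> uniq L ->
  (forall z, (z \in L) = (S z == 2)) -> (forall z, T < z -> S z = 0) ->
  certs T m S b w = stale m S b w L +
    count (fun x => [&& S x == 1, x %/ m == b & fresh T S w x]) (iota 0 T.+1).
Proof.
move=> wT S2 uL LS ST.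
have -> : stale m S b w L =
    count (fun x => [&& S x == 1, x %/ m == b, x + w <= T & S (x + w) == 2]) (iota 0 T.+1).
  rewrite /stale; have /permP -> : perm_eq L [seq z <- iota 0 T.+1 | S z == 2].
    apply: uniq_perm => // [|z]; first by rewrite filter_uniq // iota_uniq.
    rewrite mem_filter mem_iota LS /= add0n; case: eqP => //= Sz.
    by apply/esym; rewrite ltnS leqNgt; apply/negP => /ST; rewrite Sz.
  rewrite count_filter.
  have -> : iota 0 T.+1 = iota 0 w ++ iota w (T.+1 - w) by rewrite -iotaD subnKC // ltnW.
  rewrite count_cat (eq_in_count (a2 := pred0)) ?count_pred0 ?add0n; last first.
    by move=> z; rewrite mem_iota add0n /= => zw; rewrite leqNgt zw.
  rewrite -[in RHS]iotaD subnKC; last by rewrite ltnW.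
  have -> : iota 0 T.+1 = iota 0 (T.+1 - w) ++ iota (T.+1 - w) w.
    by rewrite -iotaD subnK // ltnW.
  rewrite count_cat [X in _ = _ + X](eq_in_count (a2 := pred0)); last first.
    move=> x; rewrite mem_iota => /andP[xw _] /=.
    by rewrite [x + w <= T]leqNgt (_ : T < x + w) ?andbF //; lia.
  rewrite count_pred0 addn0 -[X in iota X]addn0 iotaDl count_map.
  apply: eq_in_count => x; rewrite mem_iota add0n /= => xT.
  rewrite leq_addr addKn addnC (_ : x + w <= T); last by lia.
  by rewrite -!andbA.
rewrite /certs -count_predUI [X in _ = _ + X](eq_count (a2 := pred0)) ?count_pred0 ?addn0.
  apply: eq_count => x; rewrite /= /fresh; have := S2 (x + w).
  by case: (S x == 1); case: (_ == b); case: (x + w <= T); case: (S (x + w)) => [|[|[|]]].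
move=> x; rewrite /= /fresh; case: (S (x + w) =P 2) => [->|]; rewrite ?andbF //.
Qed.

Lemma wp_count_stale T q k lev (s : astate) (P : nat -> astate -> Prop) w :
  0 < T -> sized T q k lev -> params T q k lev s -> va s 4 = w -> w <= T ->
  let L := mkseq (ar s 1) (va s 12) in
  va s 12 <= T.+1 -> (forall z, z \in L -> z <= T) ->
  (forall n s', n <= 3 * q + 10 * va s 12 + 10 -> frame 20 s s' ->
     (forall j, j != 4 -> ar s' j = ar s j) ->
     (forall b, b < q -> ar s' 4 b = stale (q * q) (ar s 0) b w L) -> P n s') ->
  wp (Xof T) count_stale s P.
Proof.
move=> T0 sz pr v4 wT L cT LT HP.
have [XN XT qT] := sized_X _ _ _ _ T0 sz.
have [/andP[_ q3] _ _ _ _] := sz.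
have [[v0 v5 v6 v13] _] := pr.
apply: wp_then.
apply: (wp_for q (fun i n s' => [/\ va s' 20 = i, frame 20 s s',
  (forall j, j != 4 -> ar s' j = ar s j),
  (forall b, b < i -> ar s' 4 b = 0) & n <= i * 3])).
- by lia.
- by split=> //; exact: frame_updv.
- by move=> i n s' _ [v20 fr _ _ _]; split=> //=; rewrite fr.
- move=> i n s' iq [v20 fr fa f4 nl].
  apply: wp_put => //; split=> //; split=> //; [exact: frame_updv | | | by lia].
    by move=> j j4; rewrite -fa //; exact: upda_other.
  by move=> b; rewrite ltnS => bi; rewrite /= v20; case: eqP => // ne; apply: f4; lia.
move=> n1 s1 [_ fr1 fa1 f41 nl1] /=.
apply: (wp_for (va s 12) (fun i n s' => [/\ va s' 20 = i, frame 20 s s',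
  (forall j, j != 4 -> ar s' j = ar s j),
  (forall b, b < q -> ar s' 4 b = stale (q * q) (ar s 0) b w (take i L)) & n <= i * 9])).
- by lia.
- split=> //; first exact: frame_updv.
  by move=> b bq; rewrite take0 /= f41.
- by move=> i n s' _ [v20 fr _ _ _]; split=> //=; rewrite fr.
- move=> i n s' ic [v20 fr fa f4 nl].
  have zL : ar s 1 i = nth 0 L i by rewrite nth_mkseq.
  have zT : ar s 1 i <= T by apply: LT; rewrite zL mem_nth // size_mkseq.
  set z := ar s 1 i in zL zT *.
  have stE b : stale (q * q) (ar s 0) b w (take i.+1 L) = stale (q * q) (ar s 0) b w (take i L)
      + [&& w <= z, ar s 0 (z - w) == 1 & (z - w) %/ (q * q) == b].
    by rewrite /stale (take_nth 0) ?size_mkseq // -cats1 count_cat /= -zL addn0.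
  apply: wp_then; apply: wp_let; rewrite /= v20 fa //; first by rewrite -/z; lia.
  rewrite -/z; apply: wp_cond => /=; rewrite fr // v4.
    move=> /nat_of_bool1 zw; apply: wp_nop.
    split=> //; split=> //; [by do 2! apply: frame_updv => // | | by lia].
    by move=> b bq; rewrite stE f4 // leqNgt zw addn0.
  move=> /nat_of_bool0 wz; apply: wp_then; apply: wp_let; rewrite /= ?fr // v4; first by lia.
  apply: wp_cond => /=; rewrite fa //.
    move=> /nat_of_bool1 S1; apply: wp_then; apply: wp_let; rewrite /= fr // v6.
      by apply: leq_trans (leq_div _ _) _; lia.
    have bq : (z - w) %/ (q * q) < q.
      rewrite ltn_divLR; first by move: q3; rewrite !expnS expn0 muln1; lia.
      by case: (q) q3 => //; rewrite expn0 muln0.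
    apply: wp_put; rewrite /= f4 //.
      have : stale (q * q) (ar s 0) ((z - w) %/ (q * q)) w (take i L) <= i.
        apply: leq_trans (count_size _ _) _; rewrite size_take size_mkseq.
        by case: ifP => //; lia.
      by lia.
    split=> //; split=> //; [by do 4! apply: frame_updv => // | | | by lia].
      by move=> j j4; rewrite /= eqnE (negbTE j4) fa.
    move=> b bq' /=; rewrite stE S1 leqNgt wz /= [_ == b]eq_sym f4 //.
    by case: eqP => [->|_]; rewrite ?addn0.
  move=> /nat_of_bool0 S1; apply: wp_nop.
  split=> //; split=> //; [by do 3! apply: frame_updv => // | | by lia].
  by move=> b bq; rewrite stE f4 // S1 andbF addn0.
move=> n2 s2 [_ fr2 fa2 f42 nl2]; apply: HP => //; first by lia.
by move=> b bq; rewrite f42 // take_oversize // size_mkseq.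
Qed.


Lemma mkseq_push (V : nat -> nat) m v :
  mkseq (fun i => if i == m then v else V i) m.+1 = rcons (mkseq V m) v.
Proof.
rewrite mkseqS eqxx; congr rcons; apply/eq_in_map => i.
by rewrite mem_iota => /andP[_ im]; rewrite ltn_eqF.
Qed.

Definition sums (T : nat) (S : nat -> nat) (w : nat) (D : seq nat) : seq nat :=
  [seq x + w | x <- D & fresh T S w x].

Lemma sums_rcons T S w D x :
  sums T S w (rcons D x) = if fresh T S w x then rcons (sums T S w D) (x + w)
                           else sums T S w D.
Proof. by rewrite /sums filter_rcons; case: ifP => //; rewrite map_rcons. Qed.

Lemma sums_cat T S w D1 D2 : sums T S w (D1 ++ D2) = sums T S w D1 ++ sums T S w D2.
Proof. by rewrite /sums filter_cat map_cat. Qed.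

Lemma size_sums T S w D : size (sums T S w D) <= size D.
Proof. by rewrite size_map size_filter count_size. Qed.

Definition snap (S : nat -> nat) (n : nat) : seq nat := [seq x <- iota 0 n | S x == 1].

Lemma snapS S n : snap S n.+1 = if S n == 1 then rcons (snap S n) n else snap S n.
Proof. by rewrite /snap -[n.+1]addn1 iotaD filter_cat /= add0n; case: ifP => _; rewrite ?cats1 ?cats0. Qed.

Lemma wp_scan_blocks T q k lev (s : astate) (P : nat -> astate -> Prop) w :
  0 < T -> sized T q k lev -> params T q k lev s -> va s 4 = w -> w <= T ->
  let L := mkseq (ar s 1) (va s 12) in let S := ar s 0 in
  va s 12 <= T.+1 -> va s 22 = va s 12 -> uniq L ->
  (forall z, S z <= 2) -> (forall z, T < z -> S z = 0) ->
  (forall z, (z \in L) = (S z == 2)) ->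
  (forall b, b < q -> ar s 3 (b * T.+1 + w) = certs T (q * q) S b w) ->
  (forall b, b < q -> ar s 4 b = stale (q * q) S b w L) ->
  (forall n s', n <= 5 * q + 16 * (q * q) * (va s' 22 - va s 12) + 2 ->
     fixes [:: 0; 1; 2; 3; 4; 5; 6; 7; 8; 9; 11; 12; 13] s s' ->
     (forall j, j != 1 -> ar s' j = ar s j) ->
     mkseq (ar s' 1) (va s' 22) = L ++ sums T S w (snap S T.+1) -> P n s') ->
  wp (Xof T) scan_blocks s P.
Proof.
move=> T0 sz pr v4 wT L S cT v22 uL S2 ST LS c3 d4 HP.
have [XN XT qT] := sized_X _ _ _ _ T0 sz.
have [/andP[q3' q3] _ _ _ _] := sz.
have q0 : 0 < q by case: (q) q3 => //; rewrite expn0 muln0.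
have qqq : q * (q * q) = q ^ 3 by rewrite !expnS expn0 muln1.
have q3X : q ^ 3 <= 8 * T.
  case: (q) q0 q3' => // -[|q'] _ /=; first by rewrite !expnS expn0; lia.
  by rewrite !expnS !expn0 !muln1; nia.
have [[v0 v5 v6 v13] _] := pr.
pose fx := fixes [:: 0; 1; 2; 3; 4; 5; 6; 7; 8; 9; 11; 12; 13].
pose M := q * q.
have M0 : 0 < M by rewrite muln_gt0 q0.
have szL s' D : mkseq (ar s' 1) (va s' 22) = L ++ D -> va s' 22 = va s 12 + size D.
  by move=> /(congr1 size); rewrite size_cat !size_mkseq.
have snap_new b : sums T S w (snap S (b.+1 * M)) = sums T S w (snap S (b * M)) ++
    [seq x + w | x <- iota (b * M) M & (S x == 1) && fresh T S w x].
  rewrite mulSnr /snap iotaD filter_cat sums_cat; congr (_ ++ _).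
  by rewrite /sums -filter_predI; congr map; apply: eq_filter => x /=; rewrite andbC.
have snap_hit b : (0 < size [seq x + w | x <- iota (b * M) M & (S x == 1) && fresh T S w x])
    = (certs T M S b w != stale M S b w L).
  rewrite (certs_split T M S b w L) // -[X in _ != X]addn0 eqn_add2l -lt0n.
  rewrite size_map size_filter -!has_count; apply/hasP/hasP => -[x].
    rewrite mem_iota => /andP[x1 x2] /andP[Sx fr]; exists x.
      by rewrite mem_iota add0n ltnS /=; case/andP: fr; lia.
    by rewrite Sx fr andbT /= eqn_leq leq_divRL // x1 andbT -ltnS ltn_divLR // mulSnr x2.
  rewrite mem_iota => _ /and3P[Sx /eqP xb fr]; exists x; last by rewrite Sx.
  by rewrite mem_iota -xb leq_trunc_div /= {1}(divn_eq x M) ltn_add2l ltn_mod.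
apply: (wp_for q (fun b n s' => [/\ va s' 20 = b, fx s s',
  (forall j, j != 1 -> ar s' j = ar s j),
  mkseq (ar s' 1) (va s' 22) = L ++ sums T S w (snap S (b * M)) &
  n <= b * 5 + 16 * M * size (sums T S w (snap S (b * M)))])).
- by lia.
- split=> //; first exact: fixes_updv.
  by rewrite mul0n cats0 /= v22.
- by move=> i n s' _ [v20 fr _ _ _]; split=> //=; rewrite fr.
- move=> b n s' bq [v20 fr fa f1 nl].
  apply: wp_cond; rewrite /= v20 !fr // v13 v4 !fa // c3 // d4 // -/M.
    move=> /nat_of_bool1 /eqP e; apply: wp_nop.
    have nil : [seq x + w | x <- iota (b * M) M & (S x == 1) && fresh T S w x] = [::].
      by apply/size0nil/eqP; rewrite -leqn0 leqNgt snap_hit e eqxx.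
    split=> //; split=> //; [exact: fixes_updv | | ]; rewrite snap_new nil cats0 //=.
    by lia.
  move=> /nat_of_bool0 /negbT; rewrite -snap_hit => hit.
  apply: (wp_for M (fun y m s'' => [/\ va s'' 23 = y, va s'' 20 = b /\ fx s s'',
    (forall j, j != 1 -> ar s'' j = ar s j),
    mkseq (ar s'' 1) (va s'' 22) = L ++ sums T S w (snap S (b * M + y)) & m <= y * 10])).
  + by rewrite /M; nia.
  + by split=> //; [split=> //; exact: fixes_updv | rewrite addn0].
  + by move=> i m s'' _ [v23 [_ fr'] _ _ _]; split=> //; rewrite /= fr' // v6.
  + move=> y m s'' yM [v23 [v20' fr'] fa' f1' ml].
    have xX : b * M + y <= 8 * T.
      apply: leq_trans q3X; rewrite -qqq -/M.
      have : b.+1 * M <= q * M by rewrite leq_mul2r bq orbT.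
      by rewrite mulSnr; lia.
    have snS : sums T S w (snap S (b * M + y.+1)) =
        if (S (b * M + y) == 1) && fresh T S w (b * M + y)
        then rcons (sums T S w (snap S (b * M + y))) (b * M + y + w)
        else sums T S w (snap S (b * M + y)).
      by rewrite addnS snapS; case: ifP => //= _; rewrite sums_rcons.
    apply: wp_then; apply: wp_let; rewrite /= v20' v23 fr' // v6 -/M; first by lia.
    set x := b * M + y in xX snS f1' *.
    have skip m' : (S x == 1) && fresh T S w x = false -> m' <= 6 ->
       va (updv s'' 24 x) 23 = y /\ [/\ va (updv (updv s'' 24 x) 23 y.+1) 23 = y.+1,
         va (updv (updv s'' 24 x) 23 y.+1) 20 = b /\ fx s (updv (updv s'' 24 x) 23 y.+1),
         (forall j, j != 1 -> ar s'' j = ar s j),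
         mkseq (ar s'' 1) (va s'' 22) = L ++ sums T S w (snap S (b * M + y.+1)) &
         m + m' + 2 <= y.+1 * 10].
      move=> h m6; split=> //; split=> //.
      * by split=> //; do 2! apply: fixes_updv => //.
      * by rewrite snS h.
      * by lia.
    apply: wp_cond => /=; rewrite !fr' // v4 v13 ltnS.
      move=> /nat_of_bool1 xw; apply: wp_cond => /=; rewrite fa' // -/S.
        move=> /nat_of_bool1 Sx; apply: wp_cond => /=; rewrite fa' // -/S !fr' // v4.
          move=> /nat_of_bool1 Sxw; apply: wp_then.
          have v22s := szL _ _ f1'.
          have sz22 : va s'' 22 <= T.+1 + x.
            rewrite v22s leq_add //; apply: leq_trans (size_sums _ _ _ _) _.
            by rewrite size_filter; apply: leq_trans (count_size _ _) _; rewrite size_iota.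
          apply: wp_put; rewrite /= (fr' 4) // v4; first by lia.
          apply: wp_let; rewrite /=; first by lia.
          split=> //; split=> //; [by split=> //; do 3! apply: fixes_updv => // | | | by lia].
            by move=> j j1; rewrite /= eqnE (negbTE j1) fa'.
          by rewrite /= addn1 mkseq_push f1' snS Sx /fresh xw Sxw /= rcons_cat.
        by move=> /nat_of_bool0 Sxw; apply: wp_nop; apply: skip => //; rewrite /fresh Sxw !andbF.
      by move=> /nat_of_bool0 Sx; apply: wp_nop; apply: skip => //; rewrite Sx.
    by move=> /nat_of_bool0 xw; apply: wp_nop; apply: skip => //; rewrite /fresh xw andbF.
  move=> m s1 [_ [v201 fr1] fa1 f11 ml].
  split=> //; split=> //; first exact: fixes_updv.
    by rewrite /= f11 addnC -mulSn.
  have -> : b.+1 * M = b * M + M by rewrite mulSnr.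
  have := snap_new b; rewrite mulSnr => ->; rewrite size_cat.
  by move: hit; move: (size [seq _ | _ <- _ & _]) => D; rewrite -/M; nia.
move=> n1 s1 [_ fr1 fa1 f11 nl1]; apply: HP => //.
  rewrite (szL _ _ f11) addKn -/M; lia.
rewrite f11; congr (_ ++ _).
(* The q blocks cover q^3 > T positions; those beyond T contribute no sum. *)
rewrite /snap (_ : q * M = T.+1 + (q * M - T.+1)); last by rewrite -qqq /M in q3 *; lia.
rewrite iotaD filter_cat sums_cat -[RHS]cats0; congr (_ ++ _).
apply/size0nil; rewrite size_map size_filter; apply/eqP; rewrite -leqn0 leqNgt -has_count.
apply/negP => /hasP[x]; rewrite mem_filter mem_iota add0n => /andP[_ /andP[xT _]].
by rewrite /fresh leqNgt; lia.
Qed.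

End Insertion.

Section InsertionCorrectness.
Local Open Scope nat_scope.

Lemma wp_scan_recent T q k lev (s : astate) (P : nat -> astate -> Prop) w L A :
  0 < T -> sized T q k lev -> params T q k lev s -> va s 4 = w -> w <= T ->
  let S := ar s 0 in
  mkseq (ar s 1) (va s 22) = L ++ A -> size L = va s 12 -> all (fun z => z <= T) L ->
  size L <= T.+1 -> size A <= T.+1 ->
  (forall n s', n <= 9 * va s 12 + 2 ->
     fixes [:: 0; 1; 2; 3; 4; 5; 6; 7; 8; 9; 11; 12; 13] s s' ->
     (forall j, j != 1 -> ar s' j = ar s j) ->
     mkseq (ar s' 1) (va s' 22) = L ++ A ++ sums T S w L -> P n s') ->
  wp (Xof T) scan_recent s P.
Proof.
move=> T0 sz pr v4 wT S LA szL LT cL cA HP.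
have [XN XT qT] := sized_X _ _ _ _ T0 sz.
have [[v0 v5 v6 v13] _] := pr.
pose fx := fixes [:: 0; 1; 2; 3; 4; 5; 6; 7; 8; 9; 11; 12; 13].
apply: (wp_for (va s 12) (fun i n s' => [/\ va s' 20 = i, fx s s',
  (forall j, j != 1 -> ar s' j = ar s j),
  mkseq (ar s' 1) (va s' 22) = L ++ A ++ sums T S w (take i L) & n <= i * 9])).
- by lia.
- by split=> //; [exact: fixes_updv | rewrite take0 cats0].
- by move=> i n s' _ [v20 fr _ _ _]; split=> //=; rewrite fr.
- move=> i n s' ic [v20 fr fa f1 nl].
  have iL : i < size L by rewrite szL.
  have size22 : va s' 22 = size L + (size A + size (sums T S w (take i L))).
    by have := congr1 size f1; rewrite size_mkseq !size_cat.
  have zE : ar s' 1 i = nth 0 L i.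
    have := congr1 (fun l => nth 0 l i) f1; rewrite nth_mkseq ?nth_cat ?iL //.
    by rewrite size22; lia.
  set z := nth 0 L i in zE.
  have zT : z <= T by move/allP: LT; apply; exact: mem_nth.
  have sE : sums T S w (take i.+1 L) = if fresh T S w z
      then rcons (sums T S w (take i L)) (z + w) else sums T S w (take i L).
    by rewrite (take_nth 0) // sums_rcons.
  apply: wp_then; apply: wp_let; rewrite /= v20 zE (fr 4) // v4; first by lia.
  have skip m : fresh T S w z = false -> m <= 5 ->
     va (updv s' 24 (z + w)) 20 = i /\ [/\ va (updv (updv s' 24 (z + w)) 20 i.+1) 20 = i.+1,
       fx s (updv (updv s' 24 (z + w)) 20 i.+1), (forall j, j != 1 -> ar s' j = ar s j),
       mkseq (ar s' 1) (va s' 22) = L ++ A ++ sums T S w (take i.+1 L) &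
       n + m + 2 <= i.+1 * 9].
    move=> h m5; split=> //; split=> //; [by do 2! apply: fixes_updv => // | | by lia].
    by rewrite sE h.
  apply: wp_cond => /=; rewrite (fr 13) // v13 ltnS.
    move=> /nat_of_bool1 zw; apply: wp_cond => /=; rewrite fa // -/S.
      move=> /nat_of_bool1 Sz; apply: wp_then.
      have b22 : va s' 22 <= 4 * T.+1.
        have := size_sums T S w (take i L); rewrite size_takel; lia.
      apply: wp_put; rewrite /=; first by lia.
      apply: wp_let; rewrite /=; first by lia.
      split=> //; split=> //; [by do 3! apply: fixes_updv => // | | | by lia].
        by move=> j j1; rewrite /= eqnE (negbTE j1) fa.
      by rewrite /= addn1 mkseq_push f1 sE /fresh zw Sz /= !rcons_cat.
    by move=> /nat_of_bool0 Sz; apply: wp_nop; apply: skip => //; rewrite /fresh Sz andbF.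
  by move=> /nat_of_bool0 zw; apply: wp_nop; apply: skip => //; rewrite /fresh zw.
move=> n1 s1 [_ fr1 fa1 f11 nl1]; apply: HP => //; first by lia.
by rewrite f11 take_oversize // szL.
Qed.

Lemma wp_mark T (s : astate) (P : nat -> astate -> Prop) :
  let D := mkseq (ar s 1) (va s 22) in 64 * T.+1 <= Xof T -> va s 22 <= 4 * T.+1 ->
  (forall n s', n <= 3 * va s 22 + 2 ->
     fixes [:: 0; 1; 2; 3; 4; 5; 6; 7; 8; 9; 11; 12; 13; 22] s s' ->
     (forall j, j != 0 -> ar s' j = ar s j) ->
     (forall z, ar s' 0 z = if z \in D then 2 else ar s 0 z) -> P n s') ->
  wp (Xof T) (For 20 ($22) (Put 0 (Elt 1 ($20)) (#2))) s P.
Proof.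
move=> D XT v22 HP.
apply: (wp_for (va s 22) (fun i n s' => [/\ va s' 20 = i,
  fixes [:: 0; 1; 2; 3; 4; 5; 6; 7; 8; 9; 11; 12; 13; 22] s s',
  (forall j, j != 0 -> ar s' j = ar s j),
  (forall z, ar s' 0 z = if z \in take i D then 2 else ar s 0 z) & n <= i * 3])).
- by lia.
- by split=> //; [exact: fixes_updv | rewrite take0].
- by move=> i n s' _ [v20 fr _ _ _]; split=> //=; rewrite fr.
- move=> i n s' ic [v20 fr fa f0 nl].
  apply: wp_put; first by rewrite /=; lia.
  split=> //; split=> //; [exact: fixes_updv | | | by lia].
    by move=> j j0; rewrite -fa //; exact: upda_other.
  move=> z; rewrite [LHS]upda_same /= v20 fa // f0.
  rewrite (take_nth 0) ?size_mkseq // mem_rcons inE nth_mkseq //.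
  by case: (z == _).
move=> n1 s1 [_ fr1 fa1 f01 nl1]; apply: HP => //; first by lia.
by move=> z; rewrite f01 take_oversize // size_mkseq.
Qed.

Lemma subset_sum_rcons items w t : subset_sum (rcons items w) t <->
  subset_sum items t \/ (w <= t /\ subset_sum items (t - w)).
Proof.
split=> [[B sB <-]|[[B sB <-]|[wt [B sB sumB]]]].
- case/lastP: B sB => [|B b]; first by left; exists [::]; rewrite ?sub0seq.
  (* [subseq] recurses on heads, so both lists are reversed to compare their last entries. *)
  rewrite -!cats1 => sB; have : subseq (rev (B ++ [:: b])) (rev (items ++ [:: w])).
    by rewrite subseq_rev.
  rewrite !rev_cat /=; case: eqP => [->|_] sB'.
    right; rewrite sumn_cat /= addn0 leq_addl addnK; split=> //.
    by exists B; rewrite // -subseq_rev.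
  by left; exists (B ++ [:: b]); rewrite // -subseq_rev rev_cat.
- by exists B => //; apply: subseq_trans sB _; rewrite -cats1 prefix_subseq.
- exists (rcons B w); last by rewrite -cats1 sumn_cat sumB /= addn0 subnK.
  by rewrite -!cats1; apply: cat_subseq.
Qed.

End InsertionCorrectness.

(** * Correctness and amortized cost of an insertion *)

Section InsertionStep.
Local Open Scope nat_scope.

Lemma mem_sums T S w D z :
  (z \in sums T S w D) = [&& w <= z, z <= T, S z == 0 & z - w \in D].
Proof.
apply/mapP/and4P => [[x]|[wz zT Sz xD]].
  rewrite mem_filter /fresh => /andP[/andP[xT Sx] xD] ->.
  by rewrite leq_addl addnK; split.
by exists (z - w); rewrite ?subnK // mem_filter /fresh subnK // zT Sz.
Qed.

Definition zeros (f : nat -> nat) (n : nat) : nat := count (fun z => f z == 0) (iota 0 n).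
Definition unsnapped (f : nat -> nat) (n : nat) : nat := count (fun z => f z != 1) (iota 0 n).

(* Every test of a weight consumes a unit of the first term, which also pays for
   the blocks scanned; the last term pays for the rebuilds. *)
Definition potential (T q k : nat) (s : astate) : nat :=
  120 * (q * q) * (zeros (ar s 0) T.+1 + zeros (ar s 2) T.+1)
  + 3200 * (q * q) * (k * k) * unsnapped (ar s 0) T.+1.

(** The last clause concerns the buffers left over from earlier convolutions: they are refilled only
    below 2^k, whereas a convolution asks that all their entries be at most Q. *)
Definition represents (T q k lev : nat) (items : seq nat) (s : astate) : Prop :=
  let S := ar s 0 in let L := mkseq (ar s 1) (va s 12) in
  [/\ params T q k lev s,
      [/\ forall z, S z <= 2, forall z, T < z -> S z = 0 &
          forall z, z <= T -> (S z != 0 <-> subset_sum items z)],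
      [/\ uniq L, forall z, (z \in L) = (S z == 2) & va s 12 < q * q],
      (forall b w, b < q -> w <= T -> ar s 3 (b * T.+1 + w) = certs T (q * q) S b w) /\
      (forall w x, ar s 2 w != 0 -> x + w <= T -> S x != 0 -> S (x + w) != 0) &
      (forall i, ar s 5 i <= 2 * T + 3) /\ (forall i, ar s 7 i <= 2 * T + 3)].

(** Serves to make the counts in the potential fall by exactly the number of positions that
    change. *)
Lemma count_update (T : nat) (f g : nat -> nat) (D : seq nat) (a : pred nat) :
  uniq D -> (forall z, z \in D -> z < T) ->
  (forall z, z \in D -> a (f z) /\ ~~ a (g z)) ->
  (forall z, z \notin D -> a (g z) = a (f z)) ->
  count (fun z => a (g z)) (iota 0 T) + size D = count (fun z => a (f z)) (iota 0 T).
Proof.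
move=> uD DT Da Dn.
have -> : size D = count (mem D) (iota 0 T).
  rewrite -size_filter; apply/perm_size/uniq_perm => //.
    by rewrite filter_uniq // iota_uniq.
  move=> z; rewrite mem_filter mem_iota /=.
  by case zD: (z \in D) => //=; rewrite add0n DT.
rewrite -count_predUI [X in _ + X](eq_count (a2 := pred0)) ?count_pred0 ?addn0.
  apply: eq_count => z /=; case zD: (z \in D).
    by have [-> _] := Da z zD; rewrite orbT.
  by rewrite orbF Dn // zD.
by move=> z /=; case zD: (z \in D); rewrite ?andbF // andbT; apply/negbTE; have [] := Da z zD.
Qed.

Lemma certs_ext T m S S' b w : (forall z, (S z == 1) = (S' z == 1)) ->
  certs T m S b w = certs T m S' b w.
Proof. by move=> e; apply: eq_count => x; rewrite !e. Qed.

Lemma wp_insert T q k lev (s : astate) (P : nat -> astate -> Prop) items :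
  0 < T -> sized T q k lev -> represents T q k lev items s -> va s 4 <= T ->
  (forall n s', n + potential T q k s' <= potential T q k s + 10 ->
     represents T q k lev (rcons items (va s 4)) s' ->
     fixes [:: 0; 1; 2; 3; 4] s s' -> P n s') ->
  wp (Xof T) insert s P.
Proof.
move=> T0 sz [pr [S2 ST SI] [uL LS cq] [ct dead] [b5 b7]] wT HP.
set w := va s 4 in wT HP *; set S := ar s 0 in S2 ST SI LS ct dead *.
set L := mkseq _ _ in uL LS; set M := q * q in cq ct *.
have [XN XT qT] := sized_X _ _ _ _ T0 sz.
have [/andP[q3' q3] /andP[Tk k4] levk kl l2] := sz.
have q2 : 2 <= q by case: (q) q3 => [|[|]] //; rewrite !expnS ?expn0 ?mul0n ?exp1n; lia.
have M4 : 4 <= M by rewrite /M; nia.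
have qM : 2 * q <= M by rewrite /M; nia.
have [[v0 v5 v6 v13] _] := pr.
have sL : size L = va s 12 by rewrite size_mkseq.
have LT z : z \in L -> z <= T.
  by rewrite LS leqNgt => /eqP Sz; apply/negP => /ST; rewrite Sz.
have cT : va s 12 <= T.+1.
  rewrite -sL -[T.+1](size_iota 0); apply: uniq_leq_size => // z /LT.
  by rewrite mem_iota.
have closed z : (S z == 0) = false -> subset_sum (rcons items w) z \/ T < z.
  by move=> /negbT Sz; case: (leqP z T) => zT; [left; apply/subset_sum_rcons; left; apply/SI | right].
apply: wp_cond => /=; rewrite -/w => dw.
  apply: wp_nop; apply: HP => //; first by rewrite addnC leq_add2l.
  split=> //; split=> // z zT; split=> [Sz|/subset_sum_rcons[/SI h|[wz /SI h]]].
  - by apply/subset_sum_rcons; left; apply/SI.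
  - exact: h.
  - by rewrite -/S -(subnK wz); apply: dead => //; [rewrite subnK | apply: h; lia].
apply: wp_then.
apply: (wp_count_stale T q k lev _ _ w) => //.
move=> n1 s1 nl1 fr1 fa1 d4 /=.
apply: wp_then; apply: wp_let; rewrite /= fr1 //; first by lia.
set s2 := updv s1 22 _.
have fx2 : fixes [:: 0; 1; 2; 3; 4; 5; 6; 7; 8; 9; 11; 12; 13] s s2.
  by apply: fixes_updv => //; apply: frame_fixes fr1.
have pr2 : params T q k lev s2.
  by apply: (params_frame pr); rewrite /= ?fa1 // => x xl; apply: fx2; move: xl; rewrite !inE => /or4P[|||/or4P[|||/orP[]]] /eqP->.
have [a0 a1 a2 a3] : [/\ ar s1 0 = S, ar s1 1 = ar s 1, ar s1 2 = ar s 2 & ar s1 3 = ar s 3].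
  by split; rewrite fa1.
have v12 : va s1 12 = va s 12 by rewrite fr1.
apply: wp_then; apply: (wp_scan_blocks T q k lev _ _ w);
  rewrite /s2 /= ?a0 ?a1 ?a3 ?v12 ?fr1 //.
- by move=> b bq; rewrite ct.
rewrite -/s2 -/L => n3 s3 nl3 fx3 fa3 f13 /=.
have [c0 c2] : ar s3 0 = S /\ ar s3 2 = ar s 2 by rewrite !fa3.
have fx3' : fixes [:: 0; 1; 2; 3; 4; 5; 6; 7; 8; 9; 11; 12; 13] s s3.
  by move=> x xl; rewrite fx3 // fx2.
set A1 := sums T S w (snap S T.+1) in f13.
have sA1 : size A1 <= T.+1.
  apply: leq_trans (size_sums _ _ _ _) _; rewrite size_filter.
  by apply: leq_trans (count_size _ _) _; rewrite size_iota.
have pr3 : params T q k lev s3.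
  by apply: (params_frame pr2); rewrite ?fa3 // => x xl; apply: fx3; move: xl; rewrite !inE => /or4P[|||/or4P[|||/orP[]]] /eqP->.
apply: wp_then; apply: (wp_scan_recent T q k lev _ _ w L A1) => //.
- by rewrite fx3'.
- by rewrite sL fx3'.
- by apply/allP => z /LT.
- by rewrite sL.
rewrite c0 fx3' // => n4 s4 nl4 fx4 fa4 f14 /=.
set A2 := sums T S w L in f14.
pose A := sums T S w (snap S T.+1 ++ L).
have AE : A = A1 ++ A2 by rewrite /A sums_cat.
have fx4' : fixes [:: 0; 1; 2; 3; 4; 5; 6; 7; 8; 9; 11; 12; 13] s s4.
  by move=> x xl; rewrite fx4 // fx3'.
have sz4 : va s4 22 = va s 12 + size A.
  by have := congr1 size f14; rewrite size_mkseq !size_cat sL AE size_cat.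
have uA : uniq A.
  rewrite map_inj_uniq => [|x y /eqP]; last by rewrite eqn_add2r => /eqP.
  apply: filter_uniq; rewrite cat_uniq filter_uniq ?iota_uniq // uL andbT /=.
  apply/hasPn => x xL; apply/negP; rewrite mem_filter => /andP[/eqP Sx _].
  by move: xL; rewrite LS Sx.
have memA z : (z \in A) = [&& w <= z, z <= T, S z == 0 & S (z - w) != 0].
  rewrite mem_sums mem_cat LS mem_filter mem_iota add0n.
  case: (leqP w z) => //= wz; case: (leqP z T) => //= zT; case: (S z == 0) => //=.
  by rewrite ltnS (leq_trans (leq_subr _ _) zT) andbT; have := S2 (z - w); case: (S (z - w)) => [|[|[|]]].
have AT z : z \in A -> z < T.+1 by rewrite memA ltnS => /and4P[].
have sA : size A <= T.+1.
  by rewrite -[T.+1](size_iota 0); apply: uniq_leq_size => // z /AT; rewrite mem_iota.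
have [e0 e2] : ar s4 0 = S /\ ar s4 2 = ar s 2 by rewrite !fa4.
have emp : (va s4 22 == va s4 12) = (size A == 0).
  by rewrite sz4 fx4' // -{2}[va s 12]addn0 eqn_add2l.
pose dd := if size A == 0 then (fun i => if i == w then 1 else ar s 2 i) else ar s 2.
apply: wp_then.
(* What follows is the same whether or not w gets marked, so it is treated once; [dd] is the array
   of marks in either case. *)
have mark n5 s5 : n5 <= 2 -> fixes [:: 0; 1; 2; 3; 4; 5; 6; 7; 8; 9; 11; 12; 13; 22] s4 s5 ->
    (forall j, j != 2 -> ar s5 j = ar s4 j) -> ar s5 2 = dd ->
    wp (Xof T) (Then (For 20 ($22) (Put 0 (Elt 1 ($20)) (#2)))
      (Then (Let 12 ($22)) (Cond ($12 < $6) Nop rebuild))) s5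
      (fun m s' => P (n1 + (1 + (n3 + (n4 + (n5 + m))))).+1 s').
  move=> nl5 fx5 fa5 f52.
  have D5 : mkseq (ar s5 1) (va s5 22) = L ++ A by rewrite fa5 // fx5 // f14 AE.
  have g0 : ar s5 0 = S by rewrite fa5 // e0.
  apply: wp_then; apply: (wp_mark T) => //; first by rewrite fx5 // sz4; lia.
  rewrite D5 g0 fx5 // sz4 => n6 s6 nl6 fx6 fa6 f60 /=.
  set S' := ar s6 0 in f60 *.
  have S'E z : S' z = if z \in A then 2 else S z.
    rewrite f60 mem_cat orbC; case: (z \in A) => //=.
    by rewrite LS; case: eqP => // ->.
  have v22 : va s6 22 = va s 12 + size A by rewrite fx6 // fx5.
  apply: wp_then; apply: wp_let; rewrite /= v22; first by lia.
  set s7 := updv s6 12 _.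
  have fx7 : fixes [:: 0; 1; 2; 3; 4; 5; 6; 7; 8; 9; 11; 13] s s7.
    apply: fixes_updv => // x xl; rewrite fx6; last first.
      by move: xl; rewrite !inE => /or4P[|||/or4P[|||/or4P[|||/or3P[]]]] /eqP->.
    have xl' : x \in [:: 0; 1; 2; 3; 4; 5; 6; 7; 8; 9; 11; 12; 13].
      by move: xl; rewrite !inE => /or4P[|||/or4P[|||/or4P[|||/or3P[]]]] /eqP->.
    by rewrite fx5 ?fx4' //; move: xl'; rewrite !inE => /or4P[|||/or4P[|||/or4P[|||/or4P[]]]] /eqP->.
  have fa7 j : j \notin [:: 0; 1; 2; 4] -> ar s7 j = ar s j.
    by rewrite !inE !negb_or => /and4P[j0 j1 j2 j4]; rewrite /= fa6 // fa5 // fa4 // fa3 //= fa1.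
  have pr7 : params T q k lev s7.
    by apply: (params_frame pr); rewrite ?fa7 // => x xl; apply: fx7; move: xl; rewrite !inE => /or4P[|||/or4P[|||/orP[]]] /eqP->.
  have D7 : mkseq (ar s7 1) (va s7 12) = L ++ A by rewrite /= fa6 // -D5 fx5 // sz4.
  have f72 : ar s7 2 = dd by rewrite /= fa6.
  have S'2 z : S' z <= 2 by rewrite S'E; case: ifP.
  have S'T z : T < z -> S' z = 0.
    by move=> Tz; rewrite S'E memA [z <= T]leqNgt Tz andbF; exact: ST.
  have S'0 z : z <= T -> (S' z != 0) = (S z != 0) || ((w <= z) && (S (z - w) != 0)).
    by move=> zT; rewrite S'E memA zT; case: (w <= z) => //=; case: (S z) => [|m] //=; case: ifP.
  have S'I z : z <= T -> (S' z != 0 <-> subset_sum (rcons items w) z).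
    move=> zT; rewrite S'0 //; split.
      by case/orP=> [/(SI _ zT) h|/andP[wz /SI h]]; apply/subset_sum_rcons; [left | right; split=> //; apply: h; lia].
    case/subset_sum_rcons=> [/(SI _ zT) -> //|[wz /SI h]].
    by rewrite wz h ?orbT //; lia.
  have uD : uniq (L ++ A).
    rewrite cat_uniq uL uA andbT; apply/hasPn => z; rewrite memA => /and4P[_ _ Sz _] /=.
    by rewrite LS (eqP Sz).
  have DS z : (z \in L ++ A) = (S' z == 2).
    by rewrite mem_cat S'E LS orbC; case: ifP.
  have S'1 z : (S z == 1) = (S' z == 1).
    by rewrite S'E; case: ifP => //; rewrite memA => /and4P[_ _ /eqP->].
  (* Closure under v survives: for a new sum x = y + w, y + v is an old sum, so x + v = (y + v) + w
     is a sum as well. *)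
  have ddS' v x : dd v != 0 -> x + v <= T -> S' x != 0 -> S' (x + v) != 0.
    rewrite /dd => dv xv; have xT : x <= T by lia.
    rewrite !S'0 //; case A0 : (size A == 0) dv => dv; last first.
      case/orP=> [Sx|/andP[wx Sx]]; first by rewrite dead.
      apply/orP; right; rewrite (leq_trans wx) ?leq_addr //= addnC -addnBA // addnC.
      by apply: dead => //; lia.
    have Aw y : y + w <= T -> S y != 0 -> S (y + w) != 0.
      move=> yw Sy; apply/negP => Syw.
      have : y + w \in A by rewrite memA leq_addl yw Syw addnK.
      by rewrite (size0nil (eqP A0)).
    have Sx' : (S x != 0) || (w <= x) && (S (x - w) != 0) -> S x != 0.
      by case/orP=> [//|/andP[wx Sx]]; rewrite -(subnK wx); apply: Aw; rewrite ?subnK.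
    move=> /Sx' Sx; apply/orP; left; move: dv => /=; case: (v =P w) => [e _|_ dv]; first by rewrite e; apply: Aw; rewrite -?e.
    exact: dead.
  have zS : zeros S' T.+1 + size A = zeros S T.+1.
    apply: (count_update T.+1 S S' A (fun v => v == 0)) => // z.
      by move=> zA; rewrite S'E zA; split=> //; move: zA; rewrite memA => /and4P[].
    by move=> zA; rewrite S'E (negbTE zA).
  have zD : zeros dd T.+1 + (size A == 0) = zeros (ar s 2) T.+1.
    rewrite /dd; case A0 : (size A == 0); last by rewrite addn0.
    have e : size [:: w] = true by [].
    rewrite -{}e; apply: (count_update T.+1 (ar s 2) _ [:: w] (fun v => v == 0)) => // z; rewrite inE.
    - by move/eqP->.
    - by move/eqP->; rewrite dw !eqxx.
    - by move/negbTE->.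
  have uS : unsnapped S' T.+1 = unsnapped S T.+1 by apply: eq_count => z; rewrite S'1.
  (* Either A is nonempty or w becomes marked, so size A + (size A == 0) >= 1, and M times this
     number dominates the fixed cost, which is of order q + M. *)
  have ticks : n1 + (1 + (n3 + (n4 + (n5 + (n6 + 1))))) + 10 +
      120 * M * (zeros S' T.+1 + zeros dd T.+1) <=
      120 * M * (zeros S T.+1 + zeros (ar s 2) T.+1).
    have sz3 : va s3 22 = va s 12 + size A1.
      by have := congr1 size f13; rewrite size_mkseq size_cat sL.
    have A1A : M * size A1 <= M * size A by rewrite leq_mul2l AE size_cat leq_addr orbT.
    have AM : size A <= M * size A by rewrite leq_pmull // (leq_trans _ M4).
    have AM1 : M <= M * (size A + (size A == 0)).
      by rewrite leq_pmulr //; case: (size A).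
    rewrite sz3 addKn -/M -mulnA in nl3.
    have -> : 120 * M * (zeros S T.+1 + zeros (ar s 2) T.+1) =
        120 * (M * (size A + (size A == 0))) + 120 * M * (zeros S' T.+1 + zeros dd T.+1).
      by rewrite -zS -zD; ring.
    rewrite leq_add2r; move: nl1 nl3 nl4 nl5 nl6 cq qM M4 A1A AM AM1; rewrite mulnDr.
    move: (M * size A1) (M * size A) (M * (size A == 0)) (size A).
    by clear; lia.
  have v66 : va s6 6 = M by have [[_ _ h _] _] := pr7.
  apply: wp_cond => /=; rewrite -/s7 v66.
    move=> /nat_of_bool1 c7; apply: wp_nop; apply: HP.
    - rewrite /potential -/M /= -/S' -/S f72 uS; move: ticks; clear; lia.
    - split=> //.
      + by rewrite D7.
      + split; last by rewrite f72.
        by move=> b v bq vT; rewrite fa7 // ct //; apply: certs_ext.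
      + by rewrite !fa7.
    - by move=> x xl; apply: fx7; move: xl; rewrite !inE => /or4P[|||/orP[]] /eqP->.
  move=> /nat_of_bool0 c7.
  have c7M : M <= va s 12 + size A.
    by move: c7 => /negbT; rewrite -leqNgt.
  have szD : size (L ++ A) <= T.+1.
    rewrite -[T.+1](size_iota 0); apply: uniq_leq_size => // z.
    by rewrite mem_cat mem_iota add0n ltnS => /orP[/LT|/AT].
  apply: (wp_rebuild T q k lev) => //.
  - by rewrite /= -sL -size_cat.
  - by move=> z; rewrite D7.
  - by move=> i; rewrite fa7.
  - by move=> i; rewrite fa7.
  move=> n8 s8 nl8 pr8 fx8 v812 fa8 f80 h5 h7 ct8; apply: HP.
  - have z8 : zeros (ar s8 0) T.+1 = zeros S' T.+1.
      by apply: eq_count => z; rewrite f80 /= -/S'; case: (S' z) => [|[|[|]]].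
    have u8 : unsnapped (ar s8 0) T.+1 + (va s 12 + size A) = unsnapped S' T.+1.
      rewrite -sL -size_cat; apply: (count_update T.+1 S' (ar s8 0) (L ++ A) (fun v => v != 1)) => // z.
      - by rewrite mem_cat => /orP[/LT|/AT].
      - by rewrite DS f80 /= -/S' => /eqP->.
      - by rewrite DS f80 /= -/S' => /negbTE->.
    (* With 2^k <= 4 T < 4 q^3 and 2^lev <= 2 k, the cost 400 * 2^(k + lev) * k * q is at most 3200
       q^4 k^2: a share of 3200 q^2 k^2 for each of the at least q^2 sums that leave the list. *)
    have cost8 : n8 <= 3200 * M * (k * k) * (va s 12 + size A).
      apply: leq_trans nl8 _; apply: (@leq_trans (3200 * M * (k * k) * M)); last by rewrite leq_mul2l c7M orbT.
      apply: (@leq_trans (400 * (q ^ 3 * 4 * (2 * k)) * k * q)); last first.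
        by apply/eq_leq; rewrite /M !expnS expn0 muln1; ring.
      rewrite !leq_mul2r leq_mul2l expnD leq_mul ?orbT // (leq_trans k4) // mulnC leq_mul2r.
      by rewrite ltnW.
    rewrite /potential -/M z8 (fa8 2) // f72 -/S -uS -u8.
    rewrite [3200 * M * (k * k) * (_ + _)]mulnDr; move: ticks cost8.
    by move: (3200 * M * (k * k) * (va s 12 + size A)); clear; lia.
  - split=> //.
    + split=> z; rewrite f80 /= -/S'.
      * by have := S'2 z; case: (S' z) => [|[|[|]]].
      * by move=> Tz; rewrite S'T.
      by move=> zT; rewrite -S'I //; case: (S' z) => [|[|[|]]].
    + rewrite v812 /=; split=> //; last by rewrite /M muln_gt0; case: (q) q2.
      by move=> z; rewrite f80 in_nil /= -/S'; case: (S' z) => [|[|[|]]].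
    + split=> //; rewrite (fa8 2) // f72 => v x dv xv.
      have := ddS' v x dv xv; rewrite !f80 /= -/S'.
      by case: (S' x) => [|[|[|]]] //; case: (S' (x + v)) => [|[|[|]]] // ? /(_ isT).
  - by move=> x xl; rewrite fx8 //; apply: fx7; move: xl; rewrite !inE => /or4P[|||/orP[]] /eqP->.
apply: wp_cond => /=; rewrite emp.
  move=> /nat_of_bool1 A0; apply: wp_put => //; apply: mark => //.
    by move=> j j2; exact: upda_other.
  by rewrite /dd A0 /= fx4' // e2.
move=> /nat_of_bool0 A0; apply: wp_nop; apply: mark => //.
by rewrite /dd A0.
Qed.

End InsertionStep.

(** * Serving operations *)

Section Service.
Local Open Scope nat_scope.

(* An insertion is carried out while serving the next operation, so that the
   first operation takes constant time. *)
Definition step : cmd :=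
  Then (Cond ($4) (Then (Cond ($5) Nop init) (Then insert (Let 4 (#0)))) Nop)
    (Cond ($1) (Let 3 (($2 == #0) + Elt 0 ($2))) (Let 4 ($2))).

(** A weight above tmax takes part in no queried sum, but may exceed the bound X on stored values.
    It is replaced by 0, which adds no sum and also means that nothing is pending. The guard is
    written in the machine language itself, since [bounded] may fail before it. *)
Definition dynamic_subset_sum : program :=
  Defs.Seq (If (Bin OpLt (Var 0) (Var 2)) (Assign 2 (Lit 0)) Skip) (compile step).

(** The cost of initialisation plus the largest value of the potential. *)
Definition budget (T q k : nat) : nat :=
  40 * T.+1 + 240 * (q * q) * T.+1 + 3200 * (q * q) * (k * k) * T.+1.

Definition fresh_store (s : astate) : Prop := va s 5 = 0 /\ forall j i, ar s j i = 0.

Lemma subset_sum_nil t : subset_sum [::] t <-> t = 0.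
Proof.
split=> [[B] | ->]; last by exists [::].
by rewrite subseq0 => /eqP-> /= <-.
Qed.

Lemma represents_init T q k lev s s' : 0 < T -> sized T q k lev -> params T q k lev s' ->
  fresh_store s -> va s' 12 = 1 ->
  (forall j, j \notin [:: 0; 1; 8; 9] -> ar s' j = ar s j) ->
  (forall i, ar s' 0 i = if i == 0 then 2 else ar s 0 i) ->
  (forall i, ar s' 1 i = if i == 0 then 0 else ar s 1 i) ->
  represents T q k lev [::] s'.
Proof.
move=> T0 [/andP[_ q3] _ _ _ _] pr [_ s0] v12 fa f0 f1.
have SE i : ar s' 0 i = if i == 0 then 2 else 0 by rewrite f0 s0.
have q2 : 1 < q * q.
  by case: (q) q3 => [|[|q']] //; rewrite !expnS ?expn0 ?mul0n; lia.
split=> //.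
- split=> z; rewrite SE; first by case: (z =P 0).
    by case: (z =P 0) => // ->.
  case: (z =P 0) => [-> _|ne _]; first by split=> // _; apply/subset_sum_nil.
  by split=> // /subset_sum_nil.
- have -> : mkseq (ar s' 1) (va s' 12) = [:: 0] by rewrite v12 /mkseq /= f1.
  rewrite v12; split=> // z.
  by rewrite inE SE; case: eqP.
- split; last by move=> w x; rewrite fa // s0.
  move=> b w _ _; rewrite fa // s0 /certs (eq_count (a2 := pred0)) ?count_pred0 //.
  by move=> x /=; rewrite SE; case: (x =P 0).
- by split=> i; rewrite fa // s0.
Qed.

(** The budget is stated with q and k before the machine has computed them; here they are identified
    with the computed ones. *)
Lemma sized_uniq T q k lev q' k' lev' : sized T q k lev -> sized T q' k' lev' ->
  q' = q /\ k' = k.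
Proof.
move=> [/andP[q1 q2] /andP[k1 k2] _ _ _] [/andP[q1' q2'] /andP[k1' k2'] _ _ _].
have qs : q.-1 < q' by rewrite -(@ltn_exp2r _ _ 3) //; exact: leq_ltn_trans q1 q2'.
have qs' : q'.-1 < q by rewrite -(@ltn_exp2r _ _ 3) //; exact: leq_ltn_trans q1' q2.
have ks : k < k'.+1 by rewrite -(@ltn_exp2l 2) // expnS; lia.
have ks' : k' < k.+1 by rewrite -(@ltn_exp2l 2) // expnS; lia.
by split; lia.
Qed.

Lemma zeros_le f n : zeros f n <= n.
Proof. by rewrite -{2}(size_iota 0 n) count_size. Qed.

Lemma unsnapped_le f n : unsnapped f n <= n.
Proof. by rewrite -{2}(size_iota 0 n) count_size. Qed.

Lemma potential_le T q k s : 40 * T.+1 + potential T q k s <= budget T q k.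
Proof.
rewrite /potential /budget -addnA leq_add2l.
apply: leq_add; last by rewrite leq_mul ?unsnapped_le.
have := zeros_le (ar s 0) T.+1; have := zeros_le (ar s 2) T.+1.
have -> : 240 * (q * q) * T.+1 = 120 * (q * q) * (T.+1 + T.+1) by ring.
by move=> h1 h2; rewrite leq_mul // leq_add.
Qed.

(* [credit] bounds the ticks still to be spent on m operations.  Initialisation
   is only paid for if some operation follows a pending insertion. *)
Definition served (T q k : nat) (items : seq nat) (s : astate) (m credit : nat) : Prop :=
  exists done : seq nat,
    [/\ va s 0 = T /\ va s 4 <= T,
        forall t, t <= T -> (subset_sum items t <-> subset_sum (rcons done (va s 4)) t) &
        [/\ fresh_store s, done = [::] &
           (if m <= (va s 4 == 0) then 0 else budget T q k) + 50 * m <= credit]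
        \/ exists lev, [/\ sized T q k lev, represents T q k lev done s &
           potential T q k s + 50 * m <= credit]].

Lemma subset_sum_rcons0 items t : subset_sum (rcons items 0) t <-> subset_sum items t.
Proof.
rewrite subset_sum_rcons subn0; split=> [[//|[_ //]]|]; by left.
Qed.

Lemma represents_answers T q k lev items s : represents T q k lev items s ->
  forall t, t <= T -> (((t == 0) + ar s 0 t != 0) <-> subset_sum items t).
Proof.
move=> [_ [_ _ SI] _ _ _] t tT; case: (t =P 0) => [->|_]; last by rewrite add0n SI.
by split=> // _; exists [::]; rewrite ?sub0seq.
Qed.

Lemma wp_insert_pending T q k lev items s (P : nat -> astate -> Prop) :
  0 < T -> sized T q k lev -> represents T q k lev items s -> va s 4 <= T ->
  (forall n s', n + potential T q k s' <= potential T q k s + 11 ->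
     represents T q k lev (rcons items (va s 4)) s' -> va s' 4 = 0 ->
     fixes [:: 0; 1; 2] s s' -> P n s') ->
  wp (Xof T) (Then insert (Let 4 (#0))) s P.
Proof.
move=> T0 sz rep pT HP; apply: wp_then; apply: wp_insert sz rep pT _ => //.
move=> n s' np rep' fx; apply: wp_let => //; apply: HP => //.
  by move: np; rewrite /potential /=; lia.
apply: fixes_updv => // x xl; apply: fx.
by move: xl; rewrite !inE => /or3P[] /eqP->.
Qed.

Lemma represents_frame {T q k lev items s s'} : represents T q k lev items s ->
  ar s' = ar s -> fixes [:: 0; 5; 6; 7; 8; 9; 11; 12; 13] s s' ->
  represents T q k lev items s'.
Proof.
move=> [pr S0 L0 c0 h0] as' fx; rewrite /represents as' fx //; split=> //.
apply: (params_frame pr); rewrite ?as' // => x xl; apply: fx.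
by move: xl; rewrite !inE => /or4P[|||/or4P[|||/orP[]]] /eqP->.
Qed.

Lemma eq_trans_rcons {T items done items' p} :
  (forall t, t <= T -> (subset_sum items t <-> subset_sum done t)) ->
  (forall t, t <= T -> (subset_sum items' t <-> subset_sum (rcons items p) t)) ->
  forall t, t <= T -> (subset_sum items' t <-> subset_sum (rcons done p) t).
Proof.
move=> e e' t tT; rewrite e' // !subset_sum_rcons e //.
by split=> -[?|[pt h]]; [left | right | left | right]; rewrite // ?e // -?e //; lia.
Qed.

(** The invariant handed on quantifies over the later state and item list, so that recording an
    insertion and answering a query both continue from here. *)
Lemma wp_flush T q k lev items s m credit (P : nat -> astate -> Prop) :
  0 < T -> sized T q k lev -> served T q k items s m.+1 credit ->
  (forall n s', fixes [:: 0; 1; 2] s s' -> va s' 4 = 0 ->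
     (forall s'' items', ar s'' = ar s' ->
        fixes [:: 0; 5; 6; 7; 8; 9; 11; 12; 13] s' s'' -> va s'' 4 <= T ->
        (forall t, t <= T ->
           (subset_sum items' t <-> subset_sum (rcons items (va s'' 4)) t)) ->
        served T q k items' s'' m (credit - (n + 10))) ->
     n + 10 <= credit -> (forall t, ar s' 0 t <= 2) ->
     (forall t, t <= T -> (((t == 0) + ar s' 0 t != 0) <-> subset_sum items t)) -> P n s') ->
  wp (Xof T) (Cond ($4) (Then (Cond ($5) Nop init) (Then insert (Let 4 (#0)))) Nop) s P.
Proof.
move=> T0 sz [done [[v0 v4] eqI st]] HP.
have p0E : va s 4 = 0 -> forall t, t <= T -> (subset_sum items t <-> subset_sum done t).
  by move=> p0 t tT; rewrite eqI // p0; exact: subset_sum_rcons0.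
case: st => [[fs d0 cr] | [lev' [sz' rep cr]]]; last first.
  apply: wp_cond => /= p0.
    apply: wp_then; apply: wp_cond => /= vq; last first.
      case: rep => [[[_ v5 _ _] _] _ _ _ _]; case: sz => /andP[_].
      by rewrite -v5 vq.
    apply: wp_nop; apply: (wp_insert_pending T q k lev' done) => // n s' np rep' p' fx.
    apply: HP => //; first 2 last.
    - by case: rep' => _ [].
    - by move=> t tT; rewrite (represents_answers _ _ _ _ _ _ rep') // -eqI.
    - move=> s'' items' as' fx' p4 eqI'; exists (rcons done (va s 4)).
      split; [by rewrite fx' // fx | exact: eq_trans_rcons eqI' | right].
      exists lev'; split=> //; first exact: represents_frame rep' as' fx'.
      by rewrite /potential as'; move: np cr; rewrite /potential; clear; lia.
    - by move: np cr; clear; lia.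
  apply: wp_nop; apply: HP => //; first 2 last.
  - by case: rep => _ [].
  - by move=> t tT; rewrite (represents_answers _ _ _ _ _ _ rep) // p0E.
  - move=> s'' items' as' fx' p4 eqI'; exists done.
    split; [by rewrite fx' | exact: eq_trans_rcons (p0E p0) eqI' | right].
    exists lev'; split=> //; first exact: represents_frame rep as' fx'.
    by rewrite /potential as'; move: cr; rewrite /potential; clear; lia.
  - by move: cr; clear; lia.
apply: wp_cond => /= p0.
  rewrite (negbTE p0) /= in cr.
  apply: wp_then; apply: wp_cond => /= vq; first by case: fs => v5; rewrite v5 in vq.
  apply: wp_init => // n0 s1 q' k' lev' n0l pr1 sz1 v12 fx1 fa1 f01 f11.
  have [eq' ek'] := sized_uniq _ _ _ _ _ _ _ sz sz1; rewrite eq' ek' in pr1 sz1.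
  have rep1 := represents_init _ _ _ _ _ _ T0 sz1 pr1 fs v12 fa1 f01 f11.
  have v41 : va s1 4 = va s 4 by rewrite fx1.
  apply: (wp_insert_pending T q k lev' [::]) => //; first by rewrite v41.
  move=> n s' np rep' p' fx; rewrite v41 in rep'.
  have pot1 := potential_le T q k s1.
  have fx' : fixes [:: 0; 1; 2] s s'.
    move=> x xl; rewrite fx //; move: xl; rewrite !inE.
    case/or3P => /eqP->; [by case: pr1 => [[-> _ _ _] _] | exact: fx1 | exact: fx1].
  apply: HP => //; first 2 last.
  - by case: rep' => _ [].
  - by move=> t tT; rewrite (represents_answers _ _ _ _ _ _ rep') // eqI // d0.
  - move=> s'' items' as' fxx p4 eqI'; exists (rcons [::] (va s 4)).
    split; [by rewrite fxx // fx' | by rewrite d0 in eqI; exact: eq_trans_rcons eqI' | right].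
    exists lev'; split=> //; first exact: represents_frame rep' as' fxx.
    by rewrite /potential as'; move: np cr pot1 n0l; rewrite /potential; clear; lia.
  - by move: np cr pot1 n0l; clear; lia.
apply: wp_nop; rewrite p0 eqxx in cr; apply: HP => //; first 2 last.
- by move=> t; rewrite fs.2.
(* Before initialisation the table is blank and only the empty sum exists, so the test for t = 0 in
   [step] gives the answer alone. *)
- move=> t tT; rewrite fs.2 addn0 p0E // d0 subset_sum_nil.
  by case: (t =P 0).
- move=> s'' items' as' fx' p4 eqI'; exists done.
  split; [by rewrite fx' | exact: eq_trans_rcons (p0E p0) eqI' | left].
  split=> //; first by case: fs => v5 a0; split; [rewrite fx' | rewrite as'].
  (* If no operation follows, no budget has to be handed on; otherwise at least two operations were
     left, so [credit] contains the budget. *)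
  case: m cr => [|m] cr; first by rewrite leq0n; move: cr; clear; lia.
  by rewrite [m.+2 <= _](_ : _ = false) // in cr; case: ifP => _; move: cr; clear; lia.
- by move: cr; clear; case: ifP => _; lia.
Qed.


Lemma bounded_updv X s x v : bounded X s -> v <= X -> bounded X (updv s x v).
Proof. by move=> [bv ba] vX; split=> // y /=; case: eqn. Qed.

Definition kind (o : operation) : nat := if o is Query _ then 1 else 0.
Definition payload (T : nat) (o : operation) : nat :=
  match o with Insert w => if w <= T then w else 0 | Query t => t end.

Lemma exec_step T W (tape : nat -> word W) s o n s' :
  0 < T -> 64 <= Xof T -> fits W (Xof T) -> T < 2 ^ W -> va s 0 = T -> bounded (Xof T) s ->
  T <= Xof T -> admissible T W o ->
  arun (Xof T) step (updv (updv s 1 (kind o)) 2 (payload T o)) n s' ->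
  bounded (Xof T) s' /\
  exists2 t, exec tape dynamic_subset_sum (present o (conc s)) t (conc s') & t <= 500 * n + 10.
Proof.
move=> T0 X64 XW TW v0 bs TX adm run.
set s1 := updv _ 2 _ in run.
have b1 : bounded (Xof T) s1.
  apply: bounded_updv; first by apply: bounded_updv => //; case: (o) => [w|t]; rewrite /kind; lia.
  case: (o) adm => [w|t] /=; last by lia.
  by case: ifP; lia.
split; first exact: arun_bounded run b1.
have sm : small_cmd step by vm_compute.
have [t xt lt] := arun_exec W (Xof T) tape X64 XW run sm b1.
pose raw := if o is Insert w then w else payload T o.
have presE : present o (conc s) = conc (updv (updv s 1 (kind o)) 2 raw).
  by rewrite /raw; case: (o).
have guard : exists2 g, exec tape (If (Bin OpLt (Var 0) (Var 2)) (Assign 2 (Lit 0)) Skip)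
    (present o (conc s)) g (conc s1) & g <= 8.
  have W1 : 1 < 2 ^ W by exact: leq_ltn_trans TW.
  rewrite presE; case: (leqP raw T) => rT.
    have e : raw = payload T o.
      by move: rT; rewrite /raw; case: (o) => //= w ->.
    exists 5 => //; apply: (@ExecIfFalse _ _ _ _ _ _ 1).
      by rewrite /= v0 ltnNge rT mod0n.
    by rewrite e; exact: ExecSkip.
  exists 6 => //; apply: (@ExecIfTrue _ _ _ _ _ _ 2).
    by rewrite /= v0 rT modn_small.
  have -> : conc s1 = Defs.set_var (conc (updv (updv s 1 (kind o)) 2 raw)) 2
      (Defs.eval W (conc (updv (updv s 1 (kind o)) 2 raw)) (Lit 0)).
    rewrite /= mod0n; congr State; apply/funext => y /=.
    rewrite !eqnE; case: (y =P 2) => // _.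
    move: rT; rewrite /raw; case: (o) adm => [w _ Tw|t' /= tT Tt] /=.
      by rewrite leqNgt Tw.
    by rewrite ltnNge tT in Tt.
  exact: ExecAssign.
have [g xg lg] := guard.
by exists (g + t); [exact: ExecSeq xg xt | lia].
Qed.

Lemma wp_step T q k lev items s m credit o (P : nat -> astate -> Prop) :
  0 < T -> sized T q k lev -> served T q k items s m.+1 credit ->
  (if o is Query t then t <= T else true) ->
  (forall n s', n + 1 <= credit ->
     served T q k (if o is Insert w then rcons items w else items) s' m (credit - (n + 1)) ->
     (if o is Query t then (va s' 3 != 0 <-> subset_sum items t) else True) -> P n s') ->
  wp (Xof T) step (updv (updv s 1 (kind o)) 2 (payload T o)) P.
Proof.
move=> T0 sz sv oT HP.
set s1 := updv _ 2 _.
have sv1 : served T q k items s1 m.+1 credit by exact: sv.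
apply: wp_then; apply: (wp_flush T q k lev items _ m credit) => // n s' fx v4 nxt ncr S2 ans.
have [[v0 v1] v2] : (va s' 0 = va s1 0 /\ va s' 1 = va s1 1) /\ va s' 2 = va s1 2.
  by rewrite !fx.
have vT : va s 0 = T by case: sv => done [[]].
have [[XN XT _] T1] := (sized_X _ _ _ _ T0 sz, T0).
have mono c c' items' s'' : c <= c' -> served T q k items' s'' m c -> served T q k items' s'' m c'.
  move=> cc [done [h1 h2 [[h3 h4 h5]|[lev' [h3 h4 h5]]]]]; exists done; split=> //.
    by left; split=> //; exact: leq_trans h5 cc.
  by right; exists lev'; split=> //; exact: leq_trans h5 cc.
case: o oT @s1 sv1 fx v0 v1 v2 HP => [w|t] /= oT sv1 fx v0 v1 v2 HP.
  apply: wp_cond => /=; rewrite v1 // => _.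
  apply: wp_let; rewrite /= v2; first by case: ifP => //; lia.
  apply: HP => //; first by move: ncr; clear; lia.
  apply: (mono (credit - (n + 10))); first by clear; lia.
  apply: nxt => //=; first exact: fixes_updv.
    by case: ifP.
  move=> t tT; rewrite !subset_sum_rcons; case: (leqP w T) => wT //.
  rewrite subn0; split=> [[h|[wt _]]|[h|[_ h]]]; try by left.
  by move: (leq_trans wt tT); rewrite leqNgt wT.
apply: wp_cond => /=; rewrite v1 // => _.
apply: wp_let; rewrite /= v2.
  have := S2 t; case: (t == 0); lia.
apply: HP => //; first by move: ncr; clear; lia.
  apply: (mono (credit - (n + 10))); first by clear; lia.
  apply: nxt => //=; first exact: fixes_updv.
    by rewrite v4.
  by move=> t' tT; rewrite v4 subset_sum_rcons0.
exact: ans.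
Qed.

End Service.

(** * Running time *)

Section Runs.
Local Open Scope nat_scope.

Lemma serves_all T q k lev W (tape : nat -> word W) :
  0 < T -> sized T q k lev -> fits W (Xof T) -> T < 2 ^ W ->
  forall ops items s credit,
  bounded (Xof T) s -> served T q k items s (size ops) credit ->
  all (admissible T W) ops ->
  exists n answers s',
    [/\ serves tape dynamic_subset_sum (conc s) ops n answers (conc s'),
        n <= 500 * credit &
        forall ops1 t ops2, ops = ops1 ++ Query t :: ops2 ->
          (nth false answers (size ops1) <-> subset_sum (items ++ inserted ops1) t)].
Proof.
move=> T0 sz XW TW; have [_ XT _] := sized_X _ _ _ _ T0 sz.
have [X64 TX] : 64 <= Xof T /\ T <= Xof T by split; lia.
elim=> [|o ops IH] items s credit bs sv /= adm.
  by exists 0, [::], s; split=> //; [exact: ServesNil | case].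
case/andP: adm => admo adm.
have oT : is_true (if o is Query t then t <= T else true) by case: (o) admo.
have v0 : va s 0 = T by case: sv => d [[]].
pose items' := if o is Insert w then rcons items w else items.
have [n [s1 [run [cr sv1 ans]]]] : wp (Xof T) step (updv (updv s 1 (kind o)) 2 (payload T o))
    (fun n s' => [/\ n + 1 <= credit, served T q k items' s' (size ops) (credit - (n + 1)) &
       if o is Query t then (va s' 3 != 0 <-> subset_sum items t) else True]).
  by apply: (wp_step T q k lev items s (size ops) credit o) => // n s' c1 c2 c3; split.
have [b1 [t xt lt]] := exec_step T W tape s o n s1 T0 X64 XW TW v0 bs TX admo run.
have [n' [answers [s' [svs nl' ans']]]] := IH _ _ _ b1 sv1 adm.
exists (t + n'), ((va s1 3 != 0) :: answers), s'; split.
- exact: ServesCons xt svs.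
(* The extra tick in [n + 1] covers the at most 10 steps outside the compiled code. *)
- by move: cr lt nl'; clear; lia.
case=> [|o1 ops1] t' ops2 [eo eops].
  by move: ans; rewrite eo /inserted /= cats0.
rewrite /= (ans' ops1 t' ops2 eops) -eo /items' /inserted /=.
by case: (o) => [w|t''] //=; rewrite cat_rcons.
Qed.

Definition empty_store (T : nat) : astate := AState (fun x => if eqn x 0 then T else 0) (fun _ _ => 0).

Definition ops_credit (T q k m : nat) : nat := (if m <= 1 then 0 else budget T q k) + 50 * m.

Lemma pow_chain X Y Z a b c : 1 < Y -> 0 < b -> X <= Y ^ a -> a * b < c ->
  Y ^ c <= Z -> X ^ b < Z.
Proof.
move=> Y1 b0 XY abc; apply: leq_trans; apply: (@leq_ltn_trans ((Y ^ a) ^ b)).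
  by rewrite leq_exp2r.
by rewrite -expnM ltn_exp2l.
Qed.

(** As 64 = 2^6 <= (T + 1)^6, all stored values are at most (T + 1)^9, and 9 * 40 = 360 < 361; this
    is the origin of the exponent 361. *)
Lemma fits_Xof T W : 0 < T -> T.+1 ^ 361 <= 2 ^ W -> fits W (Xof T).
Proof.
move=> T0; apply: (pow_chain (Xof T) T.+1 (2 ^ W) 9 40 361) => //.
rewrite /Xof (_ : 9 = 6 + 3) // expnD leq_mul2r; apply/orP; right.
by rewrite (_ : 64 = 2 ^ 6) // leq_exp2r.
Qed.

Lemma runs T W (tape : nat -> word W) ops : 0 < T -> T < 2 ^ W -> fits W (Xof T) ->
  all (admissible T W) ops ->
  exists q k lev n answers s', [/\ sized T q k lev,
    serves tape dynamic_subset_sum (initial_state T) ops n answers s',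
    drawn s' = 0, n <= 500 * ops_credit T q k (size ops) &
    forall ops1 t ops2, ops = ops1 ++ Query t :: ops2 ->
          (nth false answers (size ops1) <-> subset_sum (inserted ops1) t)].
Proof.
move=> T0 TW XW adm.
(* Suitable parameters exist because [init] computes them. *)
have [q [k [lev sz]]] : exists q k lev, sized T q k lev.
  have [n [s [_ h]]] : wp (Xof T) init (empty_store T) (fun _ _ => exists q k lev, sized T q k lev).
    by apply: wp_init => // n s q k lev _ _ sz _ _ _ _ _; exists q, k, lev.
  exact: h.
have [_ XT _] := sized_X _ _ _ _ T0 sz.
have bs : bounded (Xof T) (empty_store T).
  by split=> // x /=; case: eqn => //; lia.
have sv : served T q k [::] (empty_store T) (size ops) (ops_credit T q k (size ops)).
  by exists [::]; split=> // [t _|]; [rewrite subset_sum_rcons0 | left].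
have [n [answers [s' [svs nl ans]]]] := serves_all T q k lev W tape T0 sz XW TW _ _ _ _ bs sv adm.
by exists q, k, lev, n, answers, (conc s'); split.
Qed.

End Runs.

(** * The bound in real numbers *)

Section RealBound.
Variable R : realType.

Lemma ln_le (x y : R) : 0 < x -> x <= y -> ln x <= ln y.
Proof. by move=> x0 xy; rewrite ler_ln // posrE // (lt_le_trans x0). Qed.

Lemma ln2_gt0 : 0 < ln 2 :> R.
Proof. by rewrite ln_gt0 // ltr1n. Qed.

Lemma budget_le (T q k : nat) : (0 < q)%N -> (0 < k)%N ->
  (budget T q k <= 3480 * ((q * q) * (k * k) * T.+1))%N.
Proof.
move=> q0 k0; rewrite /budget -!mulnA.
have h : (T.+1 <= q * (q * (k * (k * T.+1))))%N by rewrite !mulnA leq_pmull // !muln_gt0 q0 k0.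
have h' : (q * (q * T.+1) <= q * (q * (k * (k * T.+1))))%N.
  by rewrite !leq_mul2l !mulnA leq_pmull ?muln_gt0 ?k0 ?orbT.
move: h h'; move: (q * (q * (k * (k * T.+1))))%N (q * (q * T.+1))%N => a b; lia.
Qed.

(** With c = T^(1/3): q <= 2 c and T + 1 <= 2 c^3, while T >= 2 gives k ln 2 <= ln (4 T) <= 3 ln T.
    The constant is 3480 * 72 = 250560 rounded up; of the three factors ln 2, two come from k^2 and
    one from ln m >= ln 2. *)
Lemma sized_real (T q k lev m : nat) : (1 < T)%N -> (1 < m)%N -> sized T q k lev ->
  (budget T q k)%:R <= 251 * 10 ^+ 3 / ln 2 ^+ 3 *
     (T%:R `^ (5%:R / 3%:R) * ln T%:R ^+ 2 * ln m%:R) :> R.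
Proof.
move=> T1 m1 [/andP[q1 q3] /andP[k1 k4] _ _ _].
have T0 : (0 < T)%N by rewrite ltnW.
have q0 : (0 < q)%N by case: (q) q3 => //; rewrite expn0 ?muln0 ltn0.
have k0 : (0 < k)%N by case: (k) k1 => //; rewrite expn0; lia.
have l2 := ln2_gt0.
pose c : R := T%:R `^ 3^-1.
have c3 : c ^+ 3 = T%:R.
  by rewrite -powR_mulrn ?powR_ge0 // -powRrM mulVf ?pnatr_eq0 // powRr1 ?ler0n.
have c5 : T%:R `^ (5%:R / 3%:R) = c ^+ 5.
  by rewrite -powR_mulrn ?powR_ge0 // -powRrM mulrC.
have c0 : 0 <= c by exact: powR_ge0.
have c1 : 1 <= c.
  by rewrite -(@ler_pXn2r _ 3) ?nnegrE ?ler01 // c3 expr1n ler1n.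
have qc : q%:R <= 2 * c.
  have : q.-1%:R <= c by rewrite -(@ler_pXn2r _ 3) ?nnegrE ?ler0n // c3 -natrX ler_nat.
  by rewrite -{2}(prednK q0) -addn1 natrD; lra.
have Tc : T.+1%:R <= 2 * c ^+ 3.
  by rewrite c3 -natrM ler_nat; lia.
have kT : k%:R * ln 2 <= 3 * ln T%:R :> R.
  have -> : k%:R * ln 2 = ln (2 ^+ k) :> R by rewrite lnXn ?mulr_natl // ltr0n.
  have : ln (2 ^+ k) <= ln (2 * 2 * T%:R) :> R.
    apply: ln_le; first by rewrite exprn_gt0 // ltr0n.
    by rewrite -!natrM -natrX ler_nat.
  have : ln 2 <= ln T%:R :> R by apply: ln_le; rewrite ?ltr0n // ler_nat.
  by rewrite !lnM ?posrE ?mulr_gt0 ?ltr0n //; lra.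
have mL : ln 2 <= ln m%:R :> R by apply: ln_le; rewrite ?ltr0n // ler_nat.
rewrite c5.
have b1 : (budget T q k)%:R <= 3480%:R * (q%:R ^+ 2 * k%:R ^+ 2 * T.+1%:R) :> R.
  by rewrite !expr2 -!natrM ler_nat budget_le.
apply: le_trans b1 _.
have b2 : q%:R ^+ 2 <= (2 * c) ^+ 2 by rewrite ler_pXn2r // nnegrE ?ler0n // mulr_ge0.
have b3 : (k%:R * ln 2) ^+ 2 <= (3 * ln T%:R) ^+ 2 :> R.
  by rewrite ler_pXn2r // nnegrE ?mulr_ge0 ?ler0n ?ln_ge0 ?ler1n // ltW.
have -> : 251 * 10 ^+ 3 / ln 2 ^+ 3 * (c ^+ 5 * ln T%:R ^+ 2 * ln m%:R) =
   251 * 10 ^+ 3 * c ^+ 5 * ln T%:R ^+ 2 * ln m%:R / ln 2 ^+ 3 by ring.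
rewrite ler_pdivlMr ?exprn_gt0 //.
have -> : 3480%:R * (q%:R ^+ 2 * k%:R ^+ 2 * T.+1%:R) * ln 2 ^+ 3 =
   3480%:R * (q%:R ^+ 2 * T.+1%:R * (k%:R * ln 2) ^+ 2 * ln 2) :> R by ring.
have q20 : 0 <= q%:R ^+ 2 * T.+1%:R :> R by rewrite mulr_ge0 ?exprn_ge0 ?ler0n.
have k20 : 0 <= (k%:R * ln 2) ^+ 2 :> R by exact: sqr_ge0.
have b4 : q%:R ^+ 2 * T.+1%:R * (k%:R * ln 2) ^+ 2 * ln 2 <=
    (2 * c) ^+ 2 * (2 * c ^+ 3) * (3 * ln T%:R) ^+ 2 * ln m%:R.
  apply: ler_pM => //; [exact: mulr_ge0 | exact: ltW |].
  apply: ler_pM => //; apply: ler_pM => //; rewrite ?exprn_ge0 ?ler0n //.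
apply: le_trans (ler_wpM2l _ b4) _; first by rewrite ler0n.
have M0 : 0 <= c ^+ 5 * ln T%:R ^+ 2 * ln m%:R.
  by rewrite !mulr_ge0 ?exprn_ge0 ?ln_ge0 ?ler1n // ltnW.
have -> : 3480%:R * ((2 * c) ^+ 2 * (2 * c ^+ 3) * (3 * ln T%:R) ^+ 2 * ln m%:R) =
  3480%:R * 72%:R * (c ^+ 5 * ln T%:R ^+ 2 * ln m%:R) :> R by ring.
have -> : 251 * 10 ^+ 3 * c ^+ 5 * ln T%:R ^+ 2 * ln m%:R =
  251 * 10 ^+ 3 * (c ^+ 5 * ln T%:R ^+ 2 * ln m%:R) by ring.
by apply: ler_wpM2r => //; lra.
Qed.

Lemma credit_arith (b m Z D K : R) : 0 <= Z -> 0 <= D -> 0 <= K -> 0 <= m ->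
  b <= D * Z \/ b <= K * m -> b + 50 * m <= (50 + K + D) * (m + Z).
Proof.
move=> Z0 D0 K0 m0 b_le.
have [Km KZ] := (mulr_ge0 K0 m0, mulr_ge0 K0 Z0).
have [Dm DZ] := (mulr_ge0 D0 m0, mulr_ge0 D0 Z0).
have -> : (50 + K + D) * (m + Z) = 50 * m + 50 * Z + K * m + K * Z + D * m + D * Z by ring.
by case: b_le; lra.
Qed.

Definition time_constant : R := 500 * (50 + 120 * 10 ^+ 3 + 251 * 10 ^+ 3 / ln 2 ^+ 3).

Lemma credit_real (T q k lev m : nat) : (0 < T)%N -> (0 < m)%N -> sized T q k lev ->
  (500 * ops_credit T q k m)%:R / m%:R <=
    time_constant * (1 + T%:R `^ (5%:R / 3%:R) * ln T%:R ^+ 2 * ln m%:R / m%:R) :> R.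
Proof.
move=> T0 m0 sz.
have l2 := ln2_gt0.
pose D : R := 251 * 10 ^+ 3 / ln 2 ^+ 3.
have D0 : 0 <= D by rewrite divr_ge0 ?mulr_ge0 ?exprn_ge0 ?ler0n // ltW.
pose Z : R := T%:R `^ (5%:R / 3%:R) * ln T%:R ^+ 2 * ln m%:R.
have Z0 : 0 <= Z by rewrite !mulr_ge0 ?powR_ge0 ?exprn_ge0 ?ln_ge0 ?ler1n.
have mR : 0 < m%:R :> R by rewrite ltr0n.
have m1 : 1 <= m%:R :> R by rewrite ler1n.
rewrite ler_pdivrMr // -/Z.
have -> : time_constant * (1 + Z / m%:R) * m%:R = time_constant * (m%:R + Z).
  by rewrite -[LHS]mulrA [(1 + _) * _]mulrDl mul1r divfK // gt_eqF.
suff key : (ops_credit T q k m)%:R <= (50 + 120 * 10 ^+ 3 + D) * (m%:R + Z).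
  by rewrite natrM /time_constant -/D -mulrA ler_pM2l ?ltr0n.
have K0 : 0 <= 120 * 10 ^+ 3 :> R by rewrite mulr_ge0 ?exprn_ge0 ?ler0n.
rewrite /ops_credit natrD natrM; apply: credit_arith => //.
case: leqP => [_|m2]; first by left; exact: mulr_ge0.
have [T1|T1] := ltnP 1 T; first by left; exact: (sized_real _ _ _ _ _ T1 m2 sz).
(* For T = 1 the logarithmic term is 0, so the budget is charged to the operations: q, k <= 2 makes
   it at most 104400. *)
right; rewrite -[leLHS]mulr1; apply: ler_pM => //.
have eT : T = 1%N by lia.
have kq : (q <= 2)%N /\ (k <= 2)%N.
  move: sz; rewrite eT => -[/andP[q1 _] /andP[_ k4] _ _ _]; split.
    by rewrite leqNgt; apply/negP => q2; move: q1; rewrite leqNgt => /negP; apply; rewrite -{1}(exp1n 3) ltn_exp2r //; lia.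
  by rewrite -(@leq_exp2l 2).
have q4 : q%:R * q%:R <= 4 :> R by rewrite -natrM ler_nat (leq_mul kq.1 kq.1).
have k4 : k%:R * k%:R <= 4 :> R by rewrite -natrM ler_nat (leq_mul kq.2 kq.2).
have qk : (q%:R * q%:R) * (k%:R * k%:R) <= 4 * 4 :> R.
  by apply: ler_pM => //; exact: mulr_ge0.
by rewrite /budget eT !natrD !natrM; lra.
Qed.

End RealBound.

Theorem theorem1 (R : realType) :
  exists (p : program) (kappa : nat) (C : R),
    forall (tmax W : nat) (ops : seq operation),
      (0 < tmax)%N ->
      (tmax < 2 ^ W)%N ->
      (tmax.+1 ^ kappa <= 2 ^ W)%N ->
      (0 < size ops)%N ->
      all (admissible tmax W) ops ->
      (forall tape : nat -> word W,
         exists (n : nat) (answers : seq bool) (s : state),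
           serves tape p (initial_state tmax) ops n answers s /\
           n%:R / (size ops)%:R <=
             C * (1 + tmax%:R `^ (5%:R / 3%:R) * ln tmax%:R ^+ 2
                        * ln (size ops)%:R / (size ops)%:R)) /\
      (forall (ops1 : seq operation) (t : nat) (ops2 : seq operation),
         ops = ops1 ++ Query t :: ops2 ->
         exists N : nat,
           1 - 1 / tmax%:R ^+ 3 <=
             tape_prob R N
               (answers_correctly (W := W) p tmax ops1 t ops2 N)).
Proof.
exists dynamic_subset_sum, 361%N, (time_constant R) => T W ops T0 TW /(fits_Xof T W T0) XW m0 adm.
split=> [tape | ops1 t ops2 eops].
  have [q [k [lev [n [answers [s [sz svs _ nl _]]]]]]] := runs T W tape ops T0 TW XW adm.
  exists n, answers, s; split=> //.
  apply: le_trans (credit_real R T q k lev (size ops) T0 m0 sz).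
  by rewrite ler_pM2r ?invr_gt0 ?ltr0n // ler_nat.
(* No random word is drawn, so the empty prefix of the tape suffices and the event has probability
   1. *)
exists 0%N; rewrite /tape_prob.
set E := [set f | _]; have -> : E = [set: {ffun 'I_0 -> word W}].
  apply/setP => f; rewrite !inE; apply/asboolP.
  have [q [k [lev [n [answers [s [sz svs d0 nl ans]]]]]]] := runs T W (tape_of f) ops T0 TW XW adm.
  exists n, answers, s; split; first by rewrite -eops.
    by rewrite d0.
  exact: ans eops.
rewrite cardsT divff; first by rewrite lerBlDr lerDl divr_ge0 ?exprn_ge0 ?ler0n.
by rewrite card_ffun [#|'I_0|]card_ord expn0 oner_neq0.
Qed.
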